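(* Let $f\colon\Sigma\to\mathbb{H}^3$ be a weakly complete flat front and let $\rho=\theta/\omega$ be the ratio of its canonical forms, a meromorphic function on the universal covering surface $\widetilde\Sigma$ of $\Sigma$. If $\rho$ is nonconstant, then $\rho$ can omit at most three values, i.e. $(\mathbb{C}\cup\{\infty\})\setminus\rho(\widetilde\Sigma)$ has at most three elements.
   Context: Hyperbolic space. $\mathbb{H}^3=\{aa^*: a\in SL(2,\mathbb{C})\}$ (with $a^*={}^t\bar a$), i.e. the set of $2\times2$ Hermitian matrices $X$ with $\det X=1$, $\mathrm{trace}\,X>0$, with the metric induced from the Lorentzian inner product on Hermitian matrices determined by $\langle X,X\rangle=-\det X$; it is the simply connected space of constant curvature $-1$. Flat fronts. Let $\Sigma$ be a connected oriented two-manifold. A smooth map $f\colon\Sigma\to\mathbb{H}^3$ is a front if there is a unit vector field $n$ along $f$ (unit normal) with $\langle df,n\rangle=0$ such that $(f,n)\colon\Sigma\to T_1\mathbb{H}^3$ is an immersion. Its parallel fronts are $f_t=(\cosh t)f+(\sinh t)n$, $t\in\mathbb{R}$. A front $f$ is a flat front if for each $p\in\Sigma$ there is $t\in\mathbb{R}$ such that $f_t$ is a flat immersion at $p$. Canonical forms. For a flat front $f$ there exist a unique complex structure on $\Sigma$ and a holomorphic immersion $\mathcal{E}_f\colon\widetilde\Sigma\to SL(2,\mathbb{C})$, where $\widetilde\Sigma$ is the universal cover of $\Sigma$, that is Legendrian, i.e. $\mathcal{E}_f^{-1}d\mathcal{E}_f$ is off-diagonal, with $f=\mathcal{E}_f\mathcal{E}_f^*$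 and $n=\mathcal{E}_f e_3\mathcal{E}_f^*$, $e_3=\begin{pmatrix}1&0\\0&-1\end{pmatrix}$. Write $\mathcal{E}_f^{-1}d\mathcal{E}_f=\begin{pmatrix}0&\theta\\ \omega&0\end{pmatrix}$; the holomorphic one-forms $\omega,\theta$ on $\widetilde\Sigma$ are the canonical forms of $f$. The quantities $|\omega|^2$, $|\theta|^2$ and $|\rho|$, where $\rho=\theta/\omega$, are well defined on $\Sigma$, and $ds^2_{1,1}=|\omega|^2+|\theta|^2$ is a conformal Riemannian metric on $\Sigma$. The flat front $f$ is weakly complete if $ds^2_{1,1}$ is complete. *)

(* Defs.v *)
From HB Require Import structures.
From mathcomp Require Import all_boot all_order all_algebra.
From mathcomp Require Import all_classical all_reals all_analysis.
From mathcomp Require Import complex.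

Set Implicit Arguments.
Unset Strict Implicit.
Unset Printing Implicit Defensive.

Import Order.TTheory GRing.Theory Num.Theory.
Import numFieldNormedType.Exports.

Local Open Scope classical_set_scope.
Local Open Scope ring_scope.
Local Open Scope complex_scope.

(** * Differentiation in the coordinate plane *)

Fixpoint Ck_on (R : realType) (k : nat) (U : set 'rV[R]_2)
    (g : 'rV[R]_2 -> R) : Prop :=
  match k with
  | 0 => forall x, U x -> {for x, continuous g}
  | k'.+1 => (forall x, U x -> {for x, continuous g}) /\
      forall i : 'I_2, (forall x, U x -> derivable g x 'e_i) /\
                       Ck_on k' U (fun x => 'D_'e_i g x)
  end.

(* C^oo; only used on open sets U *)
Definition smooth_on (R : realType) (U : set 'rV[R]_2) (g : 'rV[R]_2 -> R) :=
  forall k, Ck_on k U g.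

Definition mx_smooth_on (R : realType) (U : set 'rV[R]_2)
    (F : 'rV[R]_2 -> 'M[R[i]]_2) :=
  forall a b, smooth_on U (fun x => complex.Re (F x a b)) /\
              smooth_on U (fun x => complex.Im (F x a b)).

(* i-th real partial derivative of a matrix-valued map *)
Definition mx_pd (R : realType) (i : 'I_2) (F : 'rV[R]_2 -> 'M[R[i]]_2)
    (x : 'rV[R]_2) : 'M[R[i]]_2 :=
  \matrix_(a, b) ('D_'e_i (fun y => complex.Re (F y a b)) x
                  +i* 'D_'e_i (fun y => complex.Im (F y a b)) x).

(* The identification of C with the coordinate plane R^2. *)
Definition plane_of_C (R : realType) (z : R[i]) : 'rV[R]_2 :=
  \row_j (if j == 0 then complex.Re z else complex.Im z).
Definition C_of_plane (R : realType) (x : 'rV[R]_2) : R[i] := x 0 0 +i* x 0 1.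

(* R[i]^o is the normed R[i]-module R[i], so derivable _ z 1 and derive1 below
   are complex differentiability and the complex derivative. *)
Definition cderivable (R : realType) (g : R[i] -> R[i]) (z : R[i]) : Prop :=
  derivable (g : R[i]^o -> R[i]^o) (z : R[i]^o) 1.
Definition cderive (R : realType) (g : R[i] -> R[i]) (z : R[i]) : R[i] :=
  derive1 (g : R[i]^o -> R[i]^o) z.

(** * Surfaces *)

Record chart (R : realType) (S : topologicalType) := Chart {
  cdom : set S;
  ccod : set 'rV[R]_2;
  cmap :> S -> 'rV[R]_2;
  cinv : 'rV[R]_2 -> S;
  cdom_open : open cdom;
  ccod_open : open ccod;
  cmap_cod : forall p, cdom p -> ccod (cmap p);
  cinv_dom : forall x, ccod x -> cdom (cinv x);
  cmapK : forall p, cdom p -> cinv (cmap p) = p;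
  cinvK : forall x, ccod x -> cmap (cinv x) = x;
  cmap_cts : forall p, cdom p -> {for p, continuous cmap};
  cinv_cts : forall x, ccod x -> {for x, continuous cinv} }.

Definition trans (R : realType) (S : topologicalType) (c d : chart R S)
    (x : 'rV[R]_2) : 'rV[R]_2 := d (cinv c x).

Definition overlap (R : realType) (S : topologicalType) (c d : chart R S) :
    set 'rV[R]_2 := [set x | ccod c x /\ cdom d (cinv c x)].

Definition covers (R : realType) (S : topologicalType) (A : set (chart R S)) :=
  forall p : S, exists2 c, A c & cdom c p.

Definition smooth_trans (R : realType) (S : topologicalType) (c d : chart R S) :=
  forall j : 'I_2, smooth_on (overlap c d) (fun x => trans c d x 0 j).

Definition holomorphic_trans (R : realType) (S : topologicalType)
    (c d : chart R S) :=
  forall z, overlap c d (plane_of_C z) ->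
    cderivable (fun w => C_of_plane (trans c d (plane_of_C w))) z.

(* A is an oriented smooth atlas making S a connected oriented 2-manifold. *)
Record oriented_surface (R : realType) (S : topologicalType)
    (A : set (chart R S)) : Prop := {
  surface_hausdorff : hausdorff_space S;
  surface_second_countable : @second_countable S;
  surface_connected : connected [set: S];
  surface_covers : covers A;
  surface_smooth : forall c d, A c -> A d -> smooth_trans c d;
  surface_oriented : forall c d, A c -> A d ->
    forall x, overlap c d x -> 0 < \det ('J (trans c d) x) }.

(* B is a complex atlas on S inducing the smooth structure of A. *)
Record complex_structure (R : realType) (S : topologicalType)
    (A B : set (chart R S)) : Prop := {
  complex_covers : covers B;
  complex_holomorphic : forall z w, B z -> B w -> holomorphic_trans z w;
  complex_compatible : forall c z, A c -> B z ->
    smooth_trans c z /\ smooth_trans z c }.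

(** * Universal covering *)

Definition covering_map (S T : topologicalType) (pi : T -> S) : Prop :=
  [/\ continuous pi, range pi = [set: S] &
   forall p : S, exists U : set S, [/\ open U, U p &
     exists (I : Type) (V : I -> set T),
       [/\ trivIset [set: I] V, pi @^-1` U = \bigcup_i V i &
        forall i, [/\ open (V i), set_bij (V i) U pi &
          forall W, open W -> W `<=` V i -> open (pi @` W)]]]].

Definition simply_connected (R : realType) (T : topologicalType) : Prop :=
  (forall x y : T, exists g : R -> T,
     [/\ {within `[0, 1], continuous g}, g 0 = x & g 1 = y]) /\
  (forall (x : T) (g : R -> T),
     {within `[0, 1], continuous g} -> g 0 = x -> g 1 = x ->
     exists H : R * R -> T,
       [/\ {within `[0, 1] `*` `[0, 1], continuous H},
        forall s, s \in `[0, 1] -> H (s, 0) = g s,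
        forall s, s \in `[0, 1] -> H (s, 1) = x &
        forall t, t \in `[0, 1] -> H (0, t) = x /\ H (1, t) = x]).

Definition universal_covering (R : realType) (S T : topologicalType)
    (pi : T -> S) : Prop := covering_map pi /\ simply_connected R T.

(* c is a chart of T whose coordinate function is z \o pi.  For z in a complex
   atlas of S, these are the charts of the lifted complex structure. *)
Definition lifted_chart (R : realType) (S T : topologicalType) (pi : T -> S)
    (z : chart R S) (c : chart R T) : Prop :=
  forall t, cdom c t -> cdom z (pi t) /\ c t = z (pi t).

Definition lifted_atlas (R : realType) (S T : topologicalType) (pi : T -> S)
    (B : set (chart R S)) : set (chart R T) :=
  [set c | exists2 z, B z & lifted_chart pi z c].

(** * Hyperbolic space *)

Definition ctr (R : realType) (X : 'M[R[i]]_2) : 'M[R[i]]_2 :=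
  map_mx Num.conj X^T.

Definition SL2 (R : realType) : set 'M[R[i]]_2 := [set a | \det a = 1].

Definition hermitian2 (R : realType) : set 'M[R[i]]_2 := [set X | ctr X = X].

(* polarization of <X, X> = - det X *)
Definition lorentz (R : realType) (X Y : 'M[R[i]]_2) : R :=
  complex.Re (\det X + \det Y - \det (X + Y)) / 2.

Definition H3 (R : realType) : set 'M[R[i]]_2 :=
  [set a *m ctr a | a in @SL2 R].

Definition T1H3 (R : realType) (X v : 'M[R[i]]_2) : Prop :=
  [/\ H3 X, hermitian2 v, lorentz X v = 0 & lorentz v v = 1].

(** * Gaussian curvature of a metric g in coordinates *)

Definition christoffel (R : realType) (g : 'rV[R]_2 -> 'M[R]_2)
    (k i j : 'I_2) (x : 'rV[R]_2) : R :=
  2^-1 * \sum_l invmx (g x) k l *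
    ('D_'e_i (fun y => g y j l) x + 'D_'e_j (fun y => g y i l) x
     - 'D_'e_l (fun y => g y i j) x).

(* l-th component of R(d_i, d_j) d_k, R(X, Y) = [D_X, D_Y] - D_[X, Y] *)
Definition riemann_tensor (R : realType) (g : 'rV[R]_2 -> 'M[R]_2)
    (l k i j : 'I_2) (x : 'rV[R]_2) : R :=
  'D_'e_i (christoffel g l j k) x - 'D_'e_j (christoffel g l i k) x
  + \sum_m (christoffel g l i m x * christoffel g m j k x
            - christoffel g l j m x * christoffel g m i k x).

Definition gauss_curvature (R : realType) (g : 'rV[R]_2 -> 'M[R]_2)
    (x : 'rV[R]_2) : R :=
  (\sum_l g x 0 l * riemann_tensor g l 1 0 1 x) / \det (g x).

(** * Flat fronts *)

Definition in_chart (R : realType) (S : topologicalType) (c : chart R S)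
    (f : S -> 'M[R[i]]_2) (x : 'rV[R]_2) : 'M[R[i]]_2 := f (cinv c x).

Definition smooth_map (R : realType) (S : topologicalType)
    (A : set (chart R S)) (f : S -> 'M[R[i]]_2) : Prop :=
  forall c, A c -> mx_smooth_on (ccod c) (in_chart c f).

(* the differential of f at p, in the chart c, applied to the vector a *)
Definition dmap (R : realType) (S : topologicalType) (c : chart R S)
    (f : S -> 'M[R[i]]_2) (p : S) (a : 'rV[R]_2) : 'M[R[i]]_2 :=
  \sum_i (a 0 i)%:C *: mx_pd i (in_chart c f) (c p).

(* the front f with unit normal field nu *)
Record front (R : realType) (S : topologicalType) (A : set (chart R S))
    (f nu : S -> 'M[R[i]]_2) : Prop := {
  front_smooth : smooth_map A f;
  normal_smooth : smooth_map A nu;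
  front_T1H3 : forall p, T1H3 (f p) (nu p);
  front_normal : forall c p, A c -> cdom c p ->
    forall a, lorentz (dmap c f p a) (nu p) = 0;
  front_immersion : forall c p, A c -> cdom c p ->
    forall a, dmap c f p a = 0 -> dmap c nu p a = 0 -> a = 0 }.

Definition parallel_front (R : realType) (S : topologicalType)
    (f nu : S -> 'M[R[i]]_2) (t : R) (p : S) : 'M[R[i]]_2 :=
  ((expR t + expR (- t)) / 2)%:C *: f p + ((expR t - expR (- t)) / 2)%:C *: nu p.

Definition first_form (R : realType) (S : topologicalType) (c : chart R S)
    (f : S -> 'M[R[i]]_2) (x : 'rV[R]_2) : 'M[R]_2 :=
  \matrix_(i, j) lorentz (mx_pd i (in_chart c f) x) (mx_pd j (in_chart c f) x).

Definition flat_immersion_at (R : realType) (S : topologicalType)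
    (A : set (chart R S)) (f : S -> 'M[R[i]]_2) (p : S) : Prop :=
  \forall q \near p, forall c, A c -> cdom c q ->
    (forall a, dmap c f q a = 0 -> a = 0) /\
    gauss_curvature (first_form c f) (c q) = 0.

Definition flat_front (R : realType) (S : topologicalType)
    (A : set (chart R S)) (f nu : S -> 'M[R[i]]_2) : Prop :=
  front A f nu /\
  forall p, exists t, flat_immersion_at A (parallel_front f nu t) p.

(** * Canonical forms *)

Definition e3 (R : realType) : 'M[R[i]]_2 :=
  \matrix_(i, j) (if i == j then (if i == 0 then 1 else -1) else 0).

(* coordinate expression of E as a function of the complex coordinate of c *)
Definition in_cchart (R : realType) (T : topologicalType) (c : chart R T)
    (E : T -> 'M[R[i]]_2) (z : R[i]) : 'M[R[i]]_2 := E (cinv c (plane_of_C z)).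

Definition mx_cderive (R : realType) (F : R[i] -> 'M[R[i]]_2) (z : R[i]) :
    'M[R[i]]_2 := \matrix_(i, j) cderive (fun w => F w i j) z.

(* coefficient of dz in E^-1 dE at the point t, z the coordinate of c *)
Definition maurer_cartan (R : realType) (T : topologicalType)
    (E : T -> 'M[R[i]]_2) (c : chart R T) (t : T) : 'M[R[i]]_2 :=
  invmx (E t) *m mx_cderive (in_cchart c E) (C_of_plane (c t)).

Definition theta (R : realType) (T : topologicalType) (E : T -> 'M[R[i]]_2)
    (c : chart R T) (t : T) : R[i] := maurer_cartan E c t 0 1.
Definition omega (R : realType) (T : topologicalType) (E : T -> 'M[R[i]]_2)
    (c : chart R T) (t : T) : R[i] := maurer_cartan E c t 1 0.

(* E is a holomorphic Legendrian immersion of T, with its lifted complex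
   structure, into SL(2, C), lifting (f, nu). *)
Record legendrian_lift (R : realType) (S T : topologicalType)
    (B : set (chart R S)) (pi : T -> S) (f nu : S -> 'M[R[i]]_2)
    (E : T -> 'M[R[i]]_2) : Prop := {
  lift_SL2 : forall t, SL2 (E t);
  lift_holomorphic : forall c, lifted_atlas pi B c -> forall a b z,
    ccod c (plane_of_C z) -> cderivable (fun w => in_cchart c E w a b) z;
  lift_immersion : forall c t, lifted_atlas pi B c -> cdom c t ->
    mx_cderive (in_cchart c E) (C_of_plane (c t)) <> 0;
  lift_legendrian : forall c t, lifted_atlas pi B c -> cdom c t ->
    maurer_cartan E c t 0 0 = 0 /\ maurer_cartan E c t 1 1 = 0;
  lift_front : forall t, f (pi t) = E t *m ctr (E t);
  lift_normal : forall t, nu (pi t) = E t *m e3 R *m ctr (E t) }.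

(* Points of C u {oo}, with oo = None.  As E is an immersion, omega and theta
   have no common zero, so the zeros of omega are exactly the poles of
   theta / omega. *)
Definition quotient_of_forms (R : realType) (th om : R[i]) : option R[i] :=
  if om == 0 then None else Some (th / om).

Definition canonical_ratio (R : realType) (S T : topologicalType)
    (B : set (chart R S)) (pi : T -> S) (E : T -> 'M[R[i]]_2)
    (rho : T -> option R[i]) : Prop :=
  forall c t, lifted_atlas pi B c -> cdom c t ->
    rho t = quotient_of_forms (theta E c t) (omega E c t).

(** * Weak completeness *)

(* A conformal metric on S is given by its coefficients: lam z x |dz|^2 at the
   point of coordinate x in the complex chart z. *)

Definition C1_curve (R : realType) (g : R -> 'rV[R]_2) : Prop :=
  forall i, (forall t, derivable (fun s => g s 0 i) t 1) /\
            continuous (fun t => derive1 (fun s => g s 0 i) t).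

Definition arc_length (R : realType) (m : 'rV[R]_2 -> R)
    (g : R -> 'rV[R]_2) : R :=
  \int[lebesgue_measure]_(t in `[0, 1])
    Num.sqrt (m (g t) * \sum_i (derive1 (fun s => g s 0 i) t) ^+ 2).

(* Some piecewise C^1 curve from p to q has length l: such a curve is a finite
   concatenation of C^1 arcs, each contained in the domain of a chart. *)
Inductive curve_length (R : realType) (S : topologicalType)
    (B : set (chart R S)) (lam : chart R S -> 'rV[R]_2 -> R) :
    S -> S -> R -> Prop :=
  | curve_nil p : curve_length B lam p p 0
  | curve_cons p q l z g : curve_length B lam p q l ->
      B z -> C1_curve g -> (forall t, t \in `[0, 1] -> ccod z (g t)) ->
      cinv z (g 0) = q ->
      curve_length B lam p (cinv z (g 1)) (l + arc_length (lam z) g).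

Definition metric_dist (R : realType) (S : topologicalType)
    (B : set (chart R S)) (lam : chart R S -> 'rV[R]_2 -> R) (p q : S) :
    \bar R := ereal_inf [set l%:E | l in curve_length B lam p q].

Definition complete_metric (R : realType) (S : topologicalType)
    (B : set (chart R S)) (lam : chart R S -> 'rV[R]_2 -> R) : Prop :=
  forall u : nat -> S,
    (forall e : R, 0 < e -> exists N : nat, forall m n : nat,
       (N <= m)%N -> (N <= n)%N -> (metric_dist B lam (u m) (u n) < e%:E)%E) ->
    exists p : S, forall e : R, 0 < e -> exists N : nat, forall n : nat,
       (N <= n)%N -> (metric_dist B lam (u n) p < e%:E)%E.

Definition sqnormc (R : realType) (z : R[i]) : R :=
  complex.Re z ^+ 2 + complex.Im z ^+ 2.

(* lam is |omega|^2 + |theta|^2, regarded as a metric on S *)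
Definition is_ds11 (R : realType) (S T : topologicalType)
    (B : set (chart R S)) (pi : T -> S) (E : T -> 'M[R[i]]_2)
    (lam : chart R S -> 'rV[R]_2 -> R) : Prop :=
  forall z c t, B z -> lifted_chart pi z c -> cdom c t ->
    lam z (c t) = sqnormc (omega E c t) + sqnormc (theta E c t).

Definition weakly_complete (R : realType) (S T : topologicalType)
    (B : set (chart R S)) (pi : T -> S) (E : T -> 'M[R[i]]_2) : Prop :=
  exists2 lam, is_ds11 B pi E lam & complete_metric B lam.

(* Main.v *)
Require Import Defs.
From HB Require Import structures.
From mathcomp Require Import all_boot all_order all_algebra.
From mathcomp Require Import all_classical all_reals all_analysis.
From mathcomp Require Import complex ring lra.

Set Implicit Arguments.
Unset Strict Implicit.
Unset Printing Implicit Defensive.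

Import Order.TTheory GRing.Theory Num.Theory.
Import numFieldNormedType.Exports.

Local Open Scope classical_set_scope.
Local Open Scope card_scope.
Local Open Scope ring_scope.
Local Open Scope complex_scope.

(** Suppose [rho] omits four values.  They correspond to four linear forms
    [L j] in [theta] and [omega] without zeros, pairwise independent.  With [W]
    the Wronskian of [theta] and [omega], [V := W^5 / (L 0 * L 1 * L 2 * L 3)^4]
    is a well-defined holomorphic vector field on the universal covering: its
    complex time is a flat coordinate in which [W^5 = (L 0 * ... * L 3)^4].
    In that coordinate [S := \sum_j |L j|^(2/5)] satisfies
    [Delta (ln S) >= k * S^6], and the maximum principle (Ahlfors' lemma) bounds
    [S^3] by [C / r] at the center of a flow disc of radius [r]; hence the length
    element of [|omega|^2 + |theta|^2] is at most [C * r^(-5/6)] times the flat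
    one.  If [W] does not vanish identically, a flow disc cannot be arbitrarily
    large, and moving from a disc which cannot be enlarged to a smaller one near
    its boundary, again and again, produces a sequence of points at which the
    maximal radii tend to [0] geometrically while the distances, of order
    [r^(1/6)], are summable.  Completeness gives a limit point, near which the
    radii are bounded below by local existence: a contradiction.  Zeros of [W]
    are stationary points of the flow and need no separate treatment.  So
    [W = 0] and [rho] is constant. *)


(** * The modulus *)

(** The exponents answer two demands. One-forms have weight 1 and their Wronskian weight 3, so
    [W^a / (L 0 * ... * L 3)^b] is a vector field when [4 * b = 3 * a + 1]. In its time,
    [|W| = |L 0 * ... * L 3|^s] with [s = b / a]. For [S := \sum_j |L j|^t], the share of a pair
    [i], [k] in [Delta (ln S)] is a multiple of [|L i * L k|^(t + 2 * s - 2) * |L m * L n|^(2 * s) /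
    S^2], where [m], [n] is the other pair. At any point at most one form is small compared with the
    others, and it can be placed in the pair [i], [k]; a lower bound by a power of [S] then follows
    if [t + 2 * s <= 2]. As [t > 0], this needs [s < 1] and rules out [a = b = 1]. The next integral
    solution is [a = 5], [b = 4], and [t = 2/5] makes the exponent zero. Three forms would need
    [3 * b = 3 * a + 1], hence [s > 1]. Homogeneity gives [r^(-5/6)], and it matters that this
    exponent is above [-1]. Flow discs are parametrized and need not be injective, so neither a
    developing map nor uniformization enters. Completeness holds on the surface while the flow lives
    on its cover: the last discs have to be kept in one sheet. *)

Section Modulus.
Variable R : realType.
Implicit Types (z w : R[i]) (x y : R).

(** The norm of [R[i]] takes its values in [R[i]] itself. This real-valued modulus makes the total
    order and linear arithmetic of [R] available. *)
Definition cabs z : R := Num.sqrt (sqnormc z).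

Lemma cabs_normc z : `|z| = (cabs z)%:C. Proof. exact: normc_def. Qed.

Lemma cabs_ge0 z : 0 <= cabs z. Proof. exact: sqrtr_ge0. Qed.

Lemma sqnormc_ge0 z : 0 <= sqnormc z.
Proof. by rewrite addr_ge0 // sqr_ge0. Qed.

Lemma cabs_sq z : cabs z ^+ 2 = sqnormc z.
Proof. by rewrite sqr_sqrtr // sqnormc_ge0. Qed.

Lemma cabsM z w : cabs (z * w) = cabs z * cabs w.
Proof. by apply: complexI; rewrite rmorphM /= -!cabs_normc normrM. Qed.

Lemma cabsD z w : cabs (z + w) <= cabs z + cabs w.
Proof. by rewrite -lecR rmorphD /= -!cabs_normc ler_normD. Qed.

Lemma cabsN z : cabs (- z) = cabs z.
Proof. by apply: complexI; rewrite -!cabs_normc normrN. Qed.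

Lemma cabsBC z w : cabs (z - w) = cabs (w - z).
Proof. by rewrite -cabsN opprB. Qed.

Lemma cabs_eq0 z : (cabs z == 0) = (z == 0).
Proof.
rewrite -[RHS]normr_eq0 cabs_normc; apply/eqP/eqP => [-> //|].
by move=> /(congr1 (@complex.Re R)).
Qed.

Lemma cabs0 : cabs 0 = 0. Proof. by apply/eqP; rewrite cabs_eq0. Qed.

Lemma cabs1 : cabs 1 = 1.
Proof. by apply: complexI; rewrite -cabs_normc normr1. Qed.

Lemma cabs_gt0 z : (0 < cabs z) = (z != 0).
Proof. by rewrite lt_def cabs_ge0 andbT cabs_eq0. Qed.

Lemma cabsV z : cabs z^-1 = (cabs z)^-1.
Proof. by apply: complexI; rewrite fmorphV /= -!cabs_normc normfV. Qed.

Lemma cabsX z n : cabs (z ^+ n) = cabs z ^+ n.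
Proof. by elim: n => [|n IH]; rewrite ?expr0 ?cabs1 // !exprS cabsM IH. Qed.

Lemma cabs_real x : cabs x%:C = `|x|.
Proof. by rewrite /cabs /sqnormc /= expr0n addr0 sqrtr_sqr. Qed.

Lemma Re_le_cabs z : `|complex.Re z| <= cabs z.
Proof. by rewrite -sqrtr_sqr ler_wsqrtr // lerDl sqr_ge0. Qed.

Lemma Im_le_cabs z : `|complex.Im z| <= cabs z.
Proof. by rewrite -sqrtr_sqr ler_wsqrtr // lerDr sqr_ge0. Qed.

Lemma cabs_le_ReIm z : cabs z <= `|complex.Re z| + `|complex.Im z|.
Proof.
case: z => a b /=; rewrite [X in cabs X]complexE /= (le_trans (cabsD _ _)) //.
rewrite cabsM !cabs_real lerD2l.
by rewrite /cabs /sqnormc /= expr0n expr1n add0r sqrtr1 mul1r.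
Qed.

Lemma cabs_sub z w u : cabs (z - w) <= cabs (z - u) + cabs (u - w).
Proof. by rewrite (le_trans _ (cabsD _ _)) // addrA subrK. Qed.

Lemma cabs_lipschitz z w : `|cabs z - cabs w| <= cabs (z - w).
Proof.
have := cabsD (z - w) w; have := cabsD (w - z) z.
by rewrite !subrK [cabs (w - z)]cabsBC ler_norml => ? ?; apply/andP; split; lra.
Qed.

Lemma cabsi : cabs ('i%C : R[i]) = 1.
Proof. by rewrite /cabs /sqnormc /= expr0n expr1n add0r sqrtr1. Qed.

Lemma sqnormcM z w : sqnormc (z * w) = sqnormc z * sqnormc w.
Proof. by rewrite -!cabs_sq cabsM exprMn. Qed.

Lemma complex_eqP z w :
  complex.Re z = complex.Re w -> complex.Im z = complex.Im w -> z = w.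
Proof. by case: z => a b; case: w => c d /= -> ->. Qed.

End Modulus.

(** * Cousin's lemma *)

Lemma dist_within (R : realDomainType) (s u t v d : R) : s <= t -> t <= u ->
  s <= v -> v <= u -> u - s < d -> `|v - t| < d.
Proof.
by move=> st tu sv vu us; rewrite ltr_norml; apply/andP; split; lra.
Qed.

(** The supremum of the endpoints reached from [a] is itself reached, and validity on short
    intervals around it leads further unless it is [b]. This is compactness of the segment as an
    induction on intervals. It serves wherever a segment is cut into small pieces, [P] being an
    estimate, an equivalence between the two ends or the existence of a curve. *)
Lemma cousin (R : realType) (P : R -> R -> Prop) (a b : R) : a <= b ->
  (forall s u t, a <= s -> s <= u -> u <= t -> t <= b ->
     P s u -> P u t -> P s t) ->
  (forall c, a <= c -> c <= b -> exists2 d, 0 < d & forall s t,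
     a <= s -> s <= c -> c <= t -> t <= b -> t - s < d -> P s t) ->
  P a b.
Proof.
move=> ab Padd Ploc.
pose A := [set x | [/\ a <= x, x <= b & P a x]].
have Aa : A a.
  split => //; have [d d0 h] := Ploc a (lexx _) ab.
  by apply: h => //; rewrite subrr.
have supA : has_sup A.
  by split; [exists a | exists b => x []].
set m := sup A.
have am : a <= m by apply: ub_le_sup => //; exact: supA.2.
have mb : m <= b.
  by apply: ge_sup; [exists a|move=> x []].
have [d d0 h] := Ploc m am mb.
have [x [ax xb Pax] mx] := sup_adherent d0 supA.
have xm : x <= m by apply: ub_le_sup; [exact: supA.2|].
have Pam : P a m.
  by apply: (Padd a x m) => //; apply: h => //; rewrite -/m in mx; lra.
have [mb'|] := ltP m b; last by move=> bm; have <- : m = b by lra.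
set t := Num.min b (m + d / 2).
have mt : m < t by rewrite lt_min mb' /=; lra.
have tb : t <= b by rewrite ge_min lexx.
have tm2 : t <= m + d / 2 by rewrite ge_min lexx orbT.
have : A t.
  split => //; first by lra.
  by apply: (Padd a m t) => //; [lra|apply: h => //; lra].
move=> At; have : t <= m by apply: ub_le_sup => //; exact: supA.2.
by lra.
Qed.

(** * Derivatives of complex-valued functions *)

(* A function [f] of a variable ranging over [X], the values of the variable
   being read in [R[i]] through [j]: this covers functions of a complex
   ([j = id]) and of a real ([j = real_complex]) variable. *)
Section Derivative.
Variable R : realType.
Implicit Types (X Y : Type).

Definition contat X (j : X -> R[i]) (A : set X) (f : X -> R[i]) (x : X) :=
  forall e : R, 0 < e -> exists2 d, 0 < d & forall y, A y ->
    cabs (j y - j x) < d -> cabs (f y - f x) < e.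

(** There is no quotient and [y] is confined to [A], so the derivatives at the ends of a segment are
    covered by the same definition. *)
Definition dervat X (j : X -> R[i]) (A : set X) (f : X -> R[i]) (x : X)
    (l : R[i]) :=
  forall e : R, 0 < e -> exists2 d, 0 < d & forall y, A y ->
    cabs (j y - j x) < d ->
    cabs (f y - f x - l * (j y - j x)) <= e * cabs (j y - j x).

Section OneVariable.
Variables (X : Type) (j : X -> R[i]) (A : set X).
Implicit Types (f g : X -> R[i]) (x : X).

Lemma contat_cst c x : contat j A (fun=> c) x.
Proof. by move=> e e0; exists 1 => // y _ _; rewrite subrr cabs0. Qed.

Lemma contat_id x : contat j A j x.
Proof. by move=> e e0; exists e. Qed.

Lemma contatD f g x :
  contat j A f x -> contat j A g x -> contat j A (fun y => f y + g y) x.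
Proof.
move=> fx gx e e0; have e2 : 0 < e / 2 by lra.
have [d d0 hf] := fx _ e2; have [d' d'0 hg] := gx _ e2.
exists (Num.min d d'); first by rewrite lt_min d0.
move=> y Ay; rewrite lt_min => /andP[yd yd'].
rewrite opprD addrACA (le_lt_trans (cabsD _ _)) //.
by have := hf y Ay yd; have := hg y Ay yd'; lra.
Qed.

Lemma contatN f x : contat j A f x -> contat j A (fun y => - f y) x.
Proof.
move=> fx e e0; have [d d0 hf] := fx _ e0; exists d => // y Ay yd.
by rewrite -opprD cabsN hf.
Qed.

Lemma contatB f g x :
  contat j A f x -> contat j A g x -> contat j A (fun y => f y - g y) x.
Proof. by move=> fx gx; apply: contatD => //; apply: contatN. Qed.

Lemma contatM f g x :
  contat j A f x -> contat j A g x -> contat j A (fun y => f y * g y) x.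
Proof.
move=> fx gx e e0; set M := cabs (f x) + cabs (g x) + 1.
have M1 : 1 <= M by rewrite lerDr addr_ge0 // cabs_ge0.
have M0 : 0 < M by lra.
set e' := Num.min 1 (e / (2 * M)).
have e'0 : 0 < e' by rewrite lt_min ltr01 divr_gt0 // mulr_gt0.
have e'1 : e' <= 1 by rewrite ge_min lexx.
have e'e : e' * (2 * M) <= e.
  by rewrite -ler_pdivlMr ?mulr_gt0 // ge_min lexx orbT.
have [d d0 hf] := fx _ e'0; have [d' d'0 hg] := gx _ e'0.
exists (Num.min d d'); first by rewrite lt_min d0.
move=> y Ay; rewrite lt_min => /andP[yd yd'].
have -> : f y * g y - f x * g x =
  (f y - f x) * (g y - g x) + f x * (g y - g x) + (f y - f x) * g x by ring.
have {hf} hf := hf y Ay yd; have {hg} hg := hg y Ay yd'.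
rewrite (le_lt_trans (cabsD _ _)) //.
apply: le_lt_trans (lerD (cabsD _ _) (lexx _)) _; rewrite !cabsM.
have := cabs_ge0 (f y - f x); have := cabs_ge0 (g y - g x).
have := cabs_ge0 (f x); have := cabs_ge0 (g x).
rewrite /M in M1 M0 e'e *; nra.
Qed.

Lemma contatV f x :
  f x != 0 -> contat j A f x -> contat j A (fun y => (f y)^-1) x.
Proof.
move=> fx0 fx e e0; set m := cabs (f x).
have m0 : 0 < m by rewrite cabs_gt0.
set e' := Num.min (m / 2) (e * m ^+ 2 / 2).
have e'0 : 0 < e' by rewrite lt_min divr_gt0 // divr_gt0 // mulr_gt0 // exprn_gt0.
have [d d0 hf] := fx _ e'0; exists d => // y Ay yd.
have := hf y Ay yd; rewrite lt_min => /andP[h1 h2].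
have ym : m / 2 < cabs (f y).
  have := cabs_lipschitz (f x) (f y); rewrite cabsBC ler_norml => /andP[_].
  by rewrite -/m; lra.
have fy0 : f y != 0 by rewrite -cabs_gt0; lra.
have -> : (f y)^-1 - (f x)^-1 = (f x - f y) / (f y * f x) by field; rewrite ?fx0 ?fy0.
rewrite cabsM cabsV cabsM cabsBC -/m.
rewrite ltr_pdivrMr; last by apply: mulr_gt0 => //; lra.
apply: (lt_le_trans h2).
have : 0 <= e * m * (cabs (f y) - m / 2) by rewrite !mulr_ge0 //; lra.
by nra.
Qed.

Lemma dervat_contat f x l : dervat j A f x l -> contat j A f x.
Proof.
move=> fx e e0; have [d d0 h] := fx 1 ltr01.
set M := cabs l + 1; have M0 : 0 < M by have := cabs_ge0 l; rewrite /M; lra.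
exists (Num.min d (e / M)); first by rewrite lt_min d0 divr_gt0.
move=> y Ay; rewrite lt_min ltr_pdivlMr // => /andP[yd yM].
have := h y Ay yd; have := cabsD (f y - f x - l * (j y - j x)) (l * (j y - j x)).
by rewrite subrK cabsM /M in yM *; lra.
Qed.

(** Carathéodory's form: the slope, completed by [l], is continuous at [x]. It turns the sum,
    product and chain rules into algebra. As [j] is not assumed injective, the slope is prescribed
    on the whole fibre of [j x]. *)
Lemma dervatP f x l : dervat j A f x l <->
  exists phi : X -> R[i], [/\ contat j A phi x, phi x = l,
    forall y, A y -> f y - f x = phi y * (j y - j x) &
    forall y, j y = j x -> phi y = l].
Proof.
split => [fx|[phi [phic phix fphi phi0]] e e0]; last first.
  have [d d0 h] := phic _ e0; exists d => // y Ay yd.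
  rewrite fphi // -mulrBl cabsM ler_wpM2r ?cabs_ge0 //.
  by rewrite -phix; apply/ltW/h.
exists (fun y => if j y == j x then l else (f y - f x) / (j y - j x)).
have f0 y : A y -> j y = j x -> f y = f x.
  move=> Ay jE; apply/eqP; rewrite -subr_eq0 -cabs_eq0 eq_le cabs_ge0 andbT.
  have [d d0 h] := fx 1 ltr01.
  have := h y Ay; rewrite jE subrr cabs0 mulr0 subr0 mulr0.
  exact.
split; last by move=> y ->; rewrite eqxx.
- move=> e e0; have e2 : 0 < e / 2 by lra.
  have [d d0 h] := fx _ e2; exists d => // y Ay yd; rewrite eqxx.
  case: ifPn => jE; first by rewrite subrr cabs0.
  have jE' : j y - j x != 0 by rewrite subr_eq0.
  have -> : (f y - f x) / (j y - j x) - l =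
    (f y - f x - l * (j y - j x)) / (j y - j x) by field.
  rewrite cabsM cabsV ltr_pdivrMr ?cabs_gt0 //.
  apply: (le_lt_trans (h y Ay yd)); rewrite ltr_pM2r ?cabs_gt0 //; lra.
- by rewrite eqxx.
- move=> y Ay; case: ifPn => [/eqP jE|jE].
    by rewrite jE subrr mulr0 f0 // subrr.
  by rewrite divfK // subr_eq0.
Qed.

Lemma dervat_cst c x : dervat j A (fun=> c) x 0.
Proof.
by move=> e e0; exists 1 => // y _ _; rewrite mul0r !subrr cabs0 mulr_ge0 ?cabs_ge0 ?ltW.
Qed.

Lemma dervat_id x : dervat j A j x 1.
Proof.
by move=> e e0; exists 1 => // y _ _; rewrite mul1r !subrr cabs0 mulr_ge0 ?cabs_ge0 ?ltW.
Qed.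

Lemma dervatD f g x l m : dervat j A f x l -> dervat j A g x m ->
  dervat j A (fun y => f y + g y) x (l + m).
Proof.
move=> /dervatP[p [pc px fp p0]] /dervatP[q [qc qx gq q0]]; apply/dervatP.
exists (fun y => p y + q y); split => [||y Ay|y /[dup] /p0 -> /q0 -> //].
- exact: contatD.
- by rewrite px qx.
- by rewrite mulrDl -fp // -gq //; ring.
Qed.

Lemma dervatM f g x l m : A x -> dervat j A f x l -> dervat j A g x m ->
  dervat j A (fun y => f y * g y) x (l * g x + f x * m).
Proof.
move=> Ax fx gx; have gc := dervat_contat gx.
move: fx gx => /dervatP[p [pc px fp p0]] /dervatP[q [qc qx gq q0]].
have j0 y : A y -> j y = j x -> g y = g x.
  by move=> Ay jE; apply/eqP; rewrite -subr_eq0 gq // jE subrr mulr0.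
apply/dervatP.
exists (fun y => if j y == j x then l * g x + f x * m else p y * g y + f x * q y).
split=> [|||]; rewrite ?eqxx //; last 1 first.
- by move=> y ->; rewrite eqxx.
- have : contat j A (fun y => p y * g y + f x * q y) x.
    by apply: contatD; apply: contatM => //; apply: contat_cst.
  move=> h e e0; have [d d0 h'] := h e e0; exists d => // y Ay yd.
  rewrite eqxx; case: eqP => [_|_]; first by rewrite subrr cabs0.
  by rewrite -px -qx; apply: h'.
- move=> y Ay; case: eqP => [jE|_].
    have -> : f y = f x.
      by apply/eqP; rewrite -subr_eq0 fp // jE subrr mulr0.
    by rewrite j0 // jE !subrr mulr0.
  rewrite mulrDl mulrAC -fp // -mulrA -gq //; ring.
Qed.

Lemma dervatV f x l : A x -> f x != 0 -> dervat j A f x l ->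
  dervat j A (fun y => (f y)^-1) x (- l / f x ^+ 2).
Proof.
move=> Ax fx0 fx e e0.
have fc := dervat_contat fx.
have [d1 d10 h1] : exists2 d, 0 < d & forall y, A y -> cabs (j y - j x) < d ->
    f y != 0.
  have := fc (cabs (f x)); rewrite cabs_gt0 => /(_ fx0) [d d0 h].
  exists d => // y Ay yd; apply/eqP => fy0.
  by have := h y Ay yd; rewrite fy0 sub0r cabsN ltxx.
move: fx => /dervatP[p [pc px fp p0]].
have : dervat j (A `&` [set y | cabs (j y - j x) < d1]) (fun y => (f y)^-1) x
    (- l / f x ^+ 2).
  have c : contat j A (fun y => - p y / (f y * f x)) x.
    apply: contatM; first exact: contatN.
    apply: contatV; first by rewrite mulf_neq0.
    by apply: contatM => //; apply: contat_cst.
  move=> e1 e10; have [d d0 h] := c _ e10.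
  exists d => // y [Ay yd1] yd.
  have fy0 := h1 y Ay yd1.
  have -> : (f y)^-1 - (f x)^-1 = - p y / (f y * f x) * (j y - j x).
    have -> : - p y / (f y * f x) * (j y - j x) =
       - (p y * (j y - j x)) / (f y * f x) by ring.
    by rewrite -fp //; field; rewrite ?fx0 ?fy0.
  rewrite -mulrBl cabsM ler_wpM2r ?cabs_ge0 //.
  by have := h y Ay yd; rewrite px expr2 => /ltW.
move=> /(_ e e0) [d d0 h]; exists (Num.min d d1); first by rewrite lt_min d0.
by move=> y Ay; rewrite lt_min => /andP[yd yd1]; apply: h.
Qed.

Lemma dervat_eq f g x l : f x = g x ->
  (exists2 d, 0 < d & forall y, A y -> cabs (j y - j x) < d -> f y = g y) ->
  dervat j A f x l -> dervat j A g x l.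
Proof.
move=> fgx [d d0 fg] fx e e0; have [d' d'0 h] := fx e e0.
exists (Num.min d d'); first by rewrite lt_min d0.
by move=> y Ay; rewrite lt_min => /andP[yd yd']; rewrite -fg // -fgx; apply: h.
Qed.

Lemma contat_eq f g x : f x = g x ->
  (exists2 d, 0 < d & forall y, A y -> cabs (j y - j x) < d -> f y = g y) ->
  contat j A f x -> contat j A g x.
Proof.
move=> fgx [d d0 fg] fx e e0; have [d' d'0 h] := fx e e0.
exists (Num.min d d'); first by rewrite lt_min d0.
by move=> y Ay; rewrite lt_min => /andP[yd yd']; rewrite -fg // -fgx; apply: h.
Qed.

Lemma dervatN f x l : dervat j A f x l -> dervat j A (fun y => - f y) x (- l).
Proof.
move=> fx e e0; have [d d0 h] := fx e e0; exists d => // y Ay yd.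
by rewrite mulNr -!opprD cabsN h.
Qed.

Lemma dervatB f g x l m : dervat j A f x l -> dervat j A g x m ->
  dervat j A (fun y => f y - g y) x (l - m).
Proof. by move=> fx gx; apply: dervatD => //; apply: dervatN. Qed.

Lemma dervatZ c f x l :
  dervat j A f x l -> dervat j A (fun y => c * f y) x (c * l).
Proof.
move=> fx; have [->|c0] := eqVneq c 0.
  have -> : (fun y => 0 * f y) = (fun=> 0) by apply/funext => y; rewrite mul0r.
  by rewrite mul0r; apply: dervat_cst.
have c1 : 0 < cabs c by rewrite cabs_gt0.
move=> e e0; have [d d0 h] := fx (e / cabs c) (divr_gt0 e0 c1).
exists d => // y Ay yd.
rewrite -mulrA -!mulrBr cabsM -ler_pdivlMl // (le_trans (h y Ay yd)) //.
by rewrite mulrA [(cabs c)^-1 * _]mulrC.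
Qed.

Lemma dervatX f x l n : A x -> dervat j A f x l ->
  dervat j A (fun y => f y ^+ n) x (n%:R * f x ^+ n.-1 * l).
Proof.
move=> Ax fx; elim: n => [|n IH].
  by rewrite !mul0r; apply: (dervat_eq _ _ (dervat_cst 1 x)) => //; exists 1.
have := dervatM Ax fx IH; have -> : l * f x ^+ n + f x * (n%:R * f x ^+ n.-1 * l)
   = n.+1%:R * f x ^+ n * l.
  case: n {IH} => [|n]; first by rewrite /=; ring.
  by rewrite /= !exprS -[n.+2%:R]natr1; ring.
by apply: dervat_eq; rewrite ?exprS //; exists 1 => // y; rewrite exprS.
Qed.

Lemma dervat_subset (B : set X) f x l :
  B `<=` A -> dervat j A f x l -> dervat j B f x l.
Proof.
move=> BA fx e e0; have [d d0 h] := fx e e0.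
by exists d => // y /BA; apply: h.
Qed.

Lemma contat_subset (B : set X) f x :
  B `<=` A -> contat j A f x -> contat j B f x.
Proof.
move=> BA fx e e0; have [d d0 h] := fx e e0.
by exists d => // y /BA; apply: h.
Qed.

End OneVariable.

Lemma dervat_comp X Y (i : X -> R[i]) (j : Y -> R[i]) (A : set X) (B : set Y)
    (h : X -> Y) (f : Y -> R[i]) x l m :
  (forall x, A x -> B (h x)) -> dervat i A (j \o h) x m ->
  dervat j B f (h x) l -> dervat i A (f \o h) x (l * m).
Proof.
move=> AB hx fx; have hc := dervat_contat hx.
move: hx fx => /dervatP[p [pc px hp p0]] /dervatP[q [qc qx fq q0]].
have qhc : contat i A (q \o h) x.
  move=> e e0; have [d d0 h1] := qc e e0; have [d' d'0 h2] := hc d d0.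
  by exists d' => // y Ay yd; apply: h1; [apply: AB|apply: h2].
have c := contatM qhc pc.
move=> e e0; have [d d0 h1] := c e e0; exists d => // y Ay yd.
rewrite /= fq; last exact: AB.
have -> : j (h y) - j (h x) = p y * (i y - i x) by rewrite -hp.
rewrite mulrA -mulrBl cabsM ler_wpM2r ?cabs_ge0 //.
by have := h1 y Ay yd; rewrite /= px qx => /ltW.
Qed.

Lemma contat_comp X Y (i : X -> R[i]) (j : Y -> R[i]) (A : set X) (B : set Y)
    (h : X -> Y) (f : Y -> R[i]) x :
  (forall x, A x -> B (h x)) -> contat i A (j \o h) x ->
  contat j B f (h x) -> contat i A (f \o h) x.
Proof.
move=> AB hx fx e e0; have [d d0 h1] := fx e e0; have [d' d'0 h2] := hx d d0.
by exists d' => // y Ay yd; apply: h1; [apply: AB|apply: h2].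
Qed.

End Derivative.

Notation cdv f z l := (dervat id setT f z l).
Notation ccont f z := (contat id setT f z).
Notation rdv f z l := (dervat (fun x => x%:C) setT f z l).


(** * Functions of a real variable and the mean value inequality *)

Section RealVariable.
Variable R : realType.
Implicit Types (f g : R -> R) (x a b : R).

Notation rc := (fun x : R => x%:C).

Lemma cabs_rc x y : cabs (x%:C - y%:C) = `|x - y|.
Proof. by rewrite -rmorphB cabs_real. Qed.

Lemma continuous_ltP f x : {for x, continuous f} <->
  forall e, 0 < e -> exists2 d, 0 < d & forall y, `|y - x| < d ->
    `|f y - f x| < e.
Proof.
split=> [/cvgrPdist_lt h e e0|h].
  have /nbhs_ballP [d /= d0 hd] := h e e0; exists d => // y yx.
  by rewrite distrC; apply: hd; rewrite /ball /= distrC.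
apply/cvgrPdist_lt => e e0; have [d d0 hd] := h e e0.
apply/nbhs_ballP; exists d => //= y; rewrite /ball /= distrC => /hd.
by rewrite distrC.
Qed.

(** Both notions are compared through their Carathéodory forms. *)
Lemma is_derive_rdv f x a :
  is_derive x 1 f a <-> rdv (fun t => (f t)%:C) x a%:C.
Proof.
rewrite is_derive1_caratheodory dervatP; split=> [[g [fg gc ga]]|[p [pc px fp p0]]].
  exists (fun t => (g t)%:C); split => [e e0|||y /complexI ->]; last by rewrite ga.
  - move: gc => /continuous_ltP /(_ e e0) [d d0 h]; exists d => // y _.
    by rewrite !cabs_rc; apply: h.
  - by rewrite ga.
  - by move=> y _; rewrite -!rmorphB -rmorphM /= fg.
exists (fun t => complex.Re (p t)); split.
- move=> z; have /(congr1 (@complex.Re R)) := fp z Logic.I.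
  by rewrite -!rmorphB; case: (p z) => u v /=; rewrite mulr0 subr0.
- apply/continuous_ltP => e e0; have [d d0 h] := pc e e0; exists d => // y yx.
  apply: le_lt_trans (h y Logic.I _); last by rewrite cabs_rc.
  by rewrite -raddfB Re_le_cabs.
- by rewrite px.
Qed.

Lemma rdv_Re (g : R -> R[i]) x l : rdv g x l ->
  is_derive x 1 (fun t => complex.Re (g t)) (complex.Re l).
Proof.
move=> gx; apply/is_derive_rdv => e e0; have [d d0 h] := gx e e0.
exists d => // y _ yd; apply: le_trans (h y Logic.I yd).
have -> : (complex.Re (g y))%:C - (complex.Re (g x))%:C
    - (complex.Re l)%:C * (y%:C - x%:C) =
    (complex.Re (g y - g x - l * (y%:C - x%:C)))%:C.
  case: (g y) (g x) l {h gx} => [? ?] [? ?] [? ?].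
  by apply: complex_eqP => /=; ring.
by rewrite cabs_real Re_le_cabs.
Qed.

Lemma rdv_Im (g : R -> R[i]) x l : rdv g x l ->
  is_derive x 1 (fun t => complex.Im (g t)) (complex.Im l).
Proof.
move=> gx; have := rdv_Re (dervatZ (- 'i%C) gx).
have h (z : R[i]) : complex.Re (- 'i%C * z) = complex.Im z.
  by case: z => a b /=; ring.
by rewrite h; congr is_derive; apply/funext => t; exact: h.
Qed.

Lemma rdv_ReIm (g : R -> R[i]) x l :
  is_derive x 1 (fun t => complex.Re (g t)) (complex.Re l) ->
  is_derive x 1 (fun t => complex.Im (g t)) (complex.Im l) -> rdv g x l.
Proof.
move=> /is_derive_rdv gR /is_derive_rdv gI.
have := dervatD gR (dervatZ 'i%C gI).
rewrite -[X in dervat _ _ _ _ X]complexE.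
by apply: dervat_eq; rewrite -?complexE //; exists 1 => // y _ _; rewrite -complexE.
Qed.

(** Complex values allow no intermediate point. Instead, near each [c] the slope is at most
    [M + e'], these local bounds add up along the segment by [cousin], and the slack [e'] is
    arbitrary. *)
Lemma mean_value_ineq (A : set R) (g g' : R -> R[i]) a b M : a <= b ->
  (forall t, a <= t <= b -> A t) ->
  (forall t, a <= t <= b -> dervat rc A g t (g' t)) ->
  (forall t, a <= t <= b -> cabs (g' t) <= M) ->
  cabs (g b - g a) <= M * (b - a).
Proof.
move=> ab Aab gd gM; apply/ler_addgt0Pr => e e0.
set e' := e / (b - a + 1).
have e'0 : 0 < e' by apply: divr_gt0 => //; lra.
have : cabs (g b - g a) <= (M + e') * (b - a).
  apply: (@cousin R (fun s t => cabs (g t - g s) <= (M + e') * (t - s))) => //.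
    move=> s u t _ _ _ _ h1 h2; apply: le_trans (cabs_sub _ _ (g u)) _; lra.
  move=> c ac cb; have cab : a <= c <= b by rewrite ac.
  have [d d0 h] := gd c cab e' e'0; exists d => // s t as_ sc ct tb std.
  have main y : a <= y <= b -> `|y - c| < d -> cabs (g y - g c) <= (M + e') * `|y - c|.
    move=> yab; rewrite -cabs_rc => yc; have := h y (Aab _ yab) yc.
    have := cabsD (g y - g c - g' c * (y%:C - c%:C)) (g' c * (y%:C - c%:C)).
    rewrite subrK cabsM; have := gM c cab; rewrite !cabs_rc.
    by have := normr_ge0 (y - c); nra.
  apply: le_trans (cabs_sub _ _ (g c)) _.
  have := main t; have := main s.
  rewrite distrC (ger0_norm (_ : 0 <= c - s)); last by lra.
  rewrite (ger0_norm (_ : 0 <= t - c)); last by lra.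
  rewrite [cabs (g s - _)]cabsBC => h1 h2.
  have := h1 _ _; have := h2 _ _.
  move=> /(_ ltac:(lra) ltac:(lra)) => k2 /(_ ltac:(lra) ltac:(lra)) => k1.
  lra.
have : e' * (b - a) <= e.
  rewrite /e' mulrAC ler_pdivrMr; last by lra.
  nra.
lra.
Qed.

End RealVariable.
Notation rc := (fun x => x%:C).



(** * Integrals of continuous complex-valued functions *)

Section Integral.
Variable R : realType.
Implicit Types (a b t x : R) (g G : R -> R[i]).

Definition seg a b : set R := [set t | a <= t <= b].

Definition conton a b g := forall t, seg a b t -> contat rc (seg a b) g t.

Definition primon a b g G := forall t, seg a b t -> dervat rc (seg a b) G t (g t).

Lemma real_primitive (f : R -> R) a b : continuous f ->
  exists F : R -> R, forall x, a <= x <= b -> is_derive x 1 F (f x).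
Proof.
(* Starting at [a - 1] makes every point of the segment interior, so that the derivative at [a] is
   two-sided. *)
move=> fc; exists (fun x => \int[lebesgue_measure]_(t in `[a - 1, x]) f t)%R.
move=> x /andP[ax xb].
have xb1 : x < b + 1 by lra.
have fi : lebesgue_measure.-integrable `[a - 1, b + 1] (EFin \o f).
  apply: continuous_compact_integrable; first exact: segment_compact.
  exact: continuous_subspaceT.
have ax1 : a - 1 < x by lra.
have [dF F'] := continuous_FTC1_closed xb1 fi ax1 (fc x).
by split; [exact: dF|rewrite -F' derive1E].
Qed.

(** Clamping the variable to the segment by [k] extends [g] to a continuous function on the line;
    the fundamental theorem then applies to its real and imaginary parts, the ends included. *)
Lemma primon_exists a b g : a <= b -> conton a b g -> exists G, primon a b g G.
Proof.
move=> ab gc; pose k t := Num.max a (Num.min t b).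
have kab t : seg a b (k t).
  by rewrite /seg /= le_max lexx /= ge_max ab /= ge_min lexx orbT.
have kid t : seg a b t -> k t = t.
  by move=> /andP[ta tb]; rewrite /k (min_idPl tb) (max_idPr ta).
have lmax u v : `|Num.max a u - Num.max a v| <= `|u - v|.
  have := ler_norm (u - v); have := ler_norm (v - u); rewrite distrC => h1 h2.
  have h3 := normr_ge0 (u - v).
  by have [?|?] := leP a u; have [?|?] := leP a v; rewrite ler_norml;
    apply/andP; split; lra.
have lmin u v : `|Num.min u b - Num.min v b| <= `|u - v|.
  have := ler_norm (u - v); have := ler_norm (v - u); rewrite distrC => h1 h2.
  have h3 := normr_ge0 (u - v).
  by have [?|?] := leP u b; have [?|?] := leP v b; rewrite ler_norml;
    apply/andP; split; lra.
have kl s t : `|k s - k t| <= `|s - t| by exact: le_trans (lmax _ _) (lmin _ _).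
have gkc e t : 0 < e -> exists2 d, 0 < d & forall y, `|y - t| < d ->
    cabs (g (k y) - g (k t)) < e.
  move=> e0; have [d d0 h] := gc (k t) (kab t) e e0; exists d => // y yt.
  by apply: h; rewrite // cabs_rc (le_lt_trans (kl _ _)).
have c1 : continuous (fun t => complex.Re (g (k t))).
  move=> t; apply/continuous_ltP => e e0; have [d d0 h] := gkc e t e0.
  exists d => // y yt; apply: le_lt_trans (h y yt).
  by rewrite -raddfB Re_le_cabs.
have c2 : continuous (fun t => complex.Im (g (k t))).
  move=> t; apply/continuous_ltP => e e0; have [d d0 h] := gkc e t e0.
  exists d => // y yt; apply: le_lt_trans (h y yt).
  by rewrite -raddfB Im_le_cabs.
have [F1 F1'] := real_primitive a b c1; have [F2 F2'] := real_primitive a b c2.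
exists (fun t => F1 t +i* F2 t) => t tab.
apply: (@dervat_subset _ _ _ setT) => //; apply: rdv_ReIm => /=.
  by have := F1' t tab; rewrite kid.
by have := F2' t tab; rewrite kid.
Qed.

Lemma primon_unique a b g G G' : a <= b -> primon a b g G -> primon a b g G' ->
  G b - G a = G' b - G' a.
Proof.
move=> ab h h'.
have : cabs ((fun t => G t - G' t) b - (fun t => G t - G' t) a) <= 0 * (b - a).
  apply: (@mean_value_ineq _ (seg a b) (fun t => G t - G' t) (fun=> 0)) => // t tab.
    by have := dervatB (h t tab) (h' t tab); rewrite subrr.
  by rewrite cabs0.
rewrite mul0r => h0; apply/eqP; rewrite -subr_eq0 -cabs_eq0 eq_le cabs_ge0 andbT.
by apply: le_trans h0; rewrite /= le_eqVlt; apply/orP; left; apply/eqP;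
  congr cabs; ring.
Qed.

(** The integral is the increment of a primitive, so linearity and reparametrization become rules of
    differentiation. The default [fun=> 0] is met only where no primitive exists. *)
Definition cint a b g : R[i] :=
  let G := xget (fun=> 0) [set G | primon a b g G] in G b - G a.

Lemma cintE a b g G : a <= b -> primon a b g G -> cint a b g = G b - G a.
Proof.
move=> ab h; apply: (@primon_unique _ _ g) => //.
by have := @xgetPex _ (fun=> 0) [set G | primon a b g G] (ex_intro _ G h).
Qed.

Lemma cint_bound a b g M : a <= b -> conton a b g ->
  (forall t, seg a b t -> cabs (g t) <= M) -> cabs (cint a b g) <= M * (b - a).
Proof.
move=> ab /(primon_exists ab) [G hG] hM; rewrite (cintE ab hG).
exact: (@mean_value_ineq _ (seg a b) G g).
Qed.

Lemma cintD a b g g' : a <= b -> conton a b g -> conton a b g' ->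
  cint a b (fun t => g t + g' t) = cint a b g + cint a b g'.
Proof.
move=> ab /(primon_exists ab) [G hG] /(primon_exists ab) [G' hG'].
rewrite (cintE ab hG) (cintE ab hG') (@cintE _ _ _ (fun t => G t + G' t)) //.
  by ring.
by move=> t tab; apply: dervatD; [apply: hG|apply: hG'].
Qed.

Lemma cintZ a b c g : a <= b -> conton a b g ->
  cint a b (fun t => c * g t) = c * cint a b g.
Proof.
move=> ab /(primon_exists ab) [G hG].
rewrite (cintE ab hG) (@cintE _ _ _ (fun t => c * G t)) //; first by ring.
by move=> t tab; apply: dervatZ; apply: hG.
Qed.

Lemma cintB a b g g' : a <= b -> conton a b g -> conton a b g' ->
  cint a b (fun t => g t - g' t) = cint a b g - cint a b g'.
Proof.
move=> ab gc gc'; rewrite -[- cint _ _ _]mulN1r -cintZ // -cintD //.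
  by congr cint; apply/funext => t; rewrite mulN1r.
by move=> t tab; apply: contatM; [exact: contat_cst|exact: gc'].
Qed.


Lemma conton_sub a b g : (forall t, seg a b t -> contat rc setT g t) -> conton a b g.
Proof. by move=> h t tab; apply: (contat_subset _ (h t tab)). Qed.

Lemma conton_comp a b (h : R -> R[i]) (f : R[i] -> R[i]) : conton a b h ->
  (forall t, seg a b t -> ccont f (h t)) -> conton a b (fun t => f (h t)).
Proof.
move=> hc fc t tab.
by apply: (@contat_comp _ _ _ _ id (seg a b) setT h f) => //; [exact: hc|exact: fc].
Qed.

Lemma contonD a b g g' : conton a b g -> conton a b g' ->
  conton a b (fun t => g t + g' t).
Proof. by move=> h h' t tab; apply: contatD; [exact: h|exact: h']. Qed.

Lemma contonM a b g g' : conton a b g -> conton a b g' ->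
  conton a b (fun t => g t * g' t).
Proof. by move=> h h' t tab; apply: contatM; [exact: h|exact: h']. Qed.

Lemma conton_cst a b c : conton a b (fun=> c).
Proof. by move=> t tab; exact: contat_cst. Qed.

Lemma conton_id a b : conton a b rc.
Proof. by move=> t tab; exact: contat_id. Qed.

End Integral.



(** * Dependent choice and limits of geometrically converging sequences *)

Lemma dependent_choice X (P : nat -> X -> Prop) (Q : nat -> X -> X -> Prop) x0 :
  P 0%N x0 -> (forall n x, P n x -> exists2 y, P n.+1 y & Q n x y) ->
  exists u : nat -> X, [/\ u 0%N = x0, forall n, P n (u n) &
    forall n, Q n (u n) (u n.+1)].
Proof.
move=> P0 PQ.
have /boolp.choice [f hf] (nx : nat * X) : exists y, P nx.1 nx.2 ->
    P nx.1.+1 y /\ Q nx.1 nx.2 y.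
  case: nx => n x /=; have [h|h] := pselect (P n x).
    by have [y Py Qy] := PQ n x h; exists y.
  by exists x.
pose u := fix u n := if n is k.+1 then f (k, u k) else x0.
have Pu n : P n (u n) by elim: n => // n /(hf (n, u n)) [].
by exists u; split => // n; have [] := hf (n, u n) (Pu n).
Qed.

Section Geometric.
Variable R : realType.

Lemma exp_half_gt0 n : 0 < (2^-1 : R) ^+ n.
Proof. by rewrite exprn_gt0. Qed.

Lemma exp_halfS n : (2^-1 : R) ^+ n.+1 = 2^-1 ^+ n / 2.
Proof. by rewrite exprSr. Qed.

Lemma exp_half_small (e : R) : 0 < e -> exists n, (2^-1 : R) ^+ n < e.
Proof.
move=> e0.
have : (fun n => (2^-1 : R) ^+ n) @ \oo --> (0 : R).
  by apply: cvg_expr; rewrite ger0_norm // invf_lt1 // ltr1n.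
move=> /cvgrPdist_lt /(_ e e0) [n _ h]; exists n.
by have := h n (leqnn n); rewrite sub0r normrN ger0_norm // ltW // exp_half_gt0.
Qed.

(** The intervals of center [x n] and half-length [2 * K * 2^-1 ^+ n] are nested; the supremum of
    their left ends lies in all of them. *)
Lemma real_geometric_lim (x : nat -> R) K :
  (forall n, `|x n.+1 - x n| <= K * 2^-1 ^+ n) ->
  exists l, forall n, `|x n - l| <= 2 * K * 2^-1 ^+ n.
Proof.
move=> xK.
pose y n := x n - 2 * K * 2^-1 ^+ n; pose w n := x n + 2 * K * 2^-1 ^+ n.
have yS n : y n <= y n.+1.
  by have := xK n; rewrite /y exp_halfS ler_norml => /andP[]; lra.
have wS n : w n.+1 <= w n.
  by have := xK n; rewrite /w exp_halfS ler_norml => /andP[]; lra.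
have K0 : 0 <= K.
  by have := xK 0%N; rewrite expr0 mulr1; apply: le_trans; rewrite normr_ge0.
have ym m n : (m <= n)%N -> y m <= y n.
  by move=> /subnKC <-; elim: (n - m)%N => [|k IH]; rewrite ?addn0 ?addnS // (le_trans IH).
have wm m n : (m <= n)%N -> w n <= w m.
  by move=> /subnKC <-; elim: (n - m)%N => [|k IH]; rewrite ?addn0 ?addnS // (le_trans _ IH).
have yw m n : y m <= w n.
  apply: le_trans (ym _ _ (leq_maxl m n)) _; apply: le_trans (wm _ _ (leq_maxr m n)).
  by rewrite /y /w; have := exp_half_gt0 (maxn m n); nra.
have ub : has_sup (range y).
  by split; [exists (y 0%N), 0%N|exists (w 0%N) => _ [m _ <-]].
exists (sup (range y)) => n; rewrite ler_norml; apply/andP; split.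
  have : sup (range y) <= w n.
    by apply: ge_sup; [exact: ub.1|move=> _ [m _ <-]].
  by rewrite /w; lra.
have : y n <= sup (range y) by apply: ub_le_sup; [exact: ub.2|exists n].
by rewrite /y; lra.
Qed.

Lemma complex_geometric_lim (u : nat -> R[i]) K :
  (forall n, cabs (u n.+1 - u n) <= K * 2^-1 ^+ n) ->
  exists l, forall n, cabs (u n - l) <= 4 * K * 2^-1 ^+ n.
Proof.
move=> uK.
have [n|x hx] := @real_geometric_lim (fun n => complex.Re (u n)) K.
  by apply: le_trans (uK n); rewrite -raddfB Re_le_cabs.
have [n|y hy] := @real_geometric_lim (fun n => complex.Im (u n)) K.
  by apply: le_trans (uK n); rewrite -raddfB Im_le_cabs.
exists (x +i* y) => n; apply: le_trans (cabs_le_ReIm _) _; rewrite !raddfB /=.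
by have := hx n; have := hy n; lra.
Qed.

End Geometric.

(** * Cauchy's theorem *)

Section LineIntegral.
Variable R : realType.
Implicit Types (f F : R[i] -> R[i]) (p q : R[i]).

Definition lpt p q (t : R) : R[i] := p + t%:C * (q - p).

Definition lint f p q : R[i] := cint 0 1 (fun t => f (lpt p q t) * (q - p)).

Definition contseg f p q := forall t, seg 0 1 t -> ccont f (lpt p q t).

Lemma dervat_lpt A p q t : dervat rc A (lpt p q) t (q - p).
Proof.
move=> e e0; exists 1 => // y _ _; rewrite /lpt.
rewrite (_ : _ - _ - _ = 0) ?cabs0 ?mulr_ge0 ?cabs_ge0 ?ltW //; ring.
Qed.

Lemma lpt0 p q : lpt p q 0 = p. Proof. by rewrite /lpt mul0r addr0. Qed.

Lemma lpt1 p q : lpt p q 1 = q. Proof. by rewrite /lpt mul1r addrC subrK. Qed.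

Lemma conton_lint f p q : contseg f p q ->
  conton 0 1 (fun t => f (lpt p q t) * (q - p)).
Proof.
move=> fc; apply: contonM; last exact: conton_cst.
apply: conton_comp => // t _; exact: (dervat_contat (@dervat_lpt _ p q t)).
Qed.

Let l01 : (0 : R) <= 1. Proof. exact: ler01. Qed.

Lemma lint_prim f F p q :
  (forall t, seg 0 1 t -> cdv F (lpt p q t) (f (lpt p q t))) ->
  lint f p q = F q - F p.
Proof.
move=> h; rewrite /lint (@cintE _ _ _ _ (F \o lpt p q)) /= ?lpt0 ?lpt1 //.
move=> t t01; apply: (@dervat_comp _ _ _ _ id _ setT) => //; last exact: h.
exact: dervat_lpt.
Qed.

Lemma lint_bound f p q M : contseg f p q ->
  (forall t, seg 0 1 t -> cabs (f (lpt p q t)) <= M) ->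
  cabs (lint f p q) <= M * cabs (q - p).
Proof.
move=> fc fM; have := @cint_bound _ 0 1 _ (M * cabs (q - p)) l01 (conton_lint fc).
rewrite subr0 mulr1; apply=> t t01.
by rewrite cabsM ler_wpM2r ?cabs_ge0 // fM.
Qed.

Lemma lintB f g p q : contseg f p q -> contseg g p q ->
  lint (fun z => f z - g z) p q = lint f p q - lint g p q.
Proof.
move=> fc gc; rewrite /lint -cintB //; try exact: conton_lint.
by congr cint; apply/funext => t; rewrite mulrBl.
Qed.

Let affine_reparam (a b : R) (t : R) A : dervat rc A (fun s => (a + b * s)%:C) t b%:C.
Proof.
move=> e e0; exists 1 => // y _ _.
rewrite (_ : _ - _ - _ = 0) ?cabs0 ?mulr_ge0 ?cabs_ge0 ?ltW //.
by rewrite !rmorphD !rmorphM /=; ring.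
Qed.

Lemma lint_rev f p q : contseg f p q -> lint f q p = - lint f p q.
Proof.
move=> /conton_lint /(primon_exists l01) [G hG].
rewrite {2}/lint (cintE l01 hG) /lint.
rewrite (@cintE _ _ _ _ (fun t => G (1 + (-1) * t)) l01).
  by rewrite mulr0 addr0 mulr1 subrr opprB.
move=> t t01.
have -> : f (lpt q p t) * (p - q) = f (lpt p q (1 + -1 * t)) * (q - p) * (-1)%:C.
  rewrite (_ : lpt p q _ = lpt q p t) ?rmorphN ?rmorph1; first by ring.
  by rewrite /lpt rmorphD rmorphM rmorphN rmorph1 /=; ring.
apply: (@dervat_comp _ _ _ _ rc (seg 0 1) (seg 0 1) (fun t => 1 + -1 * t) G).
- by move=> x; rewrite /seg /= => /andP[? ?]; apply/andP; split; lra.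
- exact: affine_reparam.
- by apply: hG; move: t01; rewrite /seg /= => /andP[? ?]; apply/andP; split; lra.
Qed.

Lemma lint_split f p q : contseg f p q ->
  lint f p q = lint f p (lpt p q 2^-1) + lint f (lpt p q 2^-1) q.
Proof.
move=> /conton_lint /(primon_exists l01) [G hG].
rewrite {1}/lint (cintE l01 hG) /lint.
have h2 : (2^-1 : R)%:C = 2^-1 :> R[i].
  by rewrite fmorphV rmorph_nat.
have sub (u : R) : (0 <= u <= 2^-1) -> forall x : R, seg 0 1 x -> seg 0 1 (u + 2^-1 * x).
  move=> /andP[? ?] x; rewrite /seg /= => /andP[? ?]; apply/andP; split; lra.
have e0 : (0 <= (0 : R) <= 2^-1) by rewrite lexx invr_ge0 ler0n.
have e1 : (0 <= (2^-1 : R) <= 2^-1) by rewrite lexx invr_ge0 ler0n.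
rewrite (@cintE _ _ _ _ (fun t => G (0 + 2^-1 * t)) l01); last first.
  move=> t t01.
  rewrite (_ : _ * _ = f (lpt p q (0 + 2^-1 * t)) * (q - p) * (2^-1)%:C).
    apply: (@dervat_comp _ _ _ _ rc (seg 0 1) (seg 0 1) (fun t => 0 + 2^-1 * t) G).
    - exact: sub.
    - exact: affine_reparam.
    - by apply: hG; apply: sub.
  rewrite (_ : lpt p _ t = lpt p q (0 + 2^-1 * t)).
    by rewrite /lpt h2; field.
  by rewrite /lpt add0r rmorphM /= h2; field.
rewrite (@cintE _ _ _ _ (fun t => G (2^-1 + 2^-1 * t)) l01); last first.
  move=> t t01.
  rewrite (_ : _ * _ = f (lpt p q (2^-1 + 2^-1 * t)) * (q - p) * (2^-1)%:C).
    apply: (@dervat_comp _ _ _ _ rc (seg 0 1) (seg 0 1) (fun t => 2^-1 + 2^-1 * t) G).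
    - exact: sub.
    - exact: affine_reparam.
    - by apply: hG; apply: sub.
  rewrite (_ : lpt _ q t = lpt p q (2^-1 + 2^-1 * t)).
    by rewrite /lpt h2; field.
  by rewrite /lpt rmorphD rmorphM /= h2; field.
have h11 : (2^-1 + 2^-1 : R) = 1 by lra.
by rewrite !mulr0 !mulr1 ?add0r ?addr0 ?add0r h11; ring.
Qed.

End LineIntegral.



Section Goursat.
Variable R : realType.
Implicit Types (f F : R[i] -> R[i]) (z p q : R[i]) (r : R).

Definition disc z r : set R[i] := [set w | cabs (w - z) < r].

Definition holo (D : set R[i]) f := forall z, D z -> exists l, cdv f z l.

Lemma lpt_ball z p q r t : cabs (p - z) <= r -> cabs (q - z) <= r -> seg 0 1 t ->
  cabs (lpt p q t - z) <= r.
Proof.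
move=> hp hq /andP[t0 t1].
have -> : lpt p q t - z = (1 - t)%:C * (p - z) + t%:C * (q - z).
  by rewrite /lpt rmorphB rmorph1; ring.
apply: le_trans (cabsD _ _) _; rewrite !cabsM !cabs_real !ger0_norm; lra || nra.
Qed.

Lemma lpt_disc z p q r t : disc z r p -> disc z r q -> seg 0 1 t ->
  disc z r (lpt p q t).
Proof.
move=> hp hq t01; rewrite /disc /=.
have h : cabs (lpt p q t - z) <= Num.max (cabs (p - z)) (cabs (q - z)).
  by apply: lpt_ball => //; rewrite le_max lexx ?orbT.
by apply: le_lt_trans h _; rewrite gt_max hp.
Qed.

Lemma disc_center z r : 0 < r -> disc z r z.
Proof. by rewrite /disc /= subrr cabs0. Qed.

Lemma contseg_holo D f p q : holo D f -> (forall t, seg 0 1 t -> D (lpt p q t)) ->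
  contseg f p q.
Proof. by move=> fh h t t01; have [l hl] := fh _ (h t t01); exact: dervat_contat hl. Qed.

Definition tri f p q s := lint f p q + lint f q s + lint f s p.

Lemma tri_split f z r a b c : holo (disc z r) f ->
  disc z r a -> disc z r b -> disc z r c ->
  let m p q := lpt p q 2^-1 in
  tri f a b c = tri f a (m a b) (m c a) + tri f (m a b) b (m b c)
    + tri f (m c a) (m b c) c + tri f (m b c) (m c a) (m a b).
Proof.
move=> fh ha hb hc m; rewrite /tri.
have half01 : seg 0 1 (2^-1 : R).
  by rewrite /seg /= invr_ge0 ler0n invf_le1 // ler1n.
have hm p q : disc z r p -> disc z r q -> disc z r (m p q).
  by move=> hp hq; apply: lpt_disc.
have cs p q : disc z r p -> disc z r q -> contseg f p q.
  by move=> hp hq; apply: (contseg_holo fh) => t; apply: lpt_disc.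
rewrite (lint_split (cs _ _ ha hb)) (lint_split (cs _ _ hb hc)).
rewrite (lint_split (cs _ _ hc ha)) -/(m a b) -/(m b c) -/(m c a).
rewrite (lint_rev (cs (m b c) (m c a) _ _)); try by apply: hm.
rewrite (lint_rev (cs (m a b) (m b c) _ _)); try by apply: hm.
rewrite (lint_rev (cs (m c a) (m a b) _ _)); try by apply: hm.
repeat match goal with |- context [lint f ?u ?v] => move: (lint f u v) => ? end.
by ring.
Qed.

(** The affine part has the primitive [u * w + v / 2 * (w * w)], so it contributes nothing around a
    closed triangle. *)
Lemma tri_affine f z r a b c (u v : R[i]) : holo (disc z r) f ->
  disc z r a -> disc z r b -> disc z r c ->
  tri f a b c = tri (fun w => f w - (u + v * w)) a b c.
Proof.
move=> fh ha hb hc.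
have cs p q : disc z r p -> disc z r q -> contseg f p q.
  by move=> hp hq; apply: (contseg_holo fh) => t; apply: lpt_disc.
have af w : cdv (fun w => u + v * w) w v.
  have := dervatD (dervat_cst id setT u w) (dervatZ v (dervat_id id setT w)).
  by rewrite add0r mulr1.
have cs' p q : contseg (fun w => u + v * w) p q.
  by move=> t _; exact: dervat_contat (af _).
have pr w : cdv (fun w => u * w + v / 2 * (w * w)) w (u + v * w).
  have h1 := dervat_id id (@setT R[i]) w.
  have := dervatD (dervatZ u h1) (dervatZ (v / 2) (dervatM Logic.I h1 h1)).
  congr (dervat _ _ _ _ _); by field.
rewrite /tri !lintB; try (by apply: cs'); try by apply: cs.
do 3 rewrite [in X in _ = X](@lint_prim _ (fun w => u + v * w)
   (fun w => u * w + v / 2 * (w * w))) //.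
by ring.
Qed.

Lemma cabs_ge_sum4 (e : R) (a b c d : R[i]) : 4 * e < cabs (a + b + c + d) ->
  [\/ e < cabs a, e < cabs b, e < cabs c | e < cabs d].
Proof.
move=> h.
have [ha|ha] := ltP e (cabs a); first by constructor 1.
have [hb|hb] := ltP e (cabs b); first by constructor 2.
have [hc|hc] := ltP e (cabs c); first by constructor 3.
have [hd|hd] := ltP e (cabs d); first by constructor 4.
have := cabsD (a + b + c) d; have := cabsD (a + b) c; have := cabsD a b; lra.
Qed.

(** Goursat's bisection: of the four half-size triangles, one keeps more than a quarter of the lower
    bound, so the integral stays above a fixed multiple of the squared size. Near the limit point
    [f] is affine up to an error that is small relative to the distance, and subtracting the affine
    part makes the integral smaller than that multiple. *)
Theorem goursat f z r a b c : holo (disc z r) f ->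
  disc z r a -> disc z r b -> disc z r c -> tri f a b c = 0.
Proof.
move=> fh ha hb hc; apply/eqP; apply: contraT => tri0.
have T0 : 0 < cabs (tri f a b c) by rewrite cabs_gt0.
set T := cabs _ in T0.
pose d := cabs (a - b) + cabs (b - c) + cabs (c - a) + 1.
have d1 : 1 <= d by rewrite lerDr !addr_ge0 ?cabs_ge0.
have [ab bc ca] : [/\ cabs (a - b) <= d, cabs (b - c) <= d & cabs (c - a) <= d].
  by split; rewrite /d; have := cabs_ge0 (a - b); have := cabs_ge0 (b - c);
    have := cabs_ge0 (c - a); lra.
pose e := T / (2 * d ^+ 2).
have d20 : 0 < d ^+ 2 by rewrite exprn_gt0 //; lra.
have e0 : 0 < e by rewrite divr_gt0 // mulr_gt0.
have eT : e * d ^+ 2 < T.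
  have dn0 : d != 0 by rewrite gt_eqF //; lra.
  by rewrite (_ : e * _ = T / 2); [lra|rewrite /e; field].
(* All vertices stay in a closed disc of radius [rho < r], so their limit is still in the open disc
   where [f] is differentiable. *)
pose rho := Num.max (cabs (a - z)) (Num.max (cabs (b - z)) (cabs (c - z))).
have rr : rho < r by rewrite !gt_max ha hb hc.
pose h n : R := 2^-1 ^+ n.
pose bad n (t : R[i] * R[i] * R[i]) := let: (a, b, c) := t in
  [/\ [/\ cabs (a - z) <= rho, cabs (b - z) <= rho & cabs (c - z) <= rho],
      [/\ cabs (a - b) <= d * h n, cabs (b - c) <= d * h n &
          cabs (c - a) <= d * h n] &
      e * (d * h n) ^+ 2 < cabs (tri f a b c)].
pose link n (t t' : R[i] * R[i] * R[i]) := cabs (t'.1.1 - t.1.1) <= d * h n.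
have bad0 : bad 0%N (a, b, c).
  rewrite /bad /h expr0 mulr1; split => //.
  by split; rewrite !le_max lexx ?orbT.
have half01 : seg 0 1 (2^-1 : R).
  by rewrite /seg /= invr_ge0 ler0n invf_le1 // ler1n.
have step n t : bad n t -> exists2 t', bad n.+1 t' & link n t t'.
  move: t => [[a' b'] c'] [[pa pb pc] [ab' bc' ca'] ht].
  pose m p q : R[i] := lpt p q 2^-1.
  have mr p q : cabs (p - z) <= rho -> cabs (q - z) <= rho -> cabs (m p q - z) <= rho.
    by move=> hp hq; apply: lpt_ball.
  have dsc p : cabs (p - z) <= rho -> disc z r p.
    by move=> hp; apply: le_lt_trans rr.
  have h2 : ((2^-1 : R)%:C : R[i]) = 2^-1 by rewrite fmorphV rmorph_nat.
  have half w : cabs w <= d * h n -> cabs (w / 2) <= d * h n.+1.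
    rewrite -h2 cabsM cabs_real ger0_norm ?invr_ge0 ?ler0n // /h exp_halfS; lra.
  have half' w : cabs w <= d * h n -> cabs (- (w / 2)) <= d * h n.+1.
    by rewrite cabsN; apply: half.
  have hE : d * h n.+1 = d * h n / 2 by rewrite /h exp_halfS mulrA.
  have := ht; rewrite (tri_split fh (dsc _ pa) (dsc _ pb) (dsc _ pc)) -/m.
  rewrite (_ : e * (d * h n) ^+ 2 = 4 * (e * (d * h n.+1) ^+ 2)); last first.
    by rewrite hE; field.
  have hn0 : 0 <= d * h n by apply: le_trans ab'; rewrite cabs_ge0.
  move=> /cabs_ge_sum4 [] hh.
  - exists (a', m a' b', m c' a'); last by rewrite /link /= subrr cabs0.
    split => //; first by split => //; apply: mr.
    split.
    + rewrite (_ : _ - _ = (a' - b') / 2); first exact: half.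
      by rewrite /m /lpt h2; field.
    + rewrite (_ : _ - _ = - ((c' - b') / 2)); last by rewrite /m /lpt h2; field.
      by apply: half'; rewrite cabsBC.
    + rewrite (_ : _ - _ = (c' - a') / 2); first exact: half.
      by rewrite /m /lpt h2; field.
  - exists (m a' b', b', m b' c'); last first.
      rewrite /link /= (_ : _ - _ = - ((a' - b') / 2)); last by rewrite /m /lpt h2; field.
      by apply: le_trans (half' _ ab') _; rewrite hE; lra.
    split => //; first by split => //; apply: mr.
    split.
    + rewrite (_ : _ - _ = (a' - b') / 2); first exact: half.
      by rewrite /m /lpt h2; field.
    + rewrite (_ : _ - _ = (b' - c') / 2); first exact: half.
      by rewrite /m /lpt h2; field.
    + rewrite (_ : _ - _ = (c' - a') / 2); first exact: half.
      by rewrite /m /lpt h2; field.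
  - exists (m c' a', m b' c', c'); last first.
      rewrite /link /= (_ : _ - _ = (c' - a') / 2); last by rewrite /m /lpt h2; field.
      by apply: le_trans (half _ ca') _; rewrite hE; lra.
    split => //; first by split => //; apply: mr.
    split.
    + rewrite (_ : _ - _ = - ((b' - a') / 2)); last by rewrite /m /lpt h2; field.
      by apply: half'; rewrite cabsBC.
    + rewrite (_ : _ - _ = (b' - c') / 2); first exact: half.
      by rewrite /m /lpt h2; field.
    + rewrite (_ : _ - _ = (c' - a') / 2); first exact: half.
      by rewrite /m /lpt h2; field.
  - exists (m b' c', m c' a', m a' b'); last first.
      rewrite /link /= (_ : _ - _ = - ((a' - b') / 2) + (c' - a') / 2); last first.
        by rewrite /m /lpt h2; field.
      apply: le_trans (cabsD _ _) _.
      by have := half' _ ab'; have := half _ ca'; rewrite hE; lra.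
    split => //; first by split => //; apply: mr.
    split.
    + rewrite (_ : _ - _ = - ((a' - b') / 2)); first exact: half'.
      by rewrite /m /lpt h2; field.
    + rewrite (_ : _ - _ = - ((b' - c') / 2)); first exact: half'.
      by rewrite /m /lpt h2; field.
    + rewrite (_ : _ - _ = - ((c' - a') / 2)); first exact: half'.
      by rewrite /m /lpt h2; field.
have [u [u0 ubad ulink]] := dependent_choice bad0 step.
have [zl hzl] := complex_geometric_lim (ulink : forall n, cabs ((u n.+1).1.1 - (u n).1.1) <= d * 2^-1 ^+ n).
have zlr : cabs (zl - z) <= rho.
  apply/ler_addgt0Pr => e1 e10.
  have [|n hn] := @exp_half_small R (e1 / (4 * d)); first by rewrite divr_gt0 //; lra.
  move: hn; rewrite ltr_pdivlMr; last by lra.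
  move=> hn; have := hzl n; have := ubad n.
  case: (u n) => [[p q] s] /= [[pr _ _] _ _]; rewrite cabsBC => k.
  by apply: le_trans (cabs_sub _ _ p) _; lra.
have [l fl] := fh zl (le_lt_trans zlr rr).
(* [15 = 3 * 5]: there are three sides, and their points lie within [5 * d * h n] of the limit,
   [4 * d * h n] from the geometric limit and [d * h n] from the size of the triangle. *)
have e15 : 0 < e / 15 by lra.
have [dl dl0 hdl] := fl _ e15.
have [|n hn] := @exp_half_small R (dl / (5 * d)); first by rewrite divr_gt0 //; lra.
move: hn; rewrite ltr_pdivlMr; last by lra.
move=> hn; have := hzl n; have := ubad n.
case: (u n) => [[p q] s] /= [[pr qr sr] [pq qs sp] ht] pzl.
have dsc w : cabs (w - z) <= rho -> disc z r w.
  by move=> hw; apply: le_lt_trans rr.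
have hn0 : 0 < h n by rewrite exp_half_gt0.
move: ht; rewrite (@tri_affine _ z r _ _ _ (f zl - l * zl) l) //; try exact: dsc.
set g := (fun w => f w - _).
have gh : holo (disc z r) g.
  move=> w /fh [l' fl']; exists (l' - (0 + l * 1)); apply: dervatB => //.
  apply: dervatD; [exact: dervat_cst|apply: dervatZ; exact: dervat_id].
have near w : cabs (w - p) <= d * h n -> cabs (g w) <= e / 15 * (5 * d * h n).
  move=> wp.
  have wl : cabs (w - zl) <= 5 * d * h n.
    by apply: le_trans (cabs_sub _ _ p) _; rewrite /h in wp hn0 *; lra.
  have := hdl w Logic.I; rewrite (_ : f w - f zl - l * (w - zl) = g w); last first.
    by rewrite /g; ring.
  move=> k; apply: le_trans (k _) _; first by rewrite /h in wl; lra.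
  by rewrite ler_wpM2l //; lra.
have pp : cabs (p - p) <= d * h n by rewrite subrr cabs0; apply: mulr_ge0; lra.
have bd v w : cabs (v - z) <= rho -> cabs (w - z) <= rho -> cabs (v - p) <= d * h n ->
  cabs (w - p) <= d * h n -> cabs (v - w) <= d * h n ->
  cabs (lint g v w) <= e / 3 * (d * h n) ^+ 2.
  move=> vr wr vp wp vw.
  apply: le_trans (@lint_bound _ _ _ _ (e / 15 * (5 * d * h n)) _ _) _.
  - by apply: (contseg_holo gh) => t; apply: lpt_disc; apply: dsc.
  - by move=> t t01; apply: near; apply: lpt_ball.
  - rewrite cabsBC -(subr_ge0 _ (e / 3 * _)).
    have -> : e / 3 * (d * h n) ^+ 2 - e / 15 * (5 * d * h n) * cabs (v - w) =
      e / 3 * (d * h n) * (d * h n - cabs (v - w)) by field.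
    apply: mulr_ge0; last by rewrite subr_ge0.
    by apply: mulr_ge0; [lra|apply: mulr_ge0; lra].
rewrite /tri => ht.
have := cabsD (lint g p q + lint g q s) (lint g s p).
have := cabsD (lint g p q) (lint g q s).
have := bd p q pr qr pp; have := bd q s qr sr; have := bd s p sr pr.
rewrite (cabsBC q p) => k1 k2 k3.
have {k1} := k1 sp pp sp; have {k2} := k2 pq sp qs; have {k3} := k3 pq pq.
by clear -ht; lra.
Qed.

(** The primitive is the integral along the segment from the center. Goursat's theorem turns its
    increments into integrals over [[w, y]], where continuity of [f] suffices. *)
Theorem holo_primitive f z r : 0 < r -> holo (disc z r) f ->
  exists2 F, F z = 0 & forall w, disc z r w -> cdv F w (f w).
Proof.
move=> r0 fh; exists (fun w => lint f z w) => [|w hw].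
  rewrite (@lint_prim _ _ (fun w => f z * w)); first by rewrite subrr.
  move=> t _; rewrite /lpt subrr mulr0 addr0 -{2}[f z]mulr1.
  exact/dervatZ/dervat_id.
have hz := disc_center z r0.
have cs p q : disc z r p -> disc z r q -> contseg f p q.
  by move=> hp hq; apply: (contseg_holo fh) => t; apply: lpt_disc.
move=> e e0; have [l fl] := fh w hw; have fc := dervat_contat fl.
have [d d0 h] := fc e e0.
exists (Num.min d (r - cabs (w - z))); first by rewrite lt_min d0 subr_gt0.
move=> y _; rewrite lt_min => /andP[yd yr].
have hy : disc z r y by apply: le_lt_trans (cabs_sub _ _ w) _; lra.
have -> : lint f z y - lint f z w = lint f w y.
  have := goursat fh hz hw hy; rewrite /tri (lint_rev (cs _ _ hz hy)).
  by move=> /eqP; rewrite subr_eq0 => /eqP <-; ring.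
have -> : f w * (y - w) = lint (fun=> f w) w y.
  rewrite (@lint_prim _ _ (fun v => f w * v)); first by rewrite mulrBr.
  by move=> t _; rewrite -{2}[f w]mulr1; exact/dervatZ/dervat_id.
rewrite -lintB; [|exact: cs|by move=> t _; exact: contat_cst].
apply: lint_bound => t t01.
  by apply: contatB; [exact: cs|exact: contat_cst].
apply/ltW/h => //; apply: le_lt_trans yd.
apply: lpt_ball => //; by rewrite subrr cabs0 cabs_ge0.
Qed.

End Goursat.



(** * Regularity of holomorphic functions *)

Section Regularity.
Variable R : realType.
Implicit Types (f g : R[i] -> R[i]) (z w : R[i]) (r : R).

Lemma cdv_unique f z l m : cdv f z l -> cdv f z m -> l = m.
Proof.
move=> fl fm; apply/eqP; rewrite -subr_eq0 -cabs_eq0 eq_le cabs_ge0 andbT.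
apply/ler_addgt0Pr => e e0; rewrite add0r.
have e2 : 0 < e / 2 by lra.
have [d d0 h] := fl _ e2; have [d' d'0 h'] := fm _ e2.
pose k := Num.min d d' / 2.
have m0 : 0 < Num.min d d' by rewrite lt_min d0.
have k0 : 0 < k by rewrite /k; lra.
have [kd kd'] : k < d /\ k < d'.
  have : Num.min d d' <= d by rewrite ge_min lexx.
  have : Num.min d d' <= d' by rewrite ge_min lexx orbT.
  by rewrite /k; lra.
have E : cabs (z + k%:C - z) = k.
  by rewrite (_ : _ - _ = k%:C) ?cabs_real ?gtr0_norm //; ring.
have := h (z + k%:C) Logic.I; have := h' (z + k%:C) Logic.I.
rewrite /= E => /(_ kd') h1 /(_ kd) h2.
have : cabs ((l - m) * k%:C) <= e * k.
  rewrite (_ : (l - m) * k%:C = (f (z + k%:C) - f z - m * (z + k%:C - z))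
    - (f (z + k%:C) - f z - l * (z + k%:C - z))); last by ring.
  by apply: le_trans (cabsD _ _) _; rewrite cabsN; lra.
by rewrite cabsM cabs_real gtr0_norm // ler_pM2r.
Qed.

Definition cd f z : R[i] := xget 0 [set l | cdv f z l].

Lemma cdE f z l : cdv f z l -> cd f z = l.
Proof.
move=> fl; apply: (@cdv_unique f z) => //.
by have := @xgetPex _ 0 [set l | cdv f z l] (ex_intro _ l fl).
Qed.

Lemma cdvP f z : (exists l, cdv f z l) -> cdv f z (cd f z).
Proof. by move=> [l fl]; rewrite (cdE fl). Qed.

Lemma cmean_value f f' (p q : R[i]) M :
  (forall t, seg 0 1 t -> cdv f (lpt p q t) (f' (lpt p q t))) ->
  (forall t, seg 0 1 t -> cabs (f' (lpt p q t)) <= M) ->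
  cabs (f q - f p) <= M * cabs (q - p).
Proof.
move=> fd fM.
have := @mean_value_ineq _ setT (f \o lpt p q)
  (fun t => f' (lpt p q t) * (q - p)) 0 1 (M * cabs (q - p)).
rewrite /= lpt0 lpt1 subr0 mulr1; apply => // t t01.
  apply: (@dervat_comp _ _ _ _ id _ setT) => //; last exact: fd.
  exact: dervat_lpt.
by rewrite cabsM ler_wpM2r ?cabs_ge0 // fM.
Qed.

(** Uniform continuity along a compact curve. Only one of the two points is on the curve, which is
    what differentiation under the integral sign requires. *)
Lemma conton_unif (g : R[i] -> R[i]) (p : R -> R[i]) (a b e : R) :
  a <= b -> conton a b p -> (forall t, seg a b t -> ccont g (p t)) -> 0 < e ->
  exists2 d, 0 < d & forall t w, seg a b t -> cabs (w - p t) < d ->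
    cabs (g w - g (p t)) < e.
Proof.
move=> ab pc gc e0.
apply: (@cousin R (fun s u => exists2 d, 0 < d & forall t w, seg s u t ->
    cabs (w - p t) < d -> cabs (g w - g (p t)) < e) a b ab).
  move=> s u t _ su ut _ [d d0 h] [d' d'0 h'].
  exists (Num.min d d'); first by rewrite lt_min d0.
  move=> v w /andP[sv vt]; rewrite lt_min => /andP[k k'].
  have [vu|uv] := leP v u; first by apply: h => //; rewrite /seg /= sv.
  by apply: h' => //; rewrite /seg /= vt ltW.
move=> c ac cb; have cab : seg a b c by rewrite /seg /= ac.
have e2 : 0 < e / 2 by lra.
have [d1 d10 h1] := gc c cab _ e2.
have d12 : 0 < d1 / 2 by lra.
have [d2 d20 h2] := pc c cab _ d12.
exists d2 => // s t as_ sc ct tb st; exists (d1 / 2) => // v w /andP[sv vt] wv.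
have pv : cabs (p v - p c) < d1 / 2.
  apply: h2; first by rewrite /seg /= (le_trans as_ sv) (le_trans vt tb).
  by rewrite cabs_rc ltr_norml; apply/andP; split; lra.
have k1 := h1 (p v) Logic.I (lt_trans pv _).
have k2 : cabs (w - p c) < d1 by apply: le_lt_trans (cabs_sub _ _ (p v)) _; lra.
have {}k1 : cabs (g (p v) - g (p c)) < e / 2 by apply: k1; lra.
have k3 : cabs (g w - g (p c)) < e / 2 by apply: h1.
by apply: le_lt_trans (cabs_sub _ _ (g (p c))) _; rewrite (cabsBC (g (p c))); lra.
Qed.

(** Differentiation under the integral sign: for each [t] the mean value inequality is applied to
    [g w - g' w0 * w], and uniform continuity of [g'] along the curve makes the bound independent of
    [t]. *)
Lemma cint_param (g g' : R[i] -> R[i]) (p q k : R -> R[i]) (a b : R) (z s0 : R[i])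
    (r : R) : a <= b -> conton a b p -> conton a b q -> conton a b k ->
  (forall t, seg a b t -> cabs (q t) <= 1) ->
  (forall t, seg a b t -> cabs (k t) <= 1) ->
  (forall w, disc z r w -> cdv g w (g' w)) ->
  (forall w, disc z r w -> ccont g' w) ->
  (exists2 d, 0 < d & forall t s, seg a b t -> cabs (s - s0) < d ->
     disc z r (p t + s * q t)) ->
  cdv (fun s => cint a b (fun t => g (p t + s * q t) * k t)) s0
      (cint a b (fun t => g' (p t + s0 * q t) * (q t * k t))).
Proof.
move=> ab pc qc kc q1 k1 gd gc [d0 d00 hd0] e e0.
set e' := e / (b - a + 1).
have e'0 : 0 < e' by apply: divr_gt0 => //; lra.
have mc s : conton a b (fun t => p t + s * q t).
  by apply: contonD => //; apply: contonM => //; exact: conton_cst.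
have D0 t : seg a b t -> disc z r (p t + s0 * q t).
  by move=> tab; apply: hd0 => //; rewrite subrr cabs0.
have [d dp hd] := @conton_unif g' _ a b e' ab (mc s0) (fun t tab => gc _ (D0 t tab)) e'0.
exists (Num.min d0 d); first by rewrite lt_min d00.
move=> s _ /=; rewrite lt_min => /andP[sd0 sd].
have c1 s' : cabs (s' - s0) < d0 -> conton a b (fun t => g (p t + s' * q t) * k t).
  move=> hs; apply: contonM => //; apply: conton_comp => // t tab.
  by apply: dervat_contat (gd _ _); apply: hd0.
have c2 : conton a b (fun t => g' (p t + s0 * q t) * (q t * k t)).
  apply: contonM; last exact: contonM.
  by apply: conton_comp => // t tab; apply: gc; apply: D0.
have s00 : cabs (s0 - s0) < d0 by rewrite subrr cabs0.
have c3 : conton a b (fun t => g (p t + s * q t) * k t - g (p t + s0 * q t) * k t).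
  by move=> t tab; apply: contatB; apply: c1.
have c4 : conton a b (fun t => (s - s0) * (g' (p t + s0 * q t) * (q t * k t))).
  by apply: contonM => //; exact: conton_cst.
rewrite [_ * (s - s0)]mulrC -cintZ // -[X in X - _]cintB; [|done|exact: c1|exact: c1].
rewrite -cintB //.
apply: le_trans (@cint_bound _ _ _ _ (e' * cabs (s - s0)) ab _ _) _.
- by move=> t tab; apply: contatB; [exact: c3|exact: c4].
- move=> t tab.
  set w0 := p t + s0 * q t; set w1 := p t + s * q t.
  rewrite (_ : _ - _ = ((g w1 - g' w0 * w1) - (g w0 - g' w0 * w0)) * k t); last first.
    by rewrite /w1 /w0; ring.
  rewrite cabsM -[X in _ <= X]mulr1.
  apply: ler_pM => //; rewrite ?cabs_ge0 ?k1 //.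
  have w10 : cabs (w1 - w0) <= cabs (s - s0).
    rewrite (_ : w1 - w0 = (s - s0) * q t); last by rewrite /w1 /w0; ring.
    by rewrite cabsM -[X in _ <= X]mulr1 ler_wpM2l ?cabs_ge0 // q1.
  have bl (u : R) : seg 0 1 u -> exists s', [/\ lpt w0 w1 u = p t + s' * q t,
     cabs (s' - s0) <= cabs (s - s0) & cabs (lpt w0 w1 u - w0) <= cabs (s - s0)].
    move=> u01; exists (lpt s0 s u); split.
    - by rewrite /w0 /w1 /lpt; ring.
    - by apply: lpt_ball => //; rewrite subrr cabs0 cabs_ge0.
    - by apply: lpt_ball => //; rewrite subrr cabs0 cabs_ge0.
  apply: le_trans (@cmean_value (fun w => g w - g' w0 * w) (fun w => g' w - g' w0)
    w0 w1 e' _ _) _.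
  + move=> u /bl [s' [E s's _]]; have := gd (lpt w0 w1 u).
    rewrite E => /(_ (hd0 _ _ tab (le_lt_trans s's sd0))) h.
    have := dervatB h (dervatZ (g' w0) (dervat_id id setT (p t + s' * q t))).
    by rewrite mulr1.
  + by move=> u /bl [s' [_ _ h]]; apply/ltW/hd => //; apply: le_lt_trans h sd.
  + by rewrite ler_wpM2l // ltW.
- rewrite mulrAC ler_wpM2r ?cabs_ge0 //.
  by rewrite /e' mulrAC ler_pdivrMr; nra.
Qed.

Definition expi (t : R) : R[i] := cos t +i* sin t.

Lemma rdv_expi t : rdv expi t ('i%C * expi t).
Proof.
apply: rdv_ReIm; rewrite /= !mul0r !mul1r ?sub0r ?add0r ?addr0.
- exact: is_derive_cos.
- exact: is_derive_sin.
Qed.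

Lemma cabs_expi t : cabs (expi t) = 1.
Proof. by rewrite /cabs /sqnormc /= cos2Dsin2 sqrtr1. Qed.

Lemma expi_neq0 t : expi t != 0.
Proof. by rewrite -cabs_gt0 cabs_expi. Qed.

Let T : R := pi *+ 2.
Let T0 : 0 <= T. Proof. by rewrite mulrn_wge0 // pi_ge0. Qed.

Lemma expi0T : expi T = expi 0.
Proof. by rewrite /expi cos2pi sin2pi cos0 sin0. Qed.

Lemma conton_expi a b : conton a b expi.
Proof. by move=> t tab; apply: contat_subset (dervat_contat (rdv_expi t)). Qed.

Lemma conton_expiV a b : conton a b (fun t => (expi t)^-1).
Proof.
move=> t tab; apply: contatV; first exact: expi_neq0.
exact: conton_expi.
Qed.

Section Formula.
Variables (g g' : R[i] -> R[i]) (z : R[i]) (r : R).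
Hypothesis gd : forall w, disc z r w -> cdv g w (g' w).
Hypothesis gc : forall w, disc z r w -> ccont g' w.

Lemma disc_circle (rho : R) a : cabs (a - z) + rho < r ->
  forall t s, cabs s <= rho -> disc z r (a + s * expi t).
Proof.
move=> h t s hs; rewrite /disc /= addrAC; apply: le_lt_trans (cabsD _ _) _.
by rewrite cabsM cabs_expi; lra.
Qed.

Lemma rdv_circle a (s : R[i]) t : rdv (fun t => a + s * expi t) t (s * ('i%C * expi t)).
Proof.
by rewrite -[X in dervat _ _ _ _ X]add0r;
  exact: dervatD (dervat_cst _ _ _ _) (dervatZ _ (rdv_expi t)).
Qed.

(** As a function of the complex radius [s], the integral has derivative zero, because the
    differentiated integrand is itself the [t]-derivative of a periodic function. Its value is
    therefore the one at [s = 0]. *)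
Lemma mean_value_circle (rho : R) a : 0 < rho -> cabs (a - z) + rho < r ->
  cint 0 T (fun t => g (a + rho%:C * expi t) * 1) = T%:C * g a.
Proof.
move=> rho0 ar; pose m s := cint 0 T (fun t => g (a + s * expi t) * 1).
have m' s : cabs s <= rho -> cdv m s 0.
  move=> sr.
  have : cint 0 T (fun t => g' (a + s * expi t) * (expi t * 1)) = 0.
    have [->|s0] := eqVneq s 0.
      rewrite (@cintE _ _ _ _ (fun t => g' a / 'i%C * expi t)) // ?expi0T ?subrr //.
      move=> t _; apply: (@dervat_subset _ _ _ setT) => //.
      have := dervatZ (g' a / 'i%C) (rdv_expi t); congr (dervat _ _ _ _ _).
      by rewrite mul0r addr0 mulrA divfK ?mulr1 // -cabs_gt0 cabsi.
    rewrite (@cintE _ _ _ _ (fun t => (s * 'i%C)^-1 * g (a + s * expi t))) //.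
      by rewrite expi0T subrr.
    move=> t _; apply: (@dervat_subset _ _ _ setT) => //.
    have si : s * 'i%C != 0 by rewrite mulf_neq0 // -cabs_gt0 cabsi.
    have h : cdv g (a + s * expi t) (g' (a + s * expi t)).
      by apply: gd; apply: disc_circle sr.
    have h' := @dervat_comp _ _ _ _ id setT setT _ g t _ _ (fun _ _ => Logic.I)
      (rdv_circle a s t) h.
    have := dervatZ (s * 'i%C)^-1 h'; congr (dervat _ _ _ _ _).
    have i0 : ('i%C : R[i]) != 0 by rewrite -cabs_gt0 cabsi.
    by rewrite /=; field; rewrite ?s0 ?i0.
  move=> <-; apply: (@cint_param _ _ (fun=> a) expi (fun=> 1) 0 T z s r) => //.
  - exact: conton_cst.
  - exact: conton_expi.
  - exact: conton_cst.
  - by move=> t _; rewrite cabs_expi.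
  - by move=> t _; rewrite cabs1.
  - exists (r - cabs (a - z) - rho) => [|t s' _ hs]; first by lra.
    apply: (@disc_circle (cabs s')) => //.
    by have := cabsD (s' - s) s; rewrite subrK; lra.
have : cabs (m rho%:C - m 0) <= 0 * cabs (rho%:C - 0).
  apply: (@cmean_value m (fun=> 0)) => t t01; last by rewrite cabs0.
  apply: m'; rewrite -[lpt _ _ _]subr0; apply: lpt_ball => //.
    by rewrite subrr cabs0 ltW.
  by rewrite subr0 cabs_real gtr0_norm.
rewrite mul0r => h0.
have -> : T%:C * g a = m 0.
  rewrite /m (@cintE _ _ _ _ (fun t => g a * t%:C)) //; first by rewrite rmorph0; ring.
  by move=> t _; rewrite mul0r addr0; apply/dervatZ/dervat_id.
by apply/eqP; rewrite -subr_eq0 -cabs_eq0 eq_le cabs_ge0 andbT.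
Qed.

(** Differentiating the mean value property of [g] in the center gives that of [g']. Integration by
    parts on the circle then trades [g'] for [g], which produces Cauchy's formula for the derivative
    without a singular kernel. *)
Lemma cauchy_derivative (rho : R) a : 0 < rho -> cabs (a - z) + rho < r ->
  cint 0 T (fun t => g (a + rho%:C * expi t) * (expi t)^-1) = (T * rho)%:C * g' a.
Proof.
move=> rho0 ar.
have rrho : cabs rho%:C <= rho by rewrite cabs_real gtr0_norm.
have ca : conton 0 T (fun t => a + rho%:C * expi t).
  apply: contonD; first exact: conton_cst.
  by apply: contonM; [exact: conton_cst|exact: conton_expi].
have c1 : conton 0 T (fun t => g' (a + rho%:C * expi t)).
  by apply: conton_comp => // t _; apply: gc; apply: disc_circle rrho.
have c2 : conton 0 T (fun t => g (a + rho%:C * expi t) * (expi t)^-1).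
  apply: contonM; last exact: conton_expiV.
  apply: conton_comp => // t _.
  by apply: dervat_contat (gd _); apply: disc_circle rrho.
have d1 : cdv (fun a => cint 0 T (fun t => g (rho%:C * expi t + a * 1) * 1)) a
    (cint 0 T (fun t => g' (rho%:C * expi t + a * 1) * (1 * 1))).
  apply: (@cint_param _ _ _ (fun=> 1) (fun=> 1) 0 T z a r) => //.
  - by apply: contonM; [exact: conton_cst|exact: conton_expi].
  - exact: conton_cst.
  - exact: conton_cst.
  - by move=> t _; rewrite cabs1.
  - by move=> t _; rewrite cabs1.
  - exists (r - cabs (a - z) - rho) => [|t s' _ hs]; first by lra.
    rewrite mulr1 addrC; apply: disc_circle rrho.
    by have := cabs_sub s' z a; lra.
have d2 : cdv (fun a => cint 0 T (fun t => g (rho%:C * expi t + a * 1) * 1)) a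
    (T%:C * g' a).
  have : cdv (fun w => T%:C * g w) a (T%:C * g' a).
    by apply: dervatZ; apply: gd; rewrite /disc /=; lra.
  have E w : (fun t => g (rho%:C * expi t + w * 1) * 1) =
      (fun t => g (w + rho%:C * expi t) * 1).
    by apply/funext => t; rewrite !mulr1 addrC.
  apply: dervat_eq; first by rewrite E mean_value_circle.
  exists (r - cabs (a - z) - rho) => [|w _ hw]; first by lra.
  rewrite E mean_value_circle //.
  by have := cabs_sub w z a; rewrite /= in hw; lra.
have E1 : cint 0 T (fun t => g' (a + rho%:C * expi t)) = T%:C * g' a.
  rewrite -(cdv_unique d1 d2); congr cint; apply/funext => t.
  by rewrite !mulr1 [_ + a]addrC.
have E2 : cint 0 T (fun t => (rho%:C * 'i%C) * g' (a + rho%:C * expi t)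
    - 'i%C * (g (a + rho%:C * expi t) * (expi t)^-1)) = 0.
  rewrite (@cintE _ _ _ _ (fun t => g (a + rho%:C * expi t) * (expi t)^-1)) //.
    by rewrite expi0T subrr.
  move=> t _; apply: (@dervat_subset _ _ _ setT) => //.
  have h1 : rdv (fun t => g (a + rho%:C * expi t)) t
      (g' (a + rho%:C * expi t) * (rho%:C * ('i%C * expi t))).
    apply: (@dervat_comp _ _ _ _ id _ setT _ g) => //; first exact: rdv_circle.
    by apply: gd; apply: disc_circle rrho.
  have h2 := dervatV Logic.I (expi_neq0 t) (rdv_expi t).
  have := dervatM Logic.I h1 h2.
  have en := expi_neq0 t.
  by congr (dervat _ _ _ _ _); field.
have : (rho%:C * 'i%C) * (T%:C * g' a) - 'i%C *
   cint 0 T (fun t => g (a + rho%:C * expi t) * (expi t)^-1) = 0.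
  rewrite -E1 -[RHS]E2 cintB ?cintZ //.
  - by apply: contonM => //; exact: conton_cst.
  - by apply: contonM => //; exact: conton_cst.
move=> /eqP; rewrite subr_eq0 => /eqP h.
apply: (@mulfI _ ('i%C : R[i])); first by rewrite -cabs_gt0 cabsi.
by rewrite -h rmorphM /=; ring.
Qed.

(** Cauchy's formula writes [g'] near [a] as an integral of [g] over circles of fixed radius [rho];
    differentiation under the integral sign yields its derivative, again an integral, and uniform
    continuity of [g'] on the circle makes that derivative continuous. *)
Lemma C1_derivative a : disc z r a -> cdv g' a (cd g' a) /\ ccont (cd g') a.
Proof.
move=> ha; pose rho := (r - cabs (a - z)) / 3.
have rho0 : 0 < rho by rewrite /disc /= in ha; rewrite /rho; lra.
have T1 : 0 < T by rewrite pmulrn_lgt0 // pi_gt0.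
pose c : R[i] := ((T * rho)%:C)^-1.
have Tr0 : (T * rho)%:C != 0 :> R[i].
  by rewrite -cabs_gt0 cabs_real normr_gt0 gt_eqF // mulr_gt0.
have rrho : cabs rho%:C <= rho by rewrite cabs_real gtr0_norm.
pose h b := c * cint 0 T (fun t => g (rho%:C * expi t + b * 1) * (expi t)^-1).
pose h' b := c * cint 0 T (fun t => g' (rho%:C * expi t + b * 1) * (1 * (expi t)^-1)).
have nearr b : cabs (b - a) < rho -> cabs (b - z) + rho < r.
  by have := cabs_sub b z a; rewrite /rho /disc /= in ha *; move=> ? ?; lra.
have g'E b : cabs (b - a) < rho -> g' b = h b.
  move=> /nearr br; apply: (mulfI Tr0); rewrite -cauchy_derivative // /h mulrA.
  by rewrite divff // mul1r; congr cint; apply/funext => t; rewrite mulr1 addrC.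
have aa : cabs (a - a) < rho by rewrite subrr cabs0.
have hd b : cabs (b - a) < rho -> cdv h b (h' b).
  move=> /nearr br; apply: dervatZ.
  apply: (@cint_param _ _ _ (fun=> 1) _ 0 T z b r) => //.
  - by apply: contonM; [exact: conton_cst|exact: conton_expi].
  - exact: conton_cst.
  - exact: conton_expiV.
  - by move=> t _; rewrite cabs1.
  - by move=> t _; rewrite cabsV cabs_expi invr1.
  - exists (r - cabs (b - z) - rho) => [|t s' _ hs]; first by lra.
    rewrite mulr1 addrC; apply: disc_circle rrho.
    by have := cabs_sub s' z b; lra.
have g'd b : cabs (b - a) < rho -> cdv g' b (h' b).
  move=> br; apply: (dervat_eq _ _ (hd b br)); first by rewrite g'E.
  exists (rho - cabs (b - a)) => [|w _ hw]; first by lra.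
  by rewrite g'E //; have := cabs_sub w a b; rewrite /= in hw; lra.
split; first by rewrite (cdE (g'd a aa)); exact: g'd.
have : ccont h' a; last first.
  apply: contat_eq; first by rewrite (cdE (g'd a aa)).
  by exists rho => // w _ hw; rewrite (cdE (g'd w hw)).
move=> e e0.
have cp b : conton 0 T (fun t => rho%:C * expi t + b * 1).
  apply: contonD; last exact: conton_cst.
  by apply: contonM; [exact: conton_cst|exact: conton_expi].
have gcp b t : cabs (b - a) < rho -> ccont g' (rho%:C * expi t + b * 1).
  by move=> /nearr br; apply: gc; rewrite mulr1 addrC; apply: disc_circle rrho.
have e10 : 0 < e * rho / 2 by rewrite divr_gt0 // mulr_gt0.
have [d d0 hdd] := @conton_unif g' _ 0 T _ T0 (cp a) (fun t _ => gcp a t aa) e10.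
exists (Num.min d rho); first by rewrite lt_min d0.
move=> b _ /=; rewrite lt_min => /andP[bd br].
have ci w : cabs (w - a) < rho ->
   conton 0 T (fun t => g' (rho%:C * expi t + w * 1) * (1 * (expi t)^-1)).
  move=> hw; apply: contonM; first by apply: conton_comp => // t _; exact: gcp.
  by apply: contonM; [exact: conton_cst|exact: conton_expiV].
rewrite /h' -mulrBr -cintB //; try exact: ci.
have Trp : 0 < T * rho by rewrite mulr_gt0.
have cc w : cabs (c * w) = cabs w / (T * rho).
  by rewrite mulrC cabsM /c cabsV cabs_real gtr0_norm.
rewrite cc ltr_pdivrMr //.
apply: le_lt_trans (@cint_bound _ _ _ _ (e * rho / 2) T0 _ _) _.
- by move=> t tT; apply: contatB; apply: ci.
- move=> t tT; rewrite -mulrBl cabsM mul1r cabsV cabs_expi invr1.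
  have dE : rho%:C * expi t + b * 1 - (rho%:C * expi t + a * 1) = b - a by ring.
  have := hdd t (rho%:C * expi t + b * 1) tT; rewrite /= dE => /(_ bd); lra.
- by rewrite subr0; nra.
Qed.

End Formula.

Definition copen (D : set R[i]) :=
  forall z, D z -> exists2 r, 0 < r & disc z r `<=` D.

Lemma copen_disc z r : copen (disc z r).
Proof.
move=> w hw; exists (r - cabs (w - z)) => [|v hv]; rewrite /disc /= in hw *.
  by lra.
by rewrite /disc /= in hv; apply: le_lt_trans (cabs_sub _ _ w) _; lra.
Qed.

(** Having a primitive, [f] is a continuous derivative. The previous regularity applies twice: to
    the primitive, which makes [cd f] continuous, and then to [f], which makes [cd f]
    differentiable. *)
Theorem holo_cd (D : set R[i]) f : copen D -> holo D f -> holo D (cd f).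
Proof.
move=> Do fh z Dz; have [r r0 hr] := Do z Dz.
have fhr : holo (disc z r) f by move=> w /hr; apply: fh.
have [F _ hF] := holo_primitive r0 fhr.
have fcont w : disc z r w -> ccont f w.
  by move=> /fhr [l fl]; exact: dervat_contat fl.
have f1 w : disc z r w -> cdv f w (cd f w) /\ ccont (cd f) w.
  exact: C1_derivative hF fcont w.
have := @C1_derivative f (cd f) z r (fun w hw => (f1 w hw).1) (fun w hw => (f1 w hw).2) z.
by move=> /(_ (disc_center z r0)) [h _]; exists (cd (cd f) z).
Qed.

End Regularity.



(** * Holomorphic differential equations *)

Section HoloCalculus.
Variable R : realType.
Implicit Types (D : set R[i]) (f g : R[i] -> R[i]).

Lemma holoD D f g : holo D f -> holo D g -> holo D (fun z => f z + g z).
Proof. by move=> h k z Dz; have [l hl] := h z Dz; have [m hm] := k z Dz;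
  exists (l + m); exact: dervatD. Qed.

Lemma holoB D f g : holo D f -> holo D g -> holo D (fun z => f z - g z).
Proof. by move=> h k z Dz; have [l hl] := h z Dz; have [m hm] := k z Dz;
  exists (l - m); exact: dervatB. Qed.

Lemma holoM D f g : holo D f -> holo D g -> holo D (fun z => f z * g z).
Proof. by move=> h k z Dz; have [l hl] := h z Dz; have [m hm] := k z Dz;
  eexists; exact: (dervatM Logic.I hl hm). Qed.

Lemma holoZ D c f : holo D f -> holo D (fun z => c * f z).
Proof. by move=> h z Dz; have [l hl] := h z Dz; eexists; exact: (dervatZ c hl). Qed.

Lemma holoX D f n : holo D f -> holo D (fun z => f z ^+ n).
Proof. by move=> h z Dz; have [l hl] := h z Dz; eexists; exact: (dervatX n Logic.I hl). Qed.

Lemma holoV D f : (forall z, D z -> f z != 0) -> holo D f ->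
  holo D (fun z => (f z)^-1).
Proof. by move=> h0 h z Dz; have [l hl] := h z Dz; eexists;
  exact: (dervatV Logic.I (h0 z Dz) hl). Qed.

Lemma holo_sub D D' f : D' `<=` D -> holo D f -> holo D' f.
Proof. by move=> h k z /h; apply: k. Qed.

Lemma holo_comp D D' f g : (forall z, D z -> D' (g z)) -> holo D g -> holo D' f ->
  holo D (fun z => f (g z)).
Proof.
move=> h gh fh z Dz; have [l hl] := gh z Dz; have [m hm] := fh _ (h z Dz).
by exists (m * l); apply: (@dervat_comp _ _ _ id id setT setT g f).
Qed.

Lemma cdv_comp f g z l m : cdv g z l -> cdv f (g z) m ->
  cdv (fun w => f (g w)) z (m * l).
Proof. by move=> gl fm; apply: (@dervat_comp _ _ _ id id setT setT g f). Qed.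

Lemma rdv_comp f (g : R -> R[i]) t l m : rdv g t l -> cdv f (g t) m ->
  rdv (fun s => f (g s)) t (m * l).
Proof. by move=> gl fm; apply: (@dervat_comp _ _ _ _ id setT setT g f). Qed.

Lemma holo_lipschitz f z r K : holo (disc z r) f ->
  (forall w, disc z r w -> cabs (cd f w) <= K) ->
  forall w w', disc z r w -> disc z r w' -> cabs (f w - f w') <= K * cabs (w - w').
Proof.
move=> fh fK w w' hw hw'; apply: (@cmean_value _ _ (cd f)) => t t01.
  by apply: cdvP; apply: fh; apply: lpt_disc.
by apply: fK; apply: lpt_disc.
Qed.

End HoloCalculus.

(** Picard iteration in complex time, each iterate being a primitive of [V] along the previous one.
    The condition [e * M <= d] keeps the iterates in the disc of radius [2 * d], and [e * K <= 2^-1]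
    halves their differences. *)
Lemma picard (R : realType) (V : R[i] -> R[i]) (z0 x0 : R[i]) (d M K e : R) :
  0 < d -> 0 < e -> holo (disc z0 (2 * d)) V ->
  (forall w, disc z0 (2 * d) w -> cabs (V w) <= M) ->
  (forall w, disc z0 (2 * d) w -> cabs (cd V w) <= K) ->
  e * M <= d -> e * K <= 2^-1 -> disc z0 d x0 ->
  exists x : R[i] -> R[i],
  [/\ x 0 = x0, forall w, disc 0 e w -> disc z0 (2 * d) (x w) &
      forall w, disc 0 e w -> cdv x w (V (x w))].
Proof.
move=> d0 e0 Vh VM VK eM eK hx0; have Vlip := holo_lipschitz Vh VK.
have M0 : 0 <= M.
  by apply: le_trans (VM z0 (disc_center z0 _)); rewrite ?cabs_ge0 // mulr_gt0.
have K0 : 0 <= K.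
  by apply: le_trans (VK z0 (disc_center z0 _)); rewrite ?cabs_ge0 // mulr_gt0.
have ballD (y w : R[i]) : disc 0 e w -> cabs (y - x0) <= M * cabs w -> disc z0 (2 * d) y.
  rewrite /disc /= subr0 => we h; apply: le_lt_trans (cabs_sub _ _ x0) _.
  have : M * cabs w <= M * e by rewrite ler_wpM2l // ltW.
  by rewrite /disc /= in hx0; lra.
pose P (n : nat) (X : R[i] -> R[i]) := [/\ X 0 = x0, holo (disc 0 e) X &
  forall w w', disc 0 e w -> disc 0 e w' -> cabs (X w - X w') <= M * cabs (w - w')].
pose Q (n : nat) (X Y : R[i] -> R[i]) := forall w, disc 0 e w -> cdv Y w (V (X w)).
have c0 := disc_center 0 e0.
have PD n X w : P n X -> disc 0 e w -> disc z0 (2 * d) (X w).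
  move=> [X0 _ Xl] hw; apply: (ballD _ w) => //.
  by have := Xl w 0 hw c0; rewrite X0 subr0.
have P0 : P 0%N (fun=> x0).
  split => // [w _|w w' _ _]; first by exists 0; exact: dervat_cst.
  by rewrite subrr cabs0 mulr_ge0 ?cabs_ge0.
have step n X : P n X -> exists2 Y, P n.+1 Y & Q n X Y.
  move=> PX; have [X0 Xh Xl] := PX.
  have VXh : holo (disc 0 e) (fun w => V (X w)).
    by apply: (holo_comp _ Xh Vh) => w; apply: PD PX.
  have [F F0 hF] := holo_primitive e0 VXh.
  have hY w : disc 0 e w -> cdv (fun w => x0 + F w) w (V (X w)).
    by move=> hw; rewrite -[V _]add0r; apply: dervatD; [exact: dervat_cst|exact: hF].
  exists (fun w => x0 + F w) => //; split => [||w w' hw hw'].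
  - by rewrite F0 addr0.
  - by move=> w hw; exists (V (X w)); exact: hY.
  - apply: (@cmean_value _ (fun w => x0 + F w) (fun w => V (X w))) => t t01.
      by apply: hY; apply: lpt_disc.
    by apply: VM; apply: PD PX _; apply: lpt_disc.
have [X [_ XP XQ]] := dependent_choice P0 step.
have Xdiff n (w : R[i]) : disc 0 e w -> cabs (X n.+1 w - X n w) <= (2 * M * e) * 2^-1 ^+ n.
  elim: n w => [|n IH] w hw.
    rewrite expr0 mulr1; apply: le_trans (cabs_sub _ _ x0) _.
    have [X0 _ Xl] := XP 0%N; have [X10 _ Xl1] := XP 1%N.
    have := Xl 0 w c0 hw; have := Xl1 w 0 hw c0; rewrite X0 X10 subr0 sub0r cabsN.
    rewrite /disc /= subr0 in hw => ? ?.
    have : M * cabs w <= M * e by rewrite ler_wpM2l // ltW.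
    lra.
  have h : cabs ((X n.+2 w - X n.+1 w) - (X n.+2 0 - X n.+1 0)) <=
      (K * ((2 * M * e) * 2^-1 ^+ n)) * cabs (w - 0).
    apply: (@cmean_value _ (fun w => X n.+2 w - X n.+1 w)
      (fun w => V (X n.+1 w) - V (X n w))) => t t01.
      by apply: dervatB; apply: XQ; apply: lpt_disc.
    have hl : disc 0 e (lpt 0 w t) by apply: lpt_disc.
    apply: le_trans (Vlip _ _ _ _) _; try exact: PD hl.
    by rewrite ler_wpM2l // IH.
  have [X10 _ _] := XP n.+1; have [X20 _ _] := XP n.+2.
  move: h; rewrite X10 X20 subrr !subr0 => h; apply: (le_trans h).
  rewrite exp_halfS /disc /= subr0 in hw *.
  have B0 : 0 <= 2 * M * e * 2^-1 ^+ n.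
    by rewrite !mulr_ge0 // ltW // exp_half_gt0.
  rewrite [X in _ <= X]mulrA; set B := 2 * M * e * 2^-1 ^+ n in B0 *.
  have KB : 0 <= K * B by rewrite mulr_ge0.
  have : K * B * cabs w <= K * B * e by rewrite ler_wpM2l // ltW.
  have : B * (e * K) <= B * 2^-1 by rewrite ler_wpM2l.
  lra.
have /boolp.choice [x hx] (w : R[i]) : exists l, disc 0 e w -> forall n,
    cabs (X n w - l) <= 4 * (2 * M * e) * 2^-1 ^+ n.
  have [hw|hw] := pselect (disc 0 e w); last by exists 0.
  have [l hl] := @complex_geometric_lim _ (fun n => X n w) (2 * M * e) (fun n => Xdiff n w hw).
  by exists l.
pose B := 4 * (2 * M * e) + 1.
have B1 : 0 < B.
  have := mulr_ge0 M0 (ltW e0); rewrite /B; lra.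
have hxB (w : R[i]) n : disc 0 e w -> cabs (X n w - x w) <= B * 2^-1 ^+ n.
  move=> hw; apply: le_trans (hx w hw n) _; rewrite ler_pM2r ?exp_half_gt0 //.
  by rewrite /B; lra.
have hlim (a b c : R) : 0 <= c -> (forall n, a <= b + c * 2^-1 ^+ n) -> a <= b.
  move=> c0' h; apply/ler_addgt0Pr => e1 e10.
  have [|n hn] := @exp_half_small R (e1 / (c + 1)); first by rewrite divr_gt0 //; lra.
  move: hn; rewrite ltr_pdivlMr; last by lra.
  by have := h n; have := exp_half_gt0 R n; nra.
have x00 : x 0 = x0.
  apply/eqP; rewrite -subr_eq0 -cabs_eq0 eq_le cabs_ge0 andbT.
  apply: (@hlim _ _ B (ltW B1)) => n; rewrite add0r cabsBC.
  by have [X0 _ _] := XP n; rewrite -{1}X0; exact: hxB.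
have xlip (w : R[i]) : disc 0 e w -> cabs (x w - x0) <= M * cabs w.
  move=> hw; apply: (@hlim _ _ B (ltW B1)) => n.
  apply: le_trans (cabs_sub _ _ (X n w)) _; rewrite addrC.
  have [X0 _ Xl] := XP n; have := Xl w 0 hw c0; rewrite X0 subr0.
  by have := hxB w n hw; rewrite cabsBC; lra.
have xD w : disc 0 e w -> disc z0 (2 * d) (x w).
  by move=> hw; apply: (ballD _ w) => //; apply: xlip.
exists x; split => // w hw.
(* The error of the linear approximation of the iterates is quadratic with a constant independent of
   [n], so it passes to the limit and gives the complex derivative directly. *)
have main (v : R[i]) : disc 0 e v ->
    cabs (x v - x w - V (x w) * (v - w)) <= K * M * cabs (v - w) * cabs (v - w).
  move=> hv; apply: (@hlim _ _ (B + B + K * B * cabs (v - w))).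
    by rewrite !addr_ge0 ?(ltW B1) // !mulr_ge0 ?cabs_ge0 // ltW.
  move=> n.
  have h1 : cabs ((X n.+1 v - V (X n w) * v) - (X n.+1 w - V (X n w) * w)) <=
      K * M * cabs (v - w) * cabs (v - w).
    apply: (@cmean_value _ (fun u => X n.+1 u - V (X n w) * u)
       (fun u => V (X n u) - V (X n w))) => t t01; have hl : disc 0 e (lpt w v t) by apply: lpt_disc.
      have := dervatB (XQ n _ hl) (dervatZ (V (X n w)) (dervat_id id setT (lpt w v t))).
      by rewrite mulr1.
    apply: le_trans (Vlip _ _ _ _) _; try exact: PD (XP n) _.
    rewrite -mulrA ler_wpM2l //; have [_ _ Xl] := XP n.
    apply: le_trans (Xl _ _ hl hw) _; rewrite ler_wpM2l //.
    by apply: lpt_ball => //; rewrite subrr cabs0 cabs_ge0.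
  have h2 := hxB v n.+1 hv; have h3 := hxB w n.+1 hw.
  have h4 : cabs (V (X n w) - V (x w)) <= K * (B * 2^-1 ^+ n).
    apply: le_trans (Vlip _ _ _ _) _; [exact: PD (XP n) _|exact: xD|].
    by rewrite ler_wpM2l // hxB.
  rewrite (_ : x v - x w - V (x w) * (v - w) =
    ((X n.+1 v - V (X n w) * v) - (X n.+1 w - V (X n w) * w))
    - (X n.+1 v - x v) + (X n.+1 w - x w) + (V (X n w) - V (x w)) * (v - w)); last by ring.
  have t1 := cabsD ((X n.+1 v - V (X n w) * v) - (X n.+1 w - V (X n w) * w)
    - (X n.+1 v - x v) + (X n.+1 w - x w)) ((V (X n w) - V (x w)) * (v - w)).
  have t2 := cabsD ((X n.+1 v - V (X n w) * v) - (X n.+1 w - V (X n w) * w)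
    - (X n.+1 v - x v)) (X n.+1 w - x w).
  have t3 := cabsD ((X n.+1 v - V (X n w) * v) - (X n.+1 w - V (X n w) * w))
    (- (X n.+1 v - x v)).
  rewrite cabsN in t3; rewrite cabsM in t1.
  have t4 : cabs (V (X n w) - V (x w)) * cabs (v - w) <= K * (B * 2^-1 ^+ n) * cabs (v - w).
    by rewrite ler_wpM2r ?cabs_ge0.
  have hb : 0 <= B * 2^-1 ^+ n by rewrite mulr_ge0 ?(ltW B1) // ltW // exp_half_gt0.
  rewrite exp_halfS in h2 h3; lra.
move=> e1 e10; exists (Num.min (e1 / (K * M + 1)) (e - cabs w)).
  rewrite lt_min divr_gt0 //=; last by have := mulr_ge0 K0 M0; lra.
  by rewrite /disc /= subr0 in hw; lra.
move=> v _ /=; rewrite lt_min => /andP[h1 h2].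
apply: le_trans (main v _) _.
  by rewrite /disc /= subr0; have := cabsD (v - w) w; rewrite subrK; lra.
rewrite ler_wpM2r ?cabs_ge0 //; move: h1; rewrite ltr_pdivlMr; last first.
  by have := mulr_ge0 K0 M0; lra.
by have := cabs_ge0 (v - w); nra.
Qed.

(** The time [e] is common to all initial points near [z0]. This uniformity is what later bounds the
    radii of flow discs from below near a limit point. *)
Lemma local_flow (R : realType) (D : set R[i]) (V : R[i] -> R[i]) (z0 : R[i]) :
  copen D -> holo D V -> D z0 -> exists d e : R, [/\ 0 < d, 0 < e & forall x0,
    disc z0 d x0 -> exists x : R[i] -> R[i],
    [/\ x 0 = x0, forall w, disc 0 e w -> D (x w) &
        forall w, disc 0 e w -> cdv x w (V (x w))]].
Proof.
move=> Do Vh Dz0; have [r r0 hr] := Do z0 Dz0.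
have V1h := holo_cd Do Vh.
have bnd f : holo D f -> exists2 d, 0 < d & forall w, disc z0 d w ->
    cabs (f w) <= cabs (f z0) + 1.
  move=> fh; have [l fl] := fh z0 Dz0.
  have [d d0 h] := dervat_contat fl ltr01; exists d => // w hw.
  have := h w Logic.I hw; have := cabsD (f w - f z0) (f z0); rewrite subrK; lra.
have [d1 d10 h1] := bnd _ Vh; have [d2 d20 h2] := bnd _ V1h.
pose d := Num.min r (Num.min d1 d2) / 2.
have d0 : 0 < d by rewrite divr_gt0 // !lt_min r0 d10.
have dE : 2 * d = Num.min r (Num.min d1 d2) by rewrite /d; lra.
set M := cabs (V z0) + 1; set K := cabs (cd V z0) + 1.
have M0 : 0 < M by have := cabs_ge0 (V z0); rewrite /M; lra.
have K0 : 0 < K by have := cabs_ge0 (cd V z0); rewrite /K; lra.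
pose e := Num.min (d / M) (2^-1 / K).
have e0 : 0 < e by rewrite lt_min; apply/andP; split; apply: divr_gt0 => //; lra.
have [s1 s2 s3] : [/\ disc z0 (2 * d) `<=` disc z0 r,
    disc z0 (2 * d) `<=` disc z0 d1 & disc z0 (2 * d) `<=` disc z0 d2].
  by rewrite dE; split => w; rewrite /disc /= !lt_min => /and3P[].
exists d, e; split => // x0 hx0.
have := @picard R V z0 x0 d M K e d0 e0.
case.
- by apply: (holo_sub _ Vh) => w /s1 /hr.
- by move=> w /s2 /h1.
- by move=> w /s3 /h2.
- by rewrite -ler_pdivlMr // ge_min lexx.
- by rewrite -ler_pdivlMr // ge_min lexx orbT.
- exact: hx0.
- by move=> x [x00 xD xd]; exists x; split => // w /xD /s1 /hr.
Qed.

(** Starting from the bound [2 * r], each use of the Lipschitz condition and of the mean value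
    inequality halves the bound on the difference, because the interval is short. *)
Lemma ode_unique (R : realType) (V : R[i] -> R[i]) (z0 v : R[i]) (r K a b : R)
    (y1 y2 : R -> R[i]) :
  (forall w w', disc z0 r w -> disc z0 r w' -> cabs (V w - V w') <= K * cabs (w - w')) ->
  (forall t, seg a b t -> disc z0 r (y1 t) /\ rdv y1 t (V (y1 t) * v)) ->
  (forall t, seg a b t -> disc z0 r (y2 t) /\ rdv y2 t (V (y2 t) * v)) ->
  0 <= K -> K * cabs v * (b - a) <= 2^-1 ->
  forall s, seg a b s -> y1 s = y2 s -> forall t, seg a b t -> y1 t = y2 t.
Proof.
move=> Vl h1 h2 K0 Kab s hs ys t ht.
have r0 : 0 < r by have [+ _] := h1 t ht; apply: le_lt_trans; rewrite cabs_ge0.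
have bd n u : seg a b u -> cabs (y1 u - y2 u) <= 2 * r * 2^-1 ^+ n.
  elim: n u => [|n IH] u hu.
    have [d1 _] := h1 u hu; have [d2 _] := h2 u hu.
    have := cabs_sub (y1 u) (y2 u) z0; rewrite (cabsBC z0) expr0 mulr1.
    by rewrite /disc /= in d1 d2; lra.
  set B := 2 * r * 2^-1 ^+ n.
  have B0 : 0 <= B by rewrite !mulr_ge0 // ltW // exp_half_gt0.
  have main p q : a <= p -> p <= q -> q <= b ->
    cabs ((y1 q - y2 q) - (y1 p - y2 p)) <= K * B * cabs v * (q - p).
    move=> ap pq qb.
    apply: (@mean_value_ineq _ setT (fun t => y1 t - y2 t)
      (fun t => V (y1 t) * v - V (y2 t) * v)) => // w /andP[pw wq];
      have hw : seg a b w by rewrite /seg /= (le_trans ap pw) (le_trans wq qb).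
      have [_ e1] := h1 w hw; have [_ e2] := h2 w hw; exact: dervatB.
    have [d1 _] := h1 w hw; have [d2 _] := h2 w hw.
    rewrite -mulrBl cabsM ler_wpM2r ?cabs_ge0 //.
    by apply: le_trans (Vl _ _ d1 d2) _; rewrite ler_wpM2l // IH.
  have KB x : 0 <= x -> x <= b - a -> K * B * cabs v * x <= B / 2.
    move=> x0 xba; have k : 0 <= K * cabs v by rewrite mulr_ge0 ?cabs_ge0.
    have : K * cabs v * x <= 2^-1 by apply: le_trans Kab; rewrite ler_wpM2l.
    by nra.
  rewrite exp_halfS mulrA -/B.
  move: hs hu; rewrite /seg /= => /andP[as_ sb] /andP[au ub].
  have [su|us] := leP s u.
    have := main s u as_ su ub; rewrite ys subrr subr0 => h; apply: le_trans h _.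
    by apply: KB; lra.
  have := main u s au (ltW us) sb; rewrite ys subrr sub0r cabsN => h.
  by apply: le_trans h _; apply: KB; lra.
apply/eqP; rewrite -subr_eq0 -cabs_eq0 eq_le cabs_ge0 andbT.
apply/ler_addgt0Pr => e e0; rewrite add0r.
have [|n hn] := @exp_half_small R (e / (2 * r)); first by rewrite divr_gt0 // mulr_gt0.
apply: le_trans (bd n t ht) _; move: hn; rewrite ltr_pdivlMr ?mulr_gt0 //; lra.
Qed.



(** * Maxima on closed discs *)

Section Maximum.
Variable R : realType.

Lemma nbhs_pairP (U : set (R * R)) (p : R * R) : nbhs p U <->
  exists2 d, 0 < d & forall q : R * R, `|q.1 - p.1| < d -> `|q.2 - p.2| < d -> U q.
Proof.
split=> [|[d d0 h]].
  move=> /nbhs_ballP [d /= d0 h]; exists d => // q q1 q2; apply: h.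
  by split; rewrite /ball /= distrC.
apply/nbhs_ballP; exists d => //= q [q1 q2].
by apply: h; rewrite distrC.
Qed.

Lemma continuous_pair (f : R * R -> R) (p : R * R) :
  (forall e, 0 < e -> exists2 d, 0 < d & forall q : R * R,
     `|q.1 - p.1| < d -> `|q.2 - p.2| < d -> `|f q - f p| < e) ->
  {for p, continuous f}.
Proof.
move=> h; apply/cvgrPdist_lt => e e0; have [d d0 hd] := h e e0.
by apply/nbhs_pairP; exists d => // q q1 q2; rewrite distrC; apply: hd.
Qed.

Lemma cabs_pair (p q : R * R) (d : R) : `|q.1 - p.1| < d -> `|q.2 - p.2| < d ->
  cabs ((q.1 +i* q.2) - (p.1 +i* p.2)) < 2 * d.
Proof.
move=> h1 h2; apply: le_lt_trans (cabs_le_ReIm _) _; rewrite /=.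
by rewrite -[X in X < _]/(`|q.1 - p.1| + `|q.2 - p.2|); lra.
Qed.

Lemma continuous_pairC (f : R[i] -> R) (p : R * R) :
  ccont (fun w => (f w)%:C) (p.1 +i* p.2) ->
  {for p, continuous (fun q : R * R => f (q.1 +i* q.2))}.
Proof.
move=> h; apply: continuous_pair => e e0; have [d d0 hd] := h e e0.
exists (d / 2) => [|q q1 q2]; first by lra.
have := hd (q.1 +i* q.2) Logic.I; rewrite -rmorphB cabs_real; apply.
by apply: (lt_le_trans (cabs_pair q1 q2)); lra.
Qed.

Lemma compact_cdisc (z : R[i]) (r : R) :
  compact [set p : R * R | cabs ((p.1 +i* p.2) - z) <= r].
Proof.
apply: (@subclosed_compact _ _ (`[complex.Re z - r, complex.Re z + r]%classic
   `*` `[complex.Im z - r, complex.Im z + r]%classic)).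
- apply: (@preimage_closed _ _ (fun p : R * R => cabs ((p.1 +i* p.2) - z))
    [set x | x <= r]); last exact: closed_le.
  move=> p _; apply: (@continuous_pairC (fun w => cabs (w - z))) => e e0.
  exists e => // w _ hw; rewrite -rmorphB cabs_real.
  apply: le_lt_trans (cabs_lipschitz _ _) _.
  by rewrite (_ : _ - _ - _ = w - (p.1 +i* p.2)) //; ring.
- by apply: compact_setX; exact: segment_compact.
- move=> p /= h.
  have h1 := le_trans (Re_le_cabs _) h; have h2 := le_trans (Im_le_cabs _) h.
  rewrite !raddfB /= !ler_norml in h1 h2.
  by split; rewrite /= in_itv /=; apply/andP; split; lra.
Qed.

Lemma EVT_cdisc (f : R[i] -> R) (r : R) : 0 <= r ->
  (forall z, cabs z <= r -> ccont (fun w => (f w)%:C) z) ->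
  exists2 z, cabs z <= r & forall w, cabs w <= r -> f w <= f z.
Proof.
move=> r0 fc; pose K := [set p : R * R | cabs ((p.1 +i* p.2) - 0) <= r].
have [||p pK hp] := @compact_EVT_max _ _ (fun q : R * R => f (q.1 +i* q.2)) K _
  (@compact_cdisc 0 r).
- by exists (0, 0); rewrite /K /= subr0 -[_ +i* _]/(0 : R[i]) cabs0.
- apply: continuous_in_subspaceT => p; rewrite inE /K /= subr0 => pK.
  by apply: continuous_pairC; apply: fc.
exists (p.1 +i* p.2); first by move: pK; rewrite inE /K /= subr0.
move=> [x y] hw; have := hp (x, y); rewrite inE; apply.
by rewrite /K /= subr0.
Qed.

Lemma rcont_comp (h : R -> R) (f : R[i] -> R) z : {for f z, continuous h} ->
  ccont (fun w => (f w)%:C) z -> ccont (fun w => (h (f w))%:C) z.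
Proof.
move=> /continuous_ltP hc fc e e0; have [d d0 k] := hc e e0.
have [d' d'0 k'] := fc d d0; exists d' => // y _ yd; rewrite cabs_rc.
by apply: k; have := k' y Logic.I yd; rewrite cabs_rc.
Qed.

Lemma rcont_sqnormc (f : R[i] -> R[i]) z :
  ccont f z -> ccont (fun w => (sqnormc (f w))%:C) z.
Proof.
move=> fc.
have c1 : ccont (fun w => (complex.Re (f w))%:C) z.
  move=> e e0; have [d d0 h] := fc e e0; exists d => // y _ yd.
  rewrite -rmorphB cabs_real -raddfB; apply: le_lt_trans (Re_le_cabs _) _.
  exact: h.
have c2 : ccont (fun w => (complex.Im (f w))%:C) z.
  move=> e e0; have [d d0 h] := fc e e0; exists d => // y _ yd.
  rewrite -rmorphB cabs_real -raddfB; apply: le_lt_trans (Im_le_cabs _) _.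
  exact: h.
have := contatD (contatM c1 c1) (contatM c2 c2).
apply: contat_eq; first by rewrite -!rmorphM -rmorphD /sqnormc !expr2.
by exists 1 => // y _ _; rewrite -!rmorphM -rmorphD /sqnormc !expr2.
Qed.

End Maximum.

(** * Rules for real derivatives and the second derivative test *)

Section RealDerivatives.
Variable R : realType.
Implicit Types (f g : R -> R) (x a b : R).

Lemma is_deriveD_fun f g x a b : is_derive x 1 f a -> is_derive x 1 g b ->
  is_derive x 1 (fun t => f t + g t) (a + b).
Proof. by move=> h k; exact: is_deriveD. Qed.

Lemma is_deriveM_fun f g x a b : is_derive x 1 f a -> is_derive x 1 g b ->
  is_derive x 1 (fun t => f t * g t) (a * g x + f x * b).
Proof.
move=> h k; apply: (@is_derive_eq _ _ _ _ _ _ _ _ (is_deriveM h k)).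
by rewrite /GRing.scale /=; ring.
Qed.

Lemma is_deriveZ_fun c f x a : is_derive x 1 f a ->
  is_derive x 1 (fun t => c * f t) (c * a).
Proof. by move=> h; exact: is_deriveZ. Qed.

Lemma is_derive_exp_fun f x a : is_derive x 1 f a ->
  is_derive x 1 (fun t => expR (f t)) (expR (f x) * a).
Proof. by move=> h; apply: is_derive1_comp; exact: is_derive_expR. Qed.

Lemma is_derive_ln_fun f x a : 0 < f x -> is_derive x 1 f a ->
  is_derive x 1 (fun t => ln (f t)) (a / f x).
Proof.
move=> f0 h; rewrite mulrC; apply: is_derive1_comp; exact: is_derive1_ln.
Qed.

Lemma is_derive_div_fun f g x a b : g x != 0 -> is_derive x 1 f a ->
  is_derive x 1 g b ->
  is_derive x 1 (fun t => f t / g t) (a / g x - f x * b / g x ^+ 2).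
Proof.
move=> g0 h k; apply: (@is_derive_eq _ _ _ _ _ _ _ _
  (is_deriveM_fun h (is_deriveV g0 k))).
by rewrite /GRing.scale /=; field.
Qed.

Lemma is_derive_ltP f x a e : is_derive x 1 f a -> 0 < e ->
  exists2 d, 0 < d & forall y, `|y - x| < d ->
    `|f y - f x - a * (y - x)| <= e * `|y - x|.
Proof.
move=> /is_derive_rdv h e0; have [d d0 k] := h e e0; exists d => // y yd.
have := k y Logic.I; rewrite cabs_rc => /(_ yd).
by rewrite -!rmorphB -rmorphM -rmorphB cabs_real.
Qed.

(** The first derivative vanishes at the maximum. If [f2] were positive, it would be positive just
    to the right of [0], and the mean value theorem would produce a larger value. *)
Lemma second_derivative_test f (f1 : R -> R) (f2 d : R) : 0 < d ->
  (forall t : R, `|t| < d -> is_derive t 1 f (f1 t)) ->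
  is_derive (0 : R) 1 f1 f2 ->
  (forall t, `|t| < d -> f t <= f 0) -> f2 <= 0.
Proof.
move=> d0 hf hf1 fmax; rewrite leNgt; apply/negP => f20.
have itv (t : R) : t \in `](-d), d[ -> `|t| < d by rewrite in_itv /= ltr_norml.
have f10 : f1 0 = 0.
  have h : is_derive (0 : R) 1 f 0.
    apply: (@derive1_at_max _ f (- d) d 0).
    - by lra.
    - by move=> t /itv /hf h; exact: ex_derive.
    - by rewrite in_itv /=; apply/andP; split; lra.
    - by move=> t /itv /fmax.
  have h' : is_derive (0 : R) 1 f (f1 0) by apply: hf; rewrite normr0.
  have e1 := @derive_val _ _ _ _ _ _ _ h; have e2 := @derive_val _ _ _ _ _ _ _ h'.
  by rewrite -e2 e1.
have f22 : 0 < f2 / 2 by lra.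
have [d' d'0 h] := is_derive_ltP hf1 f22.
pose t := Num.min d d' / 2.
have m0 : 0 < Num.min d d' by rewrite lt_min d0.
have t0 : 0 < t by rewrite /t; lra.
have [td td'] : t < d /\ t < d'.
  have : Num.min d d' <= d by rewrite ge_min lexx.
  have : Num.min d d' <= d' by rewrite ge_min lexx orbT.
  by rewrite /t; lra.
have hfs (s : R) : 0 <= s -> s <= t -> is_derive s 1 f (f1 s).
  by move=> s0 st; apply: hf; rewrite ltr_norml; apply/andP; split; lra.
have [s|s|c cI fE] := @MVT R f f1 0 t t0.
- by rewrite in_itv /= => /andP[s0 st]; apply: hfs; exact: ltW.
- move: s; apply: derivable_within_continuous => s; rewrite in_itv /= => /andP[s0 st].
  by have k := hfs s s0 st; exact: ex_derive.
move: cI; rewrite in_itv /= => /andP[c0 ct].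
have := h c; rewrite f10 !subr0 gtr0_norm // => /(_ ltac:(lra)).
rewrite ler_norml => /andP[k _].
have k' : 0 < f1 c by nra.
have := fmax t; rewrite gtr0_norm // => /(_ td).
by have := mulr_gt0 k' t0; rewrite subr0 in fE; lra.
Qed.

End RealDerivatives.



(** * The curvature estimate *)

Section Curvature.
Variable R : realType.

Definition sum4 (F : nat -> R) : R := F 0%N + F 1%N + F 2%N + F 3%N.

Lemma is_derive_sum4 (F : nat -> R -> R) (G : nat -> R) (x : R) :
  (forall j, (j < 4)%N -> is_derive x 1 (F j) (G j)) ->
  is_derive x 1 (fun t => sum4 (F^~ t)) (sum4 G).
Proof.
move=> h; exact: (is_deriveD_fun (is_deriveD_fun (is_deriveD_fun (h 0%N isT) (h 1%N isT))
  (h 2%N isT)) (h 3%N isT)).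
Qed.

(** The second derivative of [3 * ln S + ln P] along a line, cleared of denominators. The factor [3]
    fits the scale: the curvature inequality makes [S ^+ 3] behave like the inverse of a length, and
    [P] will be the function [r ^+ 2 - |z| ^+ 2] vanishing on the circle. *)
Lemma log_max_test (W W1 : nat -> R -> R) (W2 : nat -> R) (P P1 : R -> R) (P2 d : R) :
  0 < d ->
  (forall j (t : R), (j < 4)%N -> `|t| < d -> is_derive t 1 (W j) (W1 j t)) ->
  (forall j, (j < 4)%N -> is_derive (0 : R) 1 (W1 j) (W2 j)) ->
  (forall t : R, `|t| < d -> 0 < P t /\ is_derive t 1 P (P1 t)) ->
  is_derive (0 : R) 1 P1 P2 ->
  let S t := sum4 (fun j => expR (W j t)) in
  (forall t, `|t| < d -> 3 * ln (S t) + ln (P t) <= 3 * ln (S 0) + ln (P 0)) ->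
  3 * (sum4 (fun j => expR (W j 0) * (W1 j 0 ^+ 2 + W2 j)) * S 0
       - sum4 (fun j => expR (W j 0) * W1 j 0) ^+ 2) * P 0 ^+ 2
  + (P2 * P 0 - P1 0 ^+ 2) * S 0 ^+ 2 <= 0.
Proof.
move=> d0 hW hW1 hP hP1 S hmax.
have S0 t : 0 < S t by rewrite /S /sum4 !addr_gt0 // expR_gt0.
pose S1 t := sum4 (fun j => expR (W j t) * W1 j t).
have dS (t : R) : `|t| < d -> is_derive t 1 S (S1 t).
  move=> td; apply: (@is_derive_sum4 (fun j t => expR (W j t))) => j j4.
  by apply: is_derive_exp_fun; apply: hW.
have n0 : `|0 : R| < d by rewrite normr0.
have dS1 : is_derive (0 : R) 1 S1 (sum4 (fun j => expR (W j 0) * (W1 j 0 ^+ 2 + W2 j))).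
  have k j : (j < 4)%N -> is_derive (0 : R) 1 (fun t => expR (W j t) * W1 j t)
     (expR (W j 0) * (W1 j 0 ^+ 2 + W2 j)).
    move=> j4; have h := is_deriveM_fun (is_derive_exp_fun (hW j 0 j4 n0)) (hW1 j j4).
    by apply: (@is_derive_eq _ _ _ _ _ _ _ _ h); ring.
  exact: is_derive_sum4.
pose F t := 3 * ln (S t) + ln (P t).
pose F1 t := 3 * (S1 t / S t) + P1 t / P t.
have dF (t : R) : `|t| < d -> is_derive t 1 F (F1 t).
  move=> td; have [P0 dP] := hP t td.
  exact: (is_deriveD_fun (is_deriveZ_fun 3 (is_derive_ln_fun (S0 t) (dS t td)))
    (is_derive_ln_fun P0 dP)).
have [P0 dP] := hP 0 n0.
have P0' : P 0 != 0 by rewrite gt_eqF.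
have S0' : S 0 != 0 by rewrite gt_eqF.
have dF1 := is_deriveD_fun (is_deriveZ_fun 3 (is_derive_div_fun S0' dS1 (dS 0 n0)))
  (is_derive_div_fun P0' hP1 dP).
have := second_derivative_test d0 dF dF1 hmax.
set Q := sum4 _; rewrite -/(S1 0) => h.
have : (3 * (Q / S 0 - S1 0 * S1 0 / S 0 ^+ 2) + (P2 / P 0 - P1 0 * P1 0 / P 0 ^+ 2))
    * (S 0 ^+ 2 * P 0 ^+ 2) <= 0.
  by rewrite mulr_le0_ge0 // mulr_ge0 // sqr_ge0.
by apply: le_trans; rewrite le_eqVlt; apply/orP; left; apply/eqP; field; rewrite P0'.
Qed.

(** Lagrange's identity: the right-hand side is the sum over all pairs of the expression on the
    left, and a single pair is kept. *)
Lemma lagrange4 (A x : nat -> R) i k : (i < 2)%N -> (2 <= k < 4)%N ->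
  (forall j, 0 <= A j) ->
  A i * A k * (x i - x k) ^+ 2 <=
  sum4 A * sum4 (fun j => A j * x j ^+ 2) - sum4 (fun j => A j * x j) ^+ 2.
Proof.
move=> i2 k4 A0.
have -> : sum4 A * sum4 (fun j => A j * x j ^+ 2) - sum4 (fun j => A j * x j) ^+ 2 =
  A 0%N * A 1%N * (x 0%N - x 1%N) ^+ 2 + A 0%N * A 2%N * (x 0%N - x 2%N) ^+ 2
  + A 0%N * A 3%N * (x 0%N - x 3%N) ^+ 2 + A 1%N * A 2%N * (x 1%N - x 2%N) ^+ 2
  + A 1%N * A 3%N * (x 1%N - x 3%N) ^+ 2 + A 2%N * A 3%N * (x 2%N - x 3%N) ^+ 2.
  by rewrite /sum4; ring.
have nn a b : 0 <= A a * A b * (x a - x b) ^+ 2 by rewrite mulr_ge0 ?sqr_ge0 // mulr_ge0.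
have := nn 0%N 1%N; have := nn 0%N 2%N; have := nn 0%N 3%N; have := nn 1%N 2%N.
have := nn 1%N 3%N; have := nn 2%N 3%N.
by case: i i2 => [|[|//]] _; case: k k4 => [//|[//|[|[|//]]]] _; lra.
Qed.

Lemma rdv_ln_sqnormc (f : R -> R[i]) (t : R) l : f t != 0 -> rdv f t l ->
  is_derive t 1 (fun s => ln (sqnormc (f s))) (2 * complex.Re (l / f t)).
Proof.
move=> f0 fl; have hR := rdv_Re fl; have hI := rdv_Im fl.
have sq : is_derive t 1 (fun s => sqnormc (f s))
    (2 * (complex.Re (f t) * complex.Re l + complex.Im (f t) * complex.Im l)).
  have h := is_deriveD_fun (is_deriveM_fun hR hR) (is_deriveM_fun hI hI).
  have -> : (fun s => sqnormc (f s)) = (fun s => complex.Re (f s) * complex.Re (f s)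
    + complex.Im (f s) * complex.Im (f s)).
    by apply/funext => s; rewrite /sqnormc !expr2.
  by apply: (@is_derive_eq _ _ _ _ _ _ _ _ h); ring.
have s0 : 0 < sqnormc (f t) by rewrite -cabs_sq exprn_gt0 // cabs_gt0.
apply: (@is_derive_eq _ _ _ _ _ _ _ _ (@is_derive_ln_fun _ (fun s => sqnormc (f s)) t _ s0 sq)).
have {s0} := s0; rewrite /sqnormc.
case: (f t) l {fl hR hI sq f0} => [x y] [u v] /= s0.
by field; rewrite gt_eqF.
Qed.

Lemma sqnormc_lin (x y a b : R[i]) : sqnormc (x * a + y * b) <=
  2 * (sqnormc x + sqnormc y) * (sqnormc a + sqnormc b).
Proof.
have h := cabsD (x * a) (y * b); rewrite !cabsM in h.
have h2 : sqnormc (x * a + y * b) <= (cabs x * cabs a + cabs y * cabs b) ^+ 2.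
  by rewrite -cabs_sq ler_pXn2r // ?nnegrE ?cabs_ge0 // addr_ge0 // mulr_ge0 // cabs_ge0.
apply: (le_trans h2); rewrite -!cabs_sq.
have := sqr_ge0 (cabs x * cabs a - cabs y * cabs b).
have := sqr_ge0 (cabs x * cabs b); have := sqr_ge0 (cabs y * cabs a).
have := sqr_ge0 (cabs x * cabs a); have := sqr_ge0 (cabs y * cabs b).
by nra.
Qed.

(** Cramer's rule recovers [a] and [b] from the two forms, so independent forms cannot be small at
    the same time. *)
Lemma linear_forms_comparable (p q : nat -> R[i]) i k :
  p i * q k - p k * q i != 0 -> exists2 c, 1 <= c & forall a b,
  sqnormc a + sqnormc b <= c * Num.max (sqnormc (p i * a + q i * b))
    (sqnormc (p k * a + q k * b)).
Proof.
set D := _ - _ => D0.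
pose c := 1 + 4 * (sqnormc (q k / D) + sqnormc (- q i / D)
  + sqnormc (- p k / D) + sqnormc (p i / D)).
have nn := @sqnormc_ge0 R.
exists c => [|a b].
  have := nn (q k / D); have := nn (- q i / D); have := nn (- p k / D).
  by have := nn (p i / D); rewrite /c; lra.
set u := p i * a + q i * b; set v := p k * a + q k * b.
have aE : a = q k / D * u + (- q i / D) * v.
  by rewrite /u /v; apply: (mulfI D0); rewrite /D in D0 *; field.
have bE : b = - p k / D * u + (p i / D) * v.
  by rewrite /u /v; apply: (mulfI D0); rewrite /D in D0 *; field.
have ha := sqnormc_lin (q k / D) (- q i / D) u v; rewrite -aE in ha.
have hb := sqnormc_lin (- p k / D) (p i / D) u v; rewrite -bE in hb.
have um : sqnormc u <= Num.max (sqnormc u) (sqnormc v) by rewrite le_max lexx.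
have vm : sqnormc v <= Num.max (sqnormc u) (sqnormc v) by rewrite le_max lexx orbT.
set m := Num.max _ _ in um vm *.
have m0 : 0 <= m by apply: le_trans (nn u) um.
have uv : sqnormc u + sqnormc v <= 2 * m by lra.
have k1 : 0 <= 2 * (sqnormc (q k / D) + sqnormc (- q i / D)) by rewrite mulr_ge0 // addr_ge0 // nn.
have k2 : 0 <= 2 * (sqnormc (- p k / D) + sqnormc (p i / D)) by rewrite mulr_ge0 // addr_ge0 // nn.
have := ler_wpM2l k1 uv; have := ler_wpM2l k2 uv.
rewrite /c; lra.
Qed.

End Curvature.



(** * The maximum principle for the normalized forms *)

Section Estimate.
Variable R : realType.

Lemma cdvZ_line (f : R[i] -> R[i]) (z v : R[i]) (t : R) l : cdv f (z + t%:C * v) l ->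
  rdv (fun s : R => f (z + s%:C * v)) t (l * v).
Proof.
move=> fl; apply: (rdv_comp _ fl).
have := dervatD (dervat_cst rc (@setT R) z t) (dervatZ v (dervat_id rc (@setT R) t)).
rewrite add0r mulr1; apply: dervat_eq; first by rewrite mulrC.
by exists 1 => // y _ _; rewrite mulrC.
Qed.

(* The squared moduli of the forms are [A j ^+ 5], so that [S] below is the sum
   of the [|L j| ^ (2/5)], and the normalization of the Wronskian turns the
   curvature inequality into [S ^ 8 <= C * (r * S / P) ^ 2]. *)
Lemma estimate_at_max (p q : nat -> R[i]) (a b : R[i] -> R[i]) (z0 : R[i])
    (r c0 K : R) :
  let L j z := p j * a z + q j * b z in
  let S z := sum4 (fun j => expR (ln (sqnormc (L j z)) / 5)) in
  let P z := r ^+ 2 - sqnormc z in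
  0 < c0 -> 0 < K ->
  (forall i k, (i < 2)%N -> (2 <= k < 4)%N ->
     c0 <= sqnormc (p i * q k - p k * q i)) ->
  holo (disc 0 r) a -> holo (disc 0 r) b ->
  (forall j z, (j < 4)%N -> disc 0 r z -> L j z != 0) ->
  (cd a z0 * b z0 - a z0 * cd b z0) ^+ 5 =
    (L 0%N z0 * L 1%N z0 * L 2%N z0 * L 3%N z0) ^+ 4 ->
  let A j := expR (ln (sqnormc (L j z0)) / 5) in
  S z0 <= K * Num.max (A 0%N) (A 1%N) -> S z0 <= K * Num.max (A 2%N) (A 3%N) ->
  disc 0 r z0 ->
  (forall z, disc 0 r z -> S z ^+ 3 * P z <= S z0 ^+ 3 * P z0) ->
  S z0 ^+ 6 * P z0 ^+ 2 <= K ^+ 8 * (25 / 3) / c0 * r ^+ 2.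
Proof.
move=> L S P c00 K0 hc ah bh L0 WE A SA1 SA2 hz0 hmax.
pose g j z := (p j * cd a z + q j * cd b z) / L j z.
have Ld j z : disc 0 r z -> cdv (L j) z (p j * cd a z + q j * cd b z).
  move=> hz; apply: dervatD; apply: dervatZ; apply: cdvP; [exact: ah|exact: bh].
have gh j : (j < 4)%N -> holo (disc 0 r) (g j).
  move=> j4; have co := @copen_disc R 0 r.
  apply: holoM.
    by apply: holoD; apply: holoZ; apply: holo_cd.
  apply: holoV; first by move=> z; apply: L0.
  by move=> z hz; exists (p j * cd a z + q j * cd b z); apply: Ld.
have A0 j : 0 < A j by rewrite expR_gt0.
have Spos z : 0 < S z by rewrite /S /sum4 !addr_gt0 // expR_gt0.
have Ppos z : disc 0 r z -> 0 < P z.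
  rewrite /disc /= subr0 => h; rewrite /P -cabs_sq subr_gt0.
  by rewrite ltr_pXn2r // ?nnegrE ?cabs_ge0 // ltW // (le_lt_trans (cabs_ge0 _) h).
pose d := r - cabs z0.
have d0 : 0 < d by rewrite /d subr_gt0; rewrite /disc /= subr0 in hz0.
have line v (t : R) : cabs v = 1 -> `|t| < d -> disc 0 r (z0 + t%:C * v).
  move=> v1 td; rewrite /disc /= subr0; apply: le_lt_trans (cabsD _ _) _.
  by rewrite cabsM cabs_real v1 mulr1; rewrite /d in td; lra.
(* As [ln (A j)] is a fifth of the logarithm of the squared modulus of [L j], this is its derivative
   in the direction [v]. *)
pose X v j := 2 / 5 * complex.Re (g j z0 * v).
have lap v : cabs v = 1 ->
  3 * (sum4 (fun j => A j * (X v j ^+ 2 + 2 / 5 * complex.Re (cd (g j) z0 * v * v))) * S z0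
       - sum4 (fun j => A j * X v j) ^+ 2) * P z0 ^+ 2
  + (- 2 * P z0 - (- 2 * (complex.Re z0 * complex.Re v + complex.Im z0 * complex.Im v)) ^+ 2)
     * S z0 ^+ 2 <= 0.
  move=> v1.
  pose W j (t : R) := ln (sqnormc (L j (z0 + t%:C * v))) / 5.
  pose W1 j (t : R) := 2 / 5 * complex.Re (g j (z0 + t%:C * v) * v).
  pose Pl (t : R) := P (z0 + t%:C * v).
  pose P1 (t : R) := - 2 * (complex.Re (z0 + t%:C * v) * complex.Re v
     + complex.Im (z0 + t%:C * v) * complex.Im v).
  have hl (t : R) : rdv (fun s : R => z0 + s%:C * v) t v.
    by have := @cdvZ_line id z0 v t 1 (dervat_id _ _ _); rewrite mul1r.
  have l0 : z0 + 0%:C * v = z0 by rewrite rmorph0 mul0r addr0.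
  have n0 : `|0 : R| < d by rewrite normr0.
  have sq1 : complex.Re v ^+ 2 + complex.Im v ^+ 2 = 1.
    by rewrite -[LHS]/(sqnormc v) -cabs_sq v1 expr1n.
  have := @log_max_test R W W1 (fun j => 2 / 5 * complex.Re (cd (g j) z0 * v * v))
     Pl P1 (- 2) d d0.
  rewrite /W /W1 /Pl /P1 l0; apply.
  - move=> j t j4 td; have hz := line v t v1 td.
    have h := rdv_ln_sqnormc (L0 j _ j4 hz) (cdvZ_line (Ld j _ hz)).
    have := is_deriveZ_fun 5^-1 h.
    rewrite (_ : (fun s => 5^-1 * _) = (fun s : R => ln (sqnormc (L j (z0 + s%:C * v))) / 5)).
      move=> k; apply: (@is_derive_eq _ _ _ _ _ _ _ _ k).
      by rewrite mulrA [5^-1 * 2]mulrC /g; congr (_ * complex.Re _); rewrite mulrAC.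
    by apply/funext => s; rewrite mulrC.
  - move=> j j4; have gd : cdv (g j) z0 (cd (g j) z0) by apply: cdvP; apply: gh.
    have gd0 : cdv (g j) (z0 + 0%:C * v) (cd (g j) z0) by rewrite l0.
    have h := rdv_Re (dervatZ v (cdvZ_line gd0)).
    have := is_deriveZ_fun (2 / 5) h.
    rewrite (_ : (fun s => 2 / 5 * _) = (fun s : R => 2 / 5 * complex.Re (g j (z0 + s%:C * v) * v))).
      by move=> k; apply: (@is_derive_eq _ _ _ _ _ _ _ _ k); rewrite mulrC [v * _]mulrC mulrC.
    by apply/funext => s; rewrite [v * _]mulrC.
  - move=> t td; split; first exact: Ppos (line v t v1 td).
    have hR := rdv_Re (hl t); have hI := rdv_Im (hl t).
    have h := is_deriveD_fun (is_derive_cst (r ^+ 2) t 1) (is_deriveZ_fun (-1)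
      (is_deriveD_fun (is_deriveM_fun hR hR) (is_deriveM_fun hI hI))).
    have -> : (fun s : R => P (z0 + s%:C * v)) = (fun s : R => cst (r ^+ 2) s +
      -1 * (complex.Re (z0 + s%:C * v) * complex.Re (z0 + s%:C * v) +
            complex.Im (z0 + s%:C * v) * complex.Im (z0 + s%:C * v))).
      by apply/funext => s; rewrite /P /sqnormc /= !expr2 mulN1r.
    by apply: (@is_derive_eq _ _ _ _ _ _ _ _ h); ring.
  - have hR := rdv_Re (hl 0); have hI := rdv_Im (hl 0).
    have h := is_deriveZ_fun (-2) (is_deriveD_fun (is_deriveZ_fun (complex.Re v) hR)
       (is_deriveZ_fun (complex.Im v) hI)).
    have -> : (fun t : R => - 2 * (complex.Re (z0 + t%:C * v) * complex.Re v
     + complex.Im (z0 + t%:C * v) * complex.Im v)) = (fun t : R => - 2 *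
      (complex.Re v * complex.Re (z0 + t%:C * v) + complex.Im v * complex.Im (z0 + t%:C * v))).
      by apply/funext => s; rewrite [complex.Re v * _]mulrC [complex.Im v * _]mulrC.
    apply: (@is_derive_eq _ _ _ _ _ _ _ _ h).
    by rewrite -!expr2 sq1 mulr1.
  - move=> t td; have hz := line v t v1 td.
    have hP := Ppos _ hz; have hP0 := Ppos _ hz0.
    have e z : disc 0 r z -> 3 * ln (S z) + ln (P z) = ln (S z ^+ 3 * P z).
      move=> hz'; rewrite lnM ?posrE ?exprn_gt0 ?Ppos //.
      by rewrite lnXn // mulr_natl.
    rewrite -/(S (z0 + t%:C * v)) -/(S z0) !e //.
    by rewrite ler_ln ?posrE ?mulr_gt0 ?exprn_gt0 // hmax.
(* The directions [1] and ['i] together make the Laplacian. The terms [T] come from second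
   derivatives of the harmonic functions [ln |L j|] and cancel in the sum. *)
have lap1 := lap 1 (cabs1 R); have lapi := lap 'i%C (cabsi R).
pose x j := 2 / 5 * complex.Re (g j z0); pose y j := - (2 / 5 * complex.Im (g j z0)).
pose T := sum4 (fun j => A j * (2 / 5 * complex.Re (cd (g j) z0))).
pose Q (u : nat -> R) := sum4 (fun j => A j * u j ^+ 2) * S z0
  - sum4 (fun j => A j * u j) ^+ 2.
have SE : S z0 = sum4 A by [].
have {}lap1 : 3 * (Q x + T * S z0) * P z0 ^+ 2
    + (- 2 * P z0 - 4 * complex.Re z0 ^+ 2) * S z0 ^+ 2 <= 0.
  apply: le_trans lap1; rewrite le_eqVlt; apply/orP; left; apply/eqP.
  by rewrite /Q /T /X /x /sum4 !mulr1 /=; ring.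
have {}lapi : 3 * (Q y - T * S z0) * P z0 ^+ 2
    + (- 2 * P z0 - 4 * complex.Im z0 ^+ 2) * S z0 ^+ 2 <= 0.
  apply: le_trans lapi; rewrite le_eqVlt; apply/orP; left; apply/eqP.
  have r1 w : complex.Re (w * 'i%C) = - complex.Im w :> R by case: w => u v /=; ring.
  have r2 w : complex.Re (w * 'i%C * 'i%C) = - complex.Re w :> R.
    by case: w => u v /=; ring.
  by rewrite /Q /T /X /y /sum4 !r2 !r1 /=; ring.
have PE : 4 * P z0 + 4 * (complex.Re z0 ^+ 2 + complex.Im z0 ^+ 2) = 4 * r ^+ 2.
  by rewrite /P /sqnormc; ring.
have lapS : 3 * (Q x + Q y) * P z0 ^+ 2 <= 4 * r ^+ 2 * S z0 ^+ 2.
  by rewrite -PE; move: lap1 lapi; set s := S z0; set w := P z0; lra.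
have AE j : (j < 4)%N -> sqnormc (L j z0) = A j ^+ 5.
  move=> j4; have s0 : 0 < sqnormc (L j z0) by rewrite -cabs_sq exprn_gt0 // cabs_gt0 L0.
  by rewrite /A -expRM_natl mulrC divfK ?pnatr_eq0 // lnK.
pose W := cd a z0 * b z0 - a z0 * cd b z0.
have WA : sqnormc W = (A 0%N * A 1%N * A 2%N * A 3%N) ^+ 4.
  have sqX w n : sqnormc (w ^+ n) = sqnormc w ^+ n :> R.
    by rewrite -!cabs_sq cabsX -!exprM mulnC.
  apply/eqP; rewrite -(@eqrXn2 _ 5) ?sqnormc_ge0 ?exprn_ge0 // ?mulr_ge0 ?(ltW (A0 _)) //.
  by rewrite -sqX WE sqX !sqnormcM !AE //; apply/eqP; ring.
(* The pair [m], [n] collects the forms comparable to [S], one from each of the pairs [0], [1] and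
   [2], [3]. The complementary pair [i], [k], which may contain a form close to zero, is the one
   kept in Lagrange's identity. *)
have main i k m n : (i < 2)%N -> (2 <= k < 4)%N ->
    A 0%N * A 1%N * A 2%N * A 3%N = A i * A k * (A m * A n) ->
    S z0 <= K * A m -> S z0 <= K * A n ->
    S z0 ^+ 6 * P z0 ^+ 2 <= K ^+ 8 * (25 / 3) / c0 * r ^+ 2.
  move=> i2 k4 Aprod Sm Sn.
  have i4 : (i < 4)%N by apply: leq_trans i2 _.
  have k4' : (k < 4)%N by case/andP: k4.
  set c := p i * q k - p k * q i.
  have cc0 : c0 <= sqnormc c by apply: hc.
  have Ai := A0 i; have Ak := A0 k; have Am := A0 m; have An := A0 n.
  have gW : (g i z0 - g k z0) * (L i z0 * L k z0) = c * W.
    have Li := L0 i z0 i4 hz0; have Lk := L0 k z0 k4' hz0.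
    have -> : (g i z0 - g k z0) * (L i z0 * L k z0) =
      (p i * cd a z0 + q i * cd b z0) * L k z0 - (p k * cd a z0 + q k * cd b z0) * L i z0.
      by rewrite /g; field; rewrite ?Li ?Lk.
    by rewrite /L /c /W; ring.
  (* The point of the exponents [5] and [4]: [A i] and [A k] occur to the power [1 + 4 - 5 = 0]. A
     form close to zero therefore does not spoil the lower bound. *)
  have gA : A i * A k * sqnormc (g i z0 - g k z0) = sqnormc c * (A m * A n) ^+ 4.
    have := congr1 (@sqnormc R) gW; rewrite !sqnormcM WA !AE // Aprod => E.
    have ik0 : (A i * A k) ^+ 4 != 0 by rewrite gt_eqF // exprn_gt0 // mulr_gt0.
    apply: (mulfI ik0); rewrite exprMn mulrCA in E *.
    by rewrite -[RHS]mulrCA -E; ring.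
  have Anon j : 0 <= A j by exact: ltW (A0 j).
  have lx := @lagrange4 R A x i k i2 k4 Anon; have ly := @lagrange4 R A y i k i2 k4 Anon.
  have gxy : (x i - x k) ^+ 2 + (y i - y k) ^+ 2 = 4 / 25 * sqnormc (g i z0 - g k z0).
    by rewrite /x /y /sqnormc !raddfB /=; field.
  have QA : 4 / 25 * (sqnormc c * (A m * A n) ^+ 4) <= Q x + Q y.
    rewrite -gA /Q SE mulrCA -gxy mulrDr ![_ * sum4 A]mulrC.
    exact: lerD lx ly.
  have S0 := Spos z0; have P0 := Ppos z0 hz0.
  have S8 : S z0 ^+ 8 <= K ^+ 8 * (A m * A n) ^+ 4.
    have S2 : S z0 ^+ 2 <= K ^+ 2 * (A m * A n).
      rewrite expr2 (_ : K ^+ 2 * _ = (K * A m) * (K * A n)); last by ring.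
      by apply: ler_pM => //; exact: ltW.
    rewrite (_ : 8 = 2 * 4)%N // !exprM -exprMn.
    by rewrite lerXn2r // ?nnegrE ?mulr_ge0 ?exprn_ge0 ?(ltW S0) // ltW.
  have fin : 12 / 25 * c0 * S z0 ^+ 8 * P z0 ^+ 2 <= 4 * K ^+ 8 * r ^+ 2 * S z0 ^+ 2.
    have B0 : 0 <= (A m * A n) ^+ 4 by rewrite exprn_ge0 // mulr_ge0 // ltW.
    have K8 : 0 <= K ^+ 8 by rewrite exprn_ge0 // ltW.
    have P2 : 0 <= P z0 ^+ 2 by rewrite sqr_ge0.
    apply: (@le_trans _ _ (12 / 25 * c0 * (K ^+ 8 * (A m * A n) ^+ 4) * P z0 ^+ 2)).
      by rewrite ler_wpM2r // ler_wpM2l // mulr_ge0 // ltW.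
    apply: (@le_trans _ _ (K ^+ 8 * (3 * (Q x + Q y) * P z0 ^+ 2))); last first.
      rewrite (_ : 4 * K ^+ 8 * _ * _ = K ^+ 8 * (4 * r ^+ 2 * S z0 ^+ 2)); last by ring.
      by rewrite ler_wpM2l.
    rewrite (_ : 12 / 25 * c0 * _ * _ = K ^+ 8 * (3 * (4 / 25 * (c0 * (A m * A n) ^+ 4))
      * P z0 ^+ 2)); last by field.
    rewrite ler_wpM2l // ler_wpM2r // ler_wpM2l //; apply: le_trans QA.
    by rewrite ler_wpM2l // ler_wpM2r.
  rewrite [X in _ <= X]mulrAC ler_pdivlMr //.
  have S2 : 0 < S z0 ^+ 2 * (12 / 25) by rewrite mulr_gt0 // ?exprn_gt0 // divr_gt0.
  rewrite -(ler_pM2r S2); apply: le_trans (le_trans fin _).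
    by rewrite le_eqVlt; apply/orP; left; apply/eqP; ring.
  by rewrite le_eqVlt; apply/orP; left; apply/eqP; field.
move: SA1 SA2; have [h1|h1] := leP (A 0%N) (A 1%N); have [h2|h2] := leP (A 2%N) (A 3%N) => k1 k2.
- by apply: (main 0%N 2%N 1%N 3%N) => //; ring.
- by apply: (main 0%N 3%N 1%N 2%N) => //; ring.
- by apply: (main 1%N 2%N 0%N 3%N) => //; ring.
- by apply: (main 1%N 3%N 0%N 2%N) => //; ring.
Qed.

End Estimate.



(** * The a priori bound at the center of a flat disc *)

Section FlatDisc.
Variable R : realType.

Lemma continuous_fifth_root (x : R) : 0 < x ->
  {for x, continuous (fun y : R => expR (ln y / 5))}.
Proof.
move=> x0.
have h := is_derive_exp_fun (is_deriveM_fun (is_derive1_ln x0) (is_derive_cst (5^-1 : R) x 1)).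
exact/differentiable_continuous/derivable1_diffP/(@ex_derive _ _ _ _ _ _ _ h).
Qed.

Lemma fifth_root_X (x : R) : 0 < x -> expR (ln x / 5) ^+ 5 = x.
Proof. by move=> x0; rewrite -expRM_natl mulrC divfK ?pnatr_eq0 // lnK. Qed.

(** The function [S ^+ 3 * P] vanishes on the boundary circle, so it has an interior maximum, where
    the curvature inequality bounds it. Comparison with the center gives [S 0 ^+ 6 * r1 ^+ 2 <= C1];
    the fifth power of this is the claim, since the squared norm of the forms is at most
    [c1 * S 0 ^+ 5]. *)
Theorem flat_disc_estimate (p q : nat -> R[i]) :
  (forall i k, (i < 4)%N -> (k < 4)%N -> i <> k -> p i * q k - p k * q i != 0) ->
  exists2 C : R, 0 < C & forall (r : R) (a b : R[i] -> R[i]),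
    let L j z := p j * a z + q j * b z in
    0 < r -> holo (disc 0 r) a -> holo (disc 0 r) b ->
    (forall j z, (j < 4)%N -> disc 0 r z -> L j z != 0) ->
    (forall z, disc 0 r z -> (cd a z * b z - a z * cd b z) ^+ 5 =
       (L 0%N z * L 1%N z * L 2%N z * L 3%N z) ^+ 4) ->
    (sqnormc (a 0) + sqnormc (b 0)) ^+ 6 * r ^+ 10 <= C.
Proof.
move=> hpq.
have [c1 c11 hc1] := @linear_forms_comparable R p q 0%N 1%N (hpq 0%N 1%N isT isT ltac:(by [])).
have [c2 c21 hc2] := @linear_forms_comparable R p q 2%N 3%N (hpq 2%N 3%N isT isT ltac:(by [])).
have nn := @sqnormc_ge0 R.
pose cL := 1 + sum4 (fun j => 2 * (sqnormc (p j) + sqnormc (q j))).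
have cLj j : (j < 4)%N -> 2 * (sqnormc (p j) + sqnormc (q j)) <= cL.
  have k i := nn (p i); have k' i := nn (q i).
  have := k 0%N; have := k 1%N; have := k 2%N; have := k 3%N.
  have := k' 0%N; have := k' 1%N; have := k' 2%N; have := k' 3%N.
  by rewrite /cL /sum4; case: j => [|[|[|[|//]]]] => *; lra.
have cL1 : 1 <= cL.
  have k i : 0 <= 2 * (sqnormc (p i) + sqnormc (q i)).
    by rewrite mulr_ge0 // addr_ge0 // nn.
  have := k 0%N; have := k 1%N; have := k 2%N; have := k 3%N.
  by rewrite /cL /sum4; lra.
pose kk := cL * (c1 + c2).
have kk1 : 1 <= kk by rewrite /kk; nra.
have [k1 k2] : cL * c1 <= kk /\ cL * c2 <= kk by rewrite /kk; split; nra.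
pose K := 4 * kk.
pose c0 := Num.min (Num.min (sqnormc (p 0%N * q 2%N - p 2%N * q 0%N))
    (sqnormc (p 0%N * q 3%N - p 3%N * q 0%N)))
  (Num.min (sqnormc (p 1%N * q 2%N - p 2%N * q 1%N))
    (sqnormc (p 1%N * q 3%N - p 3%N * q 1%N))).
have sq0 (z : R[i]) : z != 0 -> 0 < sqnormc z.
  by move=> z0; rewrite -cabs_sq exprn_gt0 // cabs_gt0.
have c00 : 0 < c0.
  by rewrite !lt_min; apply/andP; split; apply/andP; split; apply: sq0; apply: hpq.
have hc0 i k : (i < 2)%N -> (2 <= k < 4)%N -> c0 <= sqnormc (p i * q k - p k * q i).
  by case: i => [|[|//]] _; case: k => [//|[//|[|[|//]]]] _; rewrite !ge_min lexx ?orbT.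
have K0 : 0 < K by rewrite /K; lra.
pose C1 := K ^+ 8 * (25 / 3) / c0.
have C10 : 0 < C1 by rewrite divr_gt0 // mulr_gt0 ?exprn_gt0 //; lra.
exists (c1 ^+ 6 * C1 ^+ 5 * 2 ^+ 10).
  have c1p : 0 < c1 by lra.
  by apply: mulr_gt0; [apply: mulr_gt0|]; apply: exprn_gt0.
move=> r a b L r0 ah bh L0 WE.
(* Nothing is known on the circle of radius [r]; on the disc of half the radius the maximum can be
   taken over a compact set. *)
pose r1 := r / 2.
have r10 : 0 < r1 by rewrite /r1; lra.
have sub : disc 0 r1 `<=` disc (0 : R[i]) r.
  by move=> z; rewrite /disc /= /r1; lra.
have ah1 := holo_sub sub ah; have bh1 := holo_sub sub bh.
pose A j z := expR (ln (sqnormc (L j z)) / 5).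
pose S z := sum4 (fun j => A j z).
pose P z := r1 ^+ 2 - sqnormc z.
have A0 j z : 0 < A j z by rewrite expR_gt0.
have S0 z : 0 < S z by rewrite /S /sum4 !addr_gt0.
have AE j z : (j < 4)%N -> disc 0 r z -> A j z ^+ 5 = sqnormc (L j z).
  by move=> j4 hz; rewrite fifth_root_X // sq0 // L0.
have maxX (x y : R) : 0 <= x -> 0 <= y -> Num.max x y ^+ 5 = Num.max (x ^+ 5) (y ^+ 5).
  move=> x0 y0; have [xy|yx] := leP x y.
    by rewrite (max_idPr _) // lerXn2r.
  by rewrite (max_idPl _) // lerXn2r // ?nnegrE // ltW.
have Lup j z : (j < 4)%N -> sqnormc (L j z) <= cL * (sqnormc (a z) + sqnormc (b z)).
  move=> j4; apply: le_trans (sqnormc_lin _ _ _ _) _.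
  by rewrite ler_wpM2r ?cLj // addr_ge0 // nn.
have comp c i k z : (i < 4)%N -> (k < 4)%N -> disc 0 r z -> cL * c <= kk -> 0 <= c ->
    (sqnormc (a z) + sqnormc (b z) <= c * Num.max (sqnormc (L i z)) (sqnormc (L k z))) ->
    S z <= K * Num.max (A i z) (A k z).
  move=> i4 k4 hz cc cpos hN.
  have m0 : 0 < Num.max (A i z) (A k z) by rewrite lt_max A0.
  (* The forms are comparable at the level of fifth powers, with constant [kk]; since [kk >= 1], one
     has [kk <= kk ^+ 5] and the same constant serves for [A]. *)
  have Aj j : (j < 4)%N -> A j z <= kk * Num.max (A i z) (A k z).
    move=> j4; rewrite -(@ler_pXn2r _ 5) // ?nnegrE ?(ltW (A0 _ _)) //; last first.
      by rewrite mulr_ge0 ?(ltW m0) //; lra.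
    rewrite AE // (le_trans (Lup j z j4)) // exprMn maxX ?(ltW (A0 _ _)) //.
    rewrite !AE //; set m := Num.max _ _ in hN *.
    have mm : 0 <= m by rewrite le_max nn.
    apply: (@le_trans _ _ (cL * (c * m))); first by rewrite ler_wpM2l //; lra.
    rewrite mulrA ler_wpM2r // (le_trans cc) //.
    by rewrite -[X in X <= _]expr1 ler_weXn2l.
  by rewrite /S /sum4 /K; have := Aj 0%N; have := Aj 1%N; have := Aj 2%N;
    have := Aj 3%N => /(_ isT) ? /(_ isT) ? /(_ isT) ? /(_ isT) ?; lra.
pose f z := S z ^+ 3 * P z.
have fc z : cabs z <= r1 -> ccont (fun w => (f w)%:C) z.
  move=> zr; have hz : disc 0 r z by rewrite /disc /= subr0; rewrite /r1 in zr; lra.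
  have Ac j : (j < 4)%N -> ccont (fun w => (A j w)%:C) z.
    move=> j4; apply: (@rcont_comp _ (fun y => expR (ln y / 5)) (fun w => sqnormc (L j w))).
      by apply: continuous_fifth_root; apply: sq0; apply: L0.
    apply: rcont_sqnormc; have [l al] := ah z hz; have [m bm] := bh z hz.
    exact: (contatD (contatM (contat_cst _ _ _ _) (dervat_contat al))
                    (contatM (contat_cst _ _ _ _) (dervat_contat bm))).
  have Sc : ccont (fun w => (A 0%N w)%:C + (A 1%N w)%:C + (A 2%N w)%:C + (A 3%N w)%:C) z.
    by do 3 (apply: contatD; last exact: Ac); exact: Ac.
  have Pc : ccont (fun w => (r1 ^+ 2)%:C - (sqnormc w)%:C) z.
    apply: contatB; first exact: contat_cst.
    by apply: rcont_sqnormc; exact: contat_id.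
  have := contatM (contatM (contatM Sc Sc) Sc) Pc.
  have E w : ((A 0%N w)%:C + (A 1%N w)%:C + (A 2%N w)%:C + (A 3%N w)%:C) *
    ((A 0%N w)%:C + (A 1%N w)%:C + (A 2%N w)%:C + (A 3%N w)%:C) *
    ((A 0%N w)%:C + (A 1%N w)%:C + (A 2%N w)%:C + (A 3%N w)%:C) *
    ((r1 ^+ 2)%:C - (sqnormc w)%:C) = (f w)%:C.
    rewrite -!rmorphD -rmorphB -!rmorphM /=; congr (_%:C).
    by rewrite /f /S /P /sum4; ring.
  by apply: contat_eq; [exact: E|exists 1 => // w _ _; exact: E].
have [z0 z0r zmax] := EVT_cdisc (ltW r10) fc.
have P00 : P 0 = r1 ^+ 2 by rewrite /P /sqnormc /= expr0n addr0 subr0.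
have f0 : 0 < f 0 by rewrite /f P00 mulr_gt0 // exprn_gt0.
have fz0 : f 0 <= f z0 by apply: zmax; rewrite cabs0 ltW.
have hz0 : disc 0 r1 z0.
  rewrite /disc /= subr0 lt_neqAle z0r andbT; apply/eqP => zE.
  by move: fz0; rewrite leNgt /f /P -cabs_sq zE subrr mulr0 f0.
have hc1' z := hc1 (a z) (b z); have hc2' z := hc2 (a z) (b z).
have := @estimate_at_max R p q a b z0 r1 c0 K c00 K0 hc0 ah1 bh1.
move=> /(_ (fun j z j4 hz => L0 j z j4 (sub z hz)) (WE _ (sub _ hz0))).
have d0 : 0 <= c1 by lra.
have d0' : 0 <= c2 by lra.
have s1 := @comp c1 0%N 1%N z0 isT isT (sub _ hz0) k1 d0 (hc1' z0).
have s2 := @comp c2 2%N 3%N z0 isT isT (sub _ hz0) k2 d0' (hc2' z0).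
move=> /(_ s1 s2 hz0) hh.
have {hh} : S z0 ^+ 6 * P z0 ^+ 2 <= C1 * r1 ^+ 2.
  apply: hh => z; rewrite /disc /= subr0 => zr; exact: zmax (ltW zr).
move=> hS.
have h6 : S 0 ^+ 6 * r1 ^+ 2 <= C1.
  have : f 0 ^+ 2 <= f z0 ^+ 2.
    by rewrite lerXn2r // ?nnegrE ?ltW // (lt_le_trans f0).
  have E z : f z ^+ 2 = S z ^+ 6 * P z ^+ 2 by rewrite /f exprMn -exprM.
  rewrite !E P00 => h; have := le_trans h hS.
  by rewrite [(r1 ^+ 2) ^+ 2]expr2 mulrA ler_pM2r // exprn_gt0.
have c0d := disc_center 0 r0.
have N1 : sqnormc (a 0) + sqnormc (b 0) <= c1 * S 0 ^+ 5.
  apply: le_trans (hc1' 0) _; rewrite ler_wpM2l // -!AE //.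
  rewrite -maxX ?(ltW (A0 _ _)) // lerXn2r // ?nnegrE ?(ltW (S0 _)) //.
    by rewrite le_max ltW.
  rewrite ge_max /S /sum4; have := A0 0%N 0; have := A0 1%N 0; have := A0 2%N 0.
  have := A0 3%N 0; move: (A _ _) (A _ _) (A _ _) (A _ _) => a0 a1 a2 a3 ? ? ? ?.
  by apply/andP; split; lra.
have N0 : 0 <= sqnormc (a 0) + sqnormc (b 0) by rewrite addr_ge0 // nn.
have N6 : (sqnormc (a 0) + sqnormc (b 0)) ^+ 6 <= c1 ^+ 6 * S 0 ^+ 30.
  rewrite (_ : S 0 ^+ 30 = (S 0 ^+ 5) ^+ 6); last by rewrite -(exprM _ 5 6).
  by rewrite -exprMn lerXn2r // ?nnegrE // mulr_ge0 // exprn_ge0 // ltW.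
have S30 : S 0 ^+ 30 * r1 ^+ 10 <= C1 ^+ 5.
  have -> : S 0 ^+ 30 * r1 ^+ 10 = (S 0 ^+ 6 * r1 ^+ 2) ^+ 5.
    by rewrite [RHS]exprMn -(exprM _ 6 5) -(exprM _ 2 5).
  by rewrite lerXn2r // ?nnegrE ?(ltW C10) // mulr_ge0 // exprn_ge0 // ltW.
rewrite (_ : r = 2 * r1); last by rewrite /r1; field.
rewrite exprMn [2 ^+ 10 * _]mulrC mulrA ler_wpM2r // ?exprn_ge0 //.
apply: (@le_trans _ _ (c1 ^+ 6 * S 0 ^+ 30 * r1 ^+ 10)).
  by rewrite ler_wpM2r // exprn_ge0 // ltW.
by rewrite -mulrA ler_wpM2l // exprn_ge0.
Qed.

End FlatDisc.



(** * Coordinates *)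

Section Bridges.
Variable R : realType.
Implicit Types (z w : R[i]) (x y : 'rV[R]_2).

Lemma ord2P (i : 'I_2) : i = 0 \/ i = 1.
Proof. by case: i => [[|[|//]] ?]; [left|right]; apply: val_inj. Qed.

Lemma C_of_planeK x : plane_of_C (C_of_plane x) = x.
Proof.
apply/rowP => i; rewrite mxE /C_of_plane /=.
by have [->|->] := ord2P i.
Qed.

Lemma plane_of_CK z : C_of_plane (plane_of_C z) = z.
Proof. by rewrite /C_of_plane /plane_of_C !mxE /=; case: z. Qed.

(** A radius in [R[i]] is a positive complex number, and positivity there forces a zero imaginary
    part. *)
Lemma nbhs_complexP z (U : set R[i]) : nbhs (z : R[i]^o) U <->
  exists2 d, 0 < d & forall w, cabs (w - z) < d -> U w.
Proof.
split=> [|[d d0 h]].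
  move=> /nbhs_ballP [e /= e0 h]; exists (complex.Re e).
    by move: e0; rewrite ltcE => /andP[_].
  move=> w wz; apply: h; rewrite -ball_normE /= cabs_normc.
  move: e0; rewrite ltcE /= => /andP[/eqP ei _].
  have -> : e = (complex.Re e)%:C by case: e ei {wz} => u v /= ->.
  by rewrite ltcR cabsBC.
apply/nbhs_ballP; exists d%:C; first by rewrite /= ltcR.
move=> w; rewrite -ball_normE /= cabs_normc ltcR cabsBC; exact: h.
Qed.

Lemma nbhs_planeP x (U : set 'rV[R]_2) : nbhs x U <->
  exists2 d, 0 < d & forall y, cabs (C_of_plane y - C_of_plane x) < d -> U y.
Proof.
have sub y : C_of_plane y - C_of_plane x = (y 0 0 - x 0 0) +i* (y 0 1 - x 0 1) by [].
split=> [|[d d0 h]].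
  move=> /nbhs_ballP [e /= e0 h]; exists e => // y yx; apply: h; split => // i j.
  rewrite (ord1 i) /ball /= distrC; apply: le_lt_trans yx; rewrite sub.
  have [->|->] := ord2P j; first exact: (Re_le_cabs (_ +i* _)).
  exact: (Im_le_cabs ((y 0 0 - x 0 0) +i* (y 0 1 - x 0 1))).
apply/nbhs_ballP; exists (d / 2); first by rewrite /= divr_gt0.
move=> y [_ yx]; apply: h; apply: le_lt_trans (cabs_le_ReIm _) _; rewrite sub /=.
have := yx 0 0; have := yx 0 1; rewrite /ball /= => h1 h2.
by rewrite -[X in X + _]distrC -[X in _ + X]distrC; lra.
Qed.

Lemma cderivableP (g : R[i] -> R[i]) z : cderivable g z <-> exists l, cdv g z l.
Proof.
rewrite /cderivable /derivable; split=> [|[l gl]].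
  move=> /cvg_ex [l /cvgrPdist_le h]; exists l => e e0.
  have := h e%:C; rewrite ltcR => /(_ e0).
  rewrite near_withinE => /nbhs_complexP [d d0 hd].
  exists d => // y _ yz; have [->|yz0] := eqVneq y z.
    by rewrite !subrr mulr0 subr0 cabs0 mulr0.
  have yz1 : y - z != 0 by rewrite subr_eq0.
  have := hd (y - z); rewrite subr0 => /(_ yz yz1).
  rewrite /= cabs_normc lecR /GRing.scale /= mulr1 subrK => k.
  rewrite -ler_pdivrMr ?cabs_gt0 //; apply: le_trans k.
  rewrite -cabsV -cabsM cabsBC le_eqVlt; apply/orP; left; apply/eqP.
  by congr cabs; field.
apply/cvg_ex; exists l; apply/cvgrPdist_le => e e0.
move: e0; rewrite ltcE /= => /andP[/eqP ei e0].
have -> : e = (complex.Re e)%:C by case: e ei {e0} => u v /= ->.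
have [d d0 hd] := gl _ e0.
rewrite near_withinE; apply/nbhs_complexP; exists d => // h; rewrite subr0 => hd' h0.
have := hd (h + z) Logic.I; rewrite /= addrK => /(_ hd') k.
rewrite cabs_normc lecR /GRing.scale /= mulr1.
rewrite -ler_pdivrMr ?cabs_gt0 // in k; apply: le_trans k.
rewrite -cabsV -cabsM cabsBC le_eqVlt; apply/orP; left; apply/eqP.
by congr cabs; field.
Qed.

Lemma cderiveE (g : R[i] -> R[i]) z l : cdv g z l -> cderive g z = l.
Proof.
move=> gl; rewrite /cderive derive1E /derive.
apply: (cvg_lim (@norm_hausdorff (R[i] : numFieldType) (R[i]^o))).
apply/cvgrPdist_le => e e0.
move: e0; rewrite ltcE /= => /andP[/eqP ei e0].
have -> : e = (complex.Re e)%:C by case: e ei {e0} => u v /= ->.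
have [d d0 hd] := gl _ e0.
rewrite near_withinE; apply/nbhs_complexP; exists d => // h; rewrite subr0 => hd' h0.
have := hd (h + z) Logic.I; rewrite /= addrK => /(_ hd') k.
rewrite /= cabs_normc lecR /GRing.scale /= mulr1.
rewrite -ler_pdivrMr ?cabs_gt0 // in k; apply: le_trans k.
rewrite -cabsV -cabsM cabsBC le_eqVlt; apply/orP; left; apply/eqP.
by congr cabs; field.
Qed.

End Bridges.



Section ComplexCoordinate.
Variables (R : realType) (X : topologicalType) (c : chart R X).
Implicit Types (t : X) (z w : R[i]).

Definition cz t : R[i] := C_of_plane (c t).
Definition ci z : X := cinv c (plane_of_C z).
Definition cO : set R[i] := [set z | ccod c (plane_of_C z)].

Lemma cz_cO t : cdom c t -> cO (cz t).
Proof. by move=> ct; rewrite /cO /cz /= C_of_planeK; apply: cmap_cod. Qed.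

Lemma ciK t : cdom c t -> ci (cz t) = t.
Proof. by move=> ct; rewrite /ci /cz C_of_planeK cmapK. Qed.

Lemma czK z : cO z -> cz (ci z) = z.
Proof. by move=> hz; rewrite /ci /cz cinvK // plane_of_CK. Qed.

Lemma ci_dom z : cO z -> cdom c (ci z).
Proof. exact: cinv_dom. Qed.

Lemma cO_open : copen cO.
Proof.
move=> z hz; have /nbhs_planeP [d d0 h] : nbhs (plane_of_C z) (ccod c).
  by apply: open_nbhs_nbhs; split => //; exact: ccod_open.
exists d => // w hw; apply: h; rewrite !plane_of_CK; exact: hw.
Qed.

Lemma ci_nbhs z (U : set X) : cO z -> nbhs (ci z) U ->
  exists2 d, 0 < d & forall w, disc z d w -> cO w /\ U (ci w).
Proof.
move=> hz hU; have [d d0 hd] := cO_open hz.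
have /nbhs_planeP [d' d'0 h] := cinv_cts hz hU.
exists (Num.min d d') => [|w]; first by rewrite lt_min d0.
rewrite /disc /= lt_min => /andP[wd wd']; split; first exact: hd.
by apply: h; rewrite !plane_of_CK.
Qed.

Lemma cz_nbhs t d : cdom c t -> 0 < d ->
  nbhs t [set s | cdom c s /\ disc (cz t) d (cz s)].
Proof.
move=> ct d0.
have h1 : nbhs t (cdom c) by apply: open_nbhs_nbhs; split => //; exact: cdom_open.
have h2 : nbhs t [set s | disc (cz t) d (cz s)].
  have : nbhs (c t) [set y | cabs (C_of_plane y - C_of_plane (c t)) < d].
    by apply/nbhs_planeP; exists d.
  by move=> h; have := cmap_cts ct h.
by apply: filterS (filterI h1 h2) => s [].
Qed.

End ComplexCoordinate.

(** * The two forms of a matrix-valued map, their Wronskian and their pullbacks *)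

Section Forms.
Variable R : realType.
Implicit Types (G H : 'I_2 -> 'I_2 -> R[i] -> R[i]).

(** With [omm], the off-diagonal entries of [G^-1 G'] when [G] has determinant one, the inverse
    being the adjugate matrix. *)
Definition thm G (w : R[i]) : R[i] := G 1 1 w * cd (G 0 1) w - G 0 1 w * cd (G 1 1) w.
Definition omm G (w : R[i]) : R[i] := G 0 0 w * cd (G 1 0) w - G 1 0 w * cd (G 0 0) w.
Definition wronskian (a b : R[i] -> R[i]) (w : R[i]) : R[i] := cd a w * b w - a w * cd b w.

Lemma cd_eq (f g : R[i] -> R[i]) (w : R[i]) (d : R) : 0 < d ->
  (forall v, disc w d v -> f v = g v) -> (exists l, cdv f w l) ->
  cdv g w (cd f w) /\ cd g w = cd f w.
Proof.
move=> d0 fg fh.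
have h : cdv g w (cd f w).
  apply: (dervat_eq _ _ (cdvP fh)); first by apply: fg; exact: disc_center.
  by exists d => // v _; exact: fg.
by split => //; exact: cdE.
Qed.

Lemma eq_cd (f g : R[i] -> R[i]) (w : R[i]) (d : R) : 0 < d ->
  (forall v, disc w d v -> f v = g v) -> cd f w = cd g w.
Proof.
move=> d0 fg; have [h|h] := pselect (exists l, cdv f w l).
  by have [_ ->] := cd_eq d0 fg h.
have [h'|h'] := pselect (exists l, cdv g w l).
  by have [_ ->] := cd_eq d0 (fun v hv => esym (fg v hv)) h'.
by rewrite /cd !xgetPN // => l hl; [apply: h'; exists l|apply: h; exists l].
Qed.

Lemma thm_holo D G : copen D -> (forall a b, holo D (G a b)) -> holo D (thm G).
Proof.
by move=> Do h; apply: holoB; apply: holoM; [exact: h|exact: holo_cd|exact: h|exact: holo_cd].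
Qed.

Lemma omm_holo D G : copen D -> (forall a b, holo D (G a b)) -> holo D (omm G).
Proof.
by move=> Do h; apply: holoB; apply: holoM; [exact: h|exact: holo_cd|exact: h|exact: holo_cd].
Qed.

Lemma wronskian_holo D a b : copen D -> holo D a -> holo D b -> holo D (wronskian a b).
Proof. by move=> Do h k; apply: holoB; apply: holoM => //; exact: holo_cd. Qed.

Section Pullback.
Variables (G H : 'I_2 -> 'I_2 -> R[i] -> R[i]) (h : R[i] -> R[i]) (D : set R[i]).
Variables (w : R[i]) (d : R).
Hypothesis d0 : 0 < d.
Hypothesis Do : copen D.
Hypothesis Hh : forall a b, holo D (H a b).
Hypothesis hD : forall v, disc w d v -> D (h v).
Hypothesis hh : holo (disc w d) h.
Hypothesis GH : forall a b v, disc w d v -> G a b v = H a b (h v).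

Lemma pullback_cd a b v : disc w d v ->
  cdv (G a b) v (cd (H a b) (h v) * cd h v) /\
  cd (G a b) v = cd (H a b) (h v) * cd h v.
Proof.
move=> hv; have [r r0 hr] := copen_disc hv.
have k : cdv (fun u => H a b (h u)) v (cd (H a b) (h v) * cd h v).
  by apply: cdv_comp; apply: cdvP; [exact: hh|apply: Hh; exact: hD].
have [] := @cd_eq (fun u => H a b (h u)) (G a b) v r r0 _ (ex_intro _ _ k).
  by move=> u /hr hu; rewrite GH.
by rewrite (cdE k).
Qed.

Lemma pullback_thm v : disc w d v -> thm G v = thm H (h v) * cd h v.
Proof.
move=> hv; rewrite /thm (pullback_cd 0 1 hv).2 (pullback_cd 1 1 hv).2 !GH //.
by ring.
Qed.

Lemma pullback_omm v : disc w d v -> omm G v = omm H (h v) * cd h v.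
Proof.
move=> hv; rewrite /omm (pullback_cd 1 0 hv).2 (pullback_cd 0 0 hv).2 !GH //.
by ring.
Qed.

(** Each form gains a factor [cd h], and differentiating it gains another one. The terms containing
    the second derivative of [h] cancel by antisymmetry, which leaves weight three. *)
Lemma pullback_wronskian : wronskian (thm G) (omm G) w =
  wronskian (thm H) (omm H) (h w) * cd h w ^+ 3.
Proof.
have hw := disc_center w d0.
have h1 := cdvP (hh hw).
have h2 := cdvP (holo_cd (@copen_disc R w d) hh hw).
have t1 := cdvP (thm_holo Do Hh (hD hw)).
have o1 := cdvP (omm_holo Do Hh (hD hw)).
have T := dervatM Logic.I (cdv_comp h1 t1) h2.
have O := dervatM Logic.I (cdv_comp h1 o1) h2.
have E1 := @eq_cd (thm G) (fun v => thm H (h v) * cd h v) w d d0 pullback_thm.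
have E2 := @eq_cd (omm G) (fun v => omm H (h v) * cd h v) w d d0 pullback_omm.
rewrite /wronskian E1 E2 (cdE T) (cdE O) (pullback_thm hw) (pullback_omm hw).
move: (cd h w) (cd _ w) (thm H _) (omm H _) (cd (thm H) _) (cd (omm H) _) => *.
by ring.
Qed.

End Pullback.

Lemma invmx2 (A : 'M[R[i]]_2) : \det A = 1 -> invmx A =
  \matrix_(i, j) (if i == 0 then (if j == 0 then A 1 1 else - A 0 1)
                  else (if j == 0 then - A 1 0 else A 0 0)).
Proof.
move=> dA; set N := (X in _ = X).
have Au : A \in unitmx by rewrite unitmxE dA unitr1.
suff NA : N *m A = 1%:M by rewrite -[LHS]mul1mx -NA -mulmxA mulmxV // mulmx1.
have dE : A 0 0 * A 1 1 - A 0 1 * A 1 0 = 1.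
  rewrite -dA (expand_det_row _ 0) !big_ord_recl big_ord0 addr0 /cofactor.
  rewrite !det_mx11 !mxE /= expr0 expr1 mul1r mulN1r mulrN.
  by congr (_ * A _ _ - A _ _ * A _ _); apply: val_inj.
apply/matrixP => i j; rewrite !mxE !big_ord_recl big_ord0 addr0 !mxE.
have e1 : lift 0 0 = 1 :> 'I_2 by apply: val_inj.
rewrite e1; have [->|->] := ord2P i; have [->|->] := ord2P j; rewrite /=.
- by rewrite -dE; ring.
- by ring.
- by ring.
- by rewrite -dE; ring.
Qed.

End Forms.



(** * Lifted charts and canonical forms *)

Section Covering.
Variables (R : realType) (S T : topologicalType) (pi : T -> S).
Hypothesis cov : covering_map pi.

(** The chart is [z \o pi] on the part of the sheet through [t] that lies over the domain of [z].
    Openness of [pi] on the sheet is what makes its inverse [sg] continuous. *)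
Lemma lifted_chart_exists (z : chart R S) (t : T) : cdom z (pi t) ->
  exists2 c, lifted_chart pi z c & cdom c t.
Proof.
move=> zt; have [pic _ /(_ (pi t)) [U [Uo Ut [I [V [Vtriv VU hV]]]]]] := cov.
have : (\bigcup_i V i) t by rewrite -VU.
move=> [i _ Vt]; have [Vo [Vmap Vinj Vsurj] Vopen] := hV i.
pose sg s := xget t [set x | V i x /\ pi x = s].
have sgP s : U s -> V i (sg s) /\ pi (sg s) = s.
  move=> Us; have [x Vx xs] := Vsurj s Us.
  by have := @xgetPex _ t [set x | V i x /\ pi x = s] (ex_intro _ x (conj Vx xs)).
have VUx x : V i x -> U (pi x) by move=> Vx; exact: Vmap.
have sgK x : V i x -> sg (pi x) = x.
  move=> Vx; have [h1 h2] := sgP _ (VUx x Vx).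
  by apply: Vinj; rewrite ?inE.
have sgc s : U s -> {for s, continuous sg}.
  move=> Us N hN; have [Vs ps] := sgP s Us.
  have Wo : open (interior N `&` V i) by apply: openI => //; exact: open_interior.
  have pWo := Vopen _ Wo (@subIsetr _ _ _).
  have : nbhs s (pi @` (interior N `&` V i)).
    apply: open_nbhs_nbhs; split => //; exists (sg s) => //; split => //.
  apply: filterS => _ [x [Nx Vx] <-]; rewrite /= sgK //.
  exact: interior_subset Nx.
pose D := V i `&` pi @^-1` cdom z.
pose O := [set x | ccod z x /\ U (cinv z x)].
have Do : open D.
  apply: openI => //; apply: open_comp; last exact: cdom_open.
  by move=> x _; exact: pic.
have Oo : open O.
  rewrite openE => x [zx Ux]; rewrite /interior.
  have h1 : nbhs x (ccod z) by apply: open_nbhs_nbhs; split => //; exact: ccod_open.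
  have h2 : nbhs (cinv z x) U by apply: open_nbhs_nbhs; split.
  have h3 : nbhs x (cinv z @^-1` U) by exact: (cinv_cts zx h2).
  by apply: filterS (filterI h1 h3) => y [].
have h1 x : D x -> O (z (pi x)).
  by move=> [Vx zx]; split; [exact: cmap_cod|rewrite cmapK //; exact: VUx].
have h2 x : O x -> D (sg (cinv z x)).
  move=> [zx Ux]; have [Vx px] := sgP _ Ux; split => //=.
  by rewrite px; exact: cinv_dom.
have h3 x : D x -> sg (cinv z (z (pi x))) = x.
  by move=> [Vx zx]; rewrite cmapK // sgK.
have h4 x : O x -> z (pi (sg (cinv z x))) = x.
  by move=> [zx Ux]; have [_ ->] := sgP _ Ux; exact: cinvK.
have h5 x : D x -> {for x, continuous (fun x => z (pi x))}.
  move=> [Vx zx]; apply: (@continuous_comp _ _ _ pi z); first exact: pic.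
  exact: cmap_cts.
have h6 x : O x -> {for x, continuous (fun x => sg (cinv z x))}.
  move=> [zx Ux]; apply: (@continuous_comp _ _ _ (cinv z) sg); last exact: sgc.
  exact: cinv_cts.
exists (Chart Do Oo h1 h2 h3 h4 h5 h6) => //.
by move=> x [].
Qed.

(** Points that cannot be separated have the same image, and their sheets meet. Disjointness makes
    it one sheet, on which [pi] is injective. *)
Lemma covering_hausdorff : hausdorff_space S -> hausdorff_space T.
Proof.
move=> hS x y xy.
have [pic _ hcov] := cov.
have pxy : pi x = pi y.
  apply: hS => M N hM hN.
  have [w [Mw Nw]] := xy _ _ (pic x _ hM) (pic y _ hN).
  by exists (pi w).
have [U [Uo Ux [I [V [Vtriv VU hV]]]]] := hcov (pi x).
have [i _ Vx] : (\bigcup_i V i) x by rewrite -VU.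
have [j _ Vy] : (\bigcup_i V i) y by rewrite -VU /= -pxy.
have [Vio [_ Vinj _] _] := hV i; have [Vjo _ _] := hV j.
have [w [Vw Vw']] := xy (V i) (V j) (open_nbhs_nbhs (conj Vio Vx)) (open_nbhs_nbhs (conj Vjo Vy)).
have ij : i = j by apply: Vtriv => //; exists w.
by subst j; apply: Vinj; rewrite ?inE.
Qed.

End Covering.

(** * Changes of lifted chart and the invariance of the vector field *)

Section LiftedData.
Variables (R : realType) (S T : topologicalType) (B : set (chart R S)).
Variables (pi : T -> S) (f nu : S -> 'M[R[i]]_2) (E : T -> 'M[R[i]]_2).
Hypothesis Bh : forall z w, B z -> B w -> holomorphic_trans z w.
Hypothesis EL : legendrian_lift B pi f nu E.

Notation LA := (lifted_atlas pi B).

Lemma lifted_chart_point (z : chart R S) (c : chart R T) w :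
  lifted_chart pi z c -> cO c w -> cO z w /\ pi (ci c w) = ci z w.
Proof.
move=> zc cw; have [zs cE] := zc _ (ci_dom cw).
have E1 : z (pi (ci c w)) = plane_of_C w by rewrite -cE /ci cinvK.
split; first by rewrite /cO /= -E1; exact: cmap_cod.
by rewrite -[LHS](cmapK zs) E1.
Qed.

Definition ctrans (c d : chart R T) (w : R[i]) : R[i] := cz d (ci c w).

(** The coordinates of lifted charts are those of charts of [B], read through [pi], so a change of
    lifted charts is locally a change of charts of [B]. *)
Lemma ctrans_holo (c d : chart R T) t : LA c -> LA d -> cdom c t -> cdom d t ->
  exists2 e, 0 < e & [/\ forall w, disc (cz c t) e w -> cO c w,
    forall w, disc (cz c t) e w -> cdom d (ci c w) &
    holo (disc (cz c t) e) (ctrans c d)].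
Proof.
move=> [z Bz zc] [z' Bz' zd] ct dt.
have dn : nbhs (ci c (cz c t)) (cdom d).
  by rewrite ciK //; apply: open_nbhs_nbhs; split => //; exact: cdom_open.
have [e e0 he] := ci_nbhs (cz_cO ct) dn.
exists e => //; split => [w /he []|w /he []|w hw] //.
have tE v : disc (cz c t) e v ->
    C_of_plane (trans z z' (plane_of_C v)) = ctrans c d v.
  move=> /he [cv dv]; rewrite /ctrans /cz /trans.
  have [zd' ->] := zd _ dv; have [_ ->] := lifted_chart_point zc cv.
  by [].
have [cw dw] := he w hw; have [zw pw] := lifted_chart_point zc cw.
have : overlap z z' (plane_of_C w).
  by split => //; rewrite -[cinv _ _]/(ci z w) -pw; have [] := zd _ dw.
move=> /(Bh Bz Bz') /cderivableP [l hl]; exists l.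
have [r r0 hr] := copen_disc hw.
apply: (dervat_eq _ _ hl); first exact: tE.
by exists r => // v _ hv; apply: tE; apply: hr.
Qed.

Definition coef (c : chart R T) (a b : 'I_2) (w : R[i]) : R[i] := E (ci c w) a b.

Lemma coef_holo c a b : LA c -> holo (cO c) (coef c a b).
Proof. by move=> hc z hz; apply/cderivableP; exact: (lift_holomorphic EL). Qed.

Lemma theta_thm c t : LA c -> cdom c t -> theta E c t = thm (coef c) (cz c t).
Proof.
move=> hc ct; rewrite /theta /maurer_cartan invmx2; last exact: (lift_SL2 EL).
have zO := cz_cO ct.
have cdE' a b : cderive (fun w => in_cchart c E w a b) (C_of_plane (c t)) =
    cd (coef c a b) (cz c t).
  by apply: cderiveE; apply: cdvP; exact: coef_holo.
rewrite !mxE !big_ord_recl big_ord0 addr0 !mxE !cdE' /= /thm /coef ciK //.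
by rewrite (_ : lift 0 0 = 1 :> 'I_2) ?mulNr //; apply: val_inj.
Qed.

Lemma omega_omm c t : LA c -> cdom c t -> omega E c t = omm (coef c) (cz c t).
Proof.
move=> hc ct; rewrite /omega /maurer_cartan invmx2; last exact: (lift_SL2 EL).
have zO := cz_cO ct.
have cdE' a b : cderive (fun w => in_cchart c E w a b) (C_of_plane (c t)) =
    cd (coef c a b) (cz c t).
  by apply: cderiveE; apply: cdvP; exact: coef_holo.
rewrite !mxE !big_ord_recl big_ord0 addr0 !mxE !cdE' /= /omm /coef ciK //.
by rewrite (_ : lift 0 0 = 1 :> 'I_2) ?mulNr ?[- _ + _]addrC //; apply: val_inj.
Qed.

(** The diagonal entries vanish by the Legendrian condition. If both forms vanished too, so would
    the derivative of [E], against the immersion property. *)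
Lemma forms_neq0 c t : LA c -> cdom c t ->
  theta E c t != 0 \/ omega E c t != 0.
Proof.
move=> hc ct; have [th0|] := eqVneq (theta E c t) 0; last by left.
have [om0|] := eqVneq (omega E c t) 0; last by right.
exfalso; apply: (lift_immersion EL hc ct).
have [h00 h11] := lift_legendrian EL hc ct.
have mc0 : maurer_cartan E c t = 0.
  apply/matrixP => i j; rewrite [RHS]mxE.
  by have [->|->] := ord2P i; have [->|->] := ord2P j;
    [exact: h00|exact: th0|exact: om0|exact: h11].
have Eu : E t \in unitmx by rewrite unitmxE (lift_SL2 EL) unitr1.
by rewrite -(mulKVmx Eu (mx_cderive _ _)) -/(maurer_cartan E c t) mc0 mulmx0.
Qed.

Section Vector.
Variables (p q : nat -> R[i]).

Definition lform (c : chart R T) j (w : R[i]) : R[i] :=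
  p j * thm (coef c) w + q j * omm (coef c) w.

Hypothesis lform0 : forall c t j, LA c -> cdom c t -> (j < 4)%N ->
  lform c j (cz c t) != 0.

Lemma lform_neq0 c w j : LA c -> cO c w -> (j < 4)%N -> lform c j w != 0.
Proof.
move=> hc cw j4; have := lform0 hc (ci_dom cw) j4; by rewrite czK.
Qed.

Definition wrf c := wronskian (thm (coef c)) (omm (coef c)).

Definition prodL c (w : R[i]) : R[i] :=
  lform c 0%N w * lform c 1%N w * lform c 2%N w * lform c 3%N w.

(* the holomorphic vector field whose time is the flat coordinate *)
Definition vfield c (w : R[i]) : R[i] := wrf c w ^+ 5 / prodL c w ^+ 4.

Lemma prodL_neq0 c w : LA c -> cO c w -> prodL c w != 0.
Proof. by move=> hc cw; rewrite !mulf_neq0 // lform_neq0. Qed.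

Lemma thm_coef_holo c : LA c -> holo (cO c) (thm (coef c)).
Proof.
by move=> hc; apply: thm_holo; [exact: cO_open|move=> a b; exact: coef_holo].
Qed.

Lemma omm_coef_holo c : LA c -> holo (cO c) (omm (coef c)).
Proof.
by move=> hc; apply: omm_holo; [exact: cO_open|move=> a b; exact: coef_holo].
Qed.

Lemma vf_holo c : LA c -> holo (cO c) (vfield c).
Proof.
move=> hc; have th := thm_coef_holo hc; have om := omm_coef_holo hc.
have lf j : holo (cO c) (lform c j) by apply: holoD; exact: holoZ.
apply: holoM.
  by apply: holoX; apply: wronskian_holo => //; exact: cO_open.
apply: holoV; first by move=> w cw; rewrite expf_neq0 // prodL_neq0.
apply: holoX; exact: holoM (holoM (holoM (lf 0%N) (lf 1%N)) (lf 2%N)) (lf 3%N).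
Qed.

Lemma ctrans_center (c d : chart R T) t : cdom c t -> ctrans c d (cz c t) = cz d t.
Proof. by move=> ct; rewrite /ctrans ciK. Qed.

Lemma form_ctrans (c d : chart R T) t : LA c -> LA d -> cdom c t -> cdom d t ->
  [/\ thm (coef c) (cz c t) = thm (coef d) (cz d t) * cd (ctrans c d) (cz c t),
      omm (coef c) (cz c t) = omm (coef d) (cz d t) * cd (ctrans c d) (cz c t),
      wrf c (cz c t) = wrf d (cz d t) * cd (ctrans c d) (cz c t) ^+ 3 &
      cd (ctrans c d) (cz c t) != 0].
Proof.
move=> hc hd ct dt; have [e e0 [h1 h2 h3]] := ctrans_holo hc hd ct dt.
have hD v : disc (cz c t) e v -> cO d (ctrans c d v).
  by move=> /h2; exact: cz_cO.
have GH a b v : disc (cz c t) e v -> coef c a b v = coef d a b (ctrans c d v).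
  by move=> /h2 dv; rewrite /coef /ctrans ciK.
have dO := @cO_open _ _ d; have dh a b := @coef_holo d a b hd.
have t1 := pullback_thm dh hD h3 GH (disc_center _ e0).
have o1 := pullback_omm dh hD h3 GH (disc_center _ e0).
have w1 := pullback_wronskian e0 dO dh hD h3 GH.
rewrite (ctrans_center d ct) in t1 o1 w1.
(* A zero of the derivative of the transition would make [lform 0] vanish. *)
split => //; apply/eqP => z0.
have := lform0 hc ct (isT : (0 < 4)%N).
by rewrite /lform t1 o1 z0 !mulr0 addr0 eqxx.
Qed.

(** The weight is [3 * 5 - 4 * 4 = -1], which is the transformation law of a vector field. *)
Lemma vf_ctrans (c d : chart R T) t : LA c -> LA d -> cdom c t -> cdom d t ->
  vfield d (cz d t) = cd (ctrans c d) (cz c t) * vfield c (cz c t).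
Proof.
move=> hc hd ct dt; have [t1 o1 w1 k0] := form_ctrans hc hd ct dt.
rewrite /vfield /prodL /lform t1 o1 w1.
set k := cd _ _ in k0 *.
have P0 := prodL_neq0 hd (cz_cO dt); rewrite /prodL /lform in P0.
move: P0; set th := thm _ _; set om := omm _ _ => P0.
have -> : (p 0%N * (th * k) + q 0%N * (om * k)) * (p 1%N * (th * k) + q 1%N * (om * k)) *
  (p 2%N * (th * k) + q 2%N * (om * k)) * (p 3%N * (th * k) + q 3%N * (om * k)) =
  (p 0%N * th + q 0%N * om) * (p 1%N * th + q 1%N * om) *
  (p 2%N * th + q 2%N * om) * (p 3%N * th + q 3%N * om) * k ^+ 4 by ring.
move: P0; set X := _ * _ * _ * _ => P0.
by field; rewrite P0 k0.
Qed.

End Vector.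

End LiftedData.



(** * The complex flow *)

Section Flow.
Variables (R : realType) (S T : topologicalType) (B : set (chart R S)).
Variables (pi : T -> S) (f nu : S -> 'M[R[i]]_2) (E : T -> 'M[R[i]]_2).
Variables (p q : nat -> R[i]).

Notation LA := (lifted_atlas pi B).
Notation vf := (vfield E p q).

(** Continuity is a separate clause: the coordinate [cz c (F v)] only has a meaning while [F v] is
    in the domain of [c], so the derivative alone would not prevent [F] from jumping out of it. *)
Definition flow_at (F : R[i] -> T) (w : R[i]) :=
  (forall U, nbhs (F w) U -> exists2 d, 0 < d & forall v, disc w d v -> U (F v)) /\
  forall c, LA c -> cdom c (F w) ->
    cdv (fun v => cz c (F v)) w (vf c (cz c (F w))).

Definition flows (t : T) (r : R) := exists2 F, F 0 = t &
  forall w, disc 0 r w -> flow_at F w.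

Hypothesis Bh : forall z w, B z -> B w -> holomorphic_trans z w.
Hypothesis EL : legendrian_lift B pi f nu E.
Hypothesis lform0 : forall c t j, LA c -> cdom c t -> (j < 4)%N ->
  lform E p q c j (cz c t) != 0.
Hypothesis hT : hausdorff_space T.
Hypothesis LAc : forall t, exists2 c, LA c & cdom c t.

Lemma flow_at_eq F G w : (exists2 d, 0 < d & forall v, disc w d v -> F v = G v) ->
  flow_at F w -> flow_at G w.
Proof.
move=> [d d0 FG] [Fc Fd]; have E0 := FG w (disc_center w d0).
split=> [U|c hc]; rewrite -E0 => h.
  have [e e0 he] := Fc U h; exists (Num.min d e) => [|v]; first by rewrite lt_min d0.
  by rewrite /disc /= lt_min => /andP[vd ve]; rewrite -FG //; exact: he.
apply: (dervat_eq _ _ (Fd c hc h)); first by rewrite E0.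
by exists d => // v _ vd; rewrite FG.
Qed.

Lemma flow_at_shift F (a w : R[i]) : flow_at F (w - a) ->
  flow_at (fun v => F (v - a)) w.
Proof.
move=> [Fc Fd]; split=> [U /Fc [d d0 hd]|c hc cw].
  exists d => // v vd; apply: hd; rewrite /disc /= in vd *.
  by rewrite (_ : v - a - (w - a) = v - w) //; ring.
have h := Fd c hc cw.
have k : cdv (fun v : R[i] => v - a) w 1.
  by have := dervatB (dervat_id id setT w) (dervat_cst id setT a w); rewrite subr0.
by have := @cdv_comp _ (fun v => cz c (F v)) (fun v => v - a) w _ _ k h; rewrite mulr1.
Qed.

Lemma flow_at_const t c w : LA c -> cdom c t -> vf c (cz c t) = 0 ->
  flow_at (fun=> t) w.
Proof.
move=> hc ct v0; split=> [U hU|d hd dt].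
  by exists 1 => // v _; exact: nbhs_singleton.
rewrite (vf_ctrans Bh EL lform0 hc hd ct dt) v0 mulr0; exact: dervat_cst.
Qed.

Lemma flows_local (t0 : T) : exists2 e, 0 < e & nbhs t0 [set t | flows t e].
Proof.
have [c hc ct0] := LAc t0.
have [d [e [d0 e0 he]]] := local_flow (@cO_open _ _ c) (vf_holo EL lform0 hc) (cz_cO ct0).
exists e => //; apply: filterS (cz_nbhs ct0 d0) => t [ct td].
have [x [x0 xO xd]] := he _ td; exists (fun w => ci c (x w)).
  by rewrite x0 ciK.
move=> w hw; have cx := xO w hw; have xw := xd w hw.
split=> [U hU|d' hd' dt].
  have [a a0 ha] := ci_nbhs cx hU.
  have [b b0 hb] := dervat_contat xw a0; exists b => // v vb.
  by have [] := ha (x v) (hb v Logic.I vb).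
have cs := ci_dom cx; have zE := czK cx.
rewrite (vf_ctrans Bh EL lform0 hc hd' cs dt) zE.
have [e' e'0 [_ _ th]] := ctrans_holo Bh hc hd' cs dt.
have tc := cdvP (th _ (disc_center _ e'0)); rewrite zE in tc.
exact: (cdv_comp xw tc).
Qed.

(** Agreement of [F] and [G] is followed along the segment as an equivalence, which is additive.
    Where the two differ, Hausdorff separation keeps them different nearby; where they agree,
    uniqueness for the equation in a chart makes them agree nearby. *)
Lemma flow_unique (F G : R[i] -> T) (w0 w1 : R[i]) :
  (forall t, seg 0 1 t -> flow_at F (lpt w0 w1 t)) ->
  (forall t, seg 0 1 t -> flow_at G (lpt w0 w1 t)) ->
  F w0 = G w0 -> F w1 = G w1.
Proof.
move=> Ff Gf FG0.
pose l := lpt w0 w1.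
have lc (t : R) (d : R) : 0 < d -> exists2 e, 0 < e & forall s, `|s - t| < e ->
    disc (l t) d (l s).
  move=> d0; have [e e0 he] := dervat_contat (@dervat_lpt R setT w0 w1 t) d0.
  by exists e => // s st; apply: he => //; rewrite cabs_rc.
have nearF H (t : R) U : flow_at H (l t) -> nbhs (H (l t)) U ->
    exists2 e, 0 < e & forall s, `|s - t| < e -> U (H (l s)).
  move=> [Hc _] /Hc [d d0 hd]; have [e e0 he] := lc t d d0.
  by exists e => // s st; apply: hd; exact: he.
suff : F (l 0) = G (l 0) <-> F (l 1) = G (l 1).
  by rewrite /l lpt0 lpt1 => -[h _]; exact: h.
apply: (@cousin R (fun s t => F (l s) = G (l s) <-> F (l t) = G (l t))).
- exact: ler01.
- by move=> s u t _ _ _ _ h1 h2; rewrite h1 h2.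
move=> t t0 t1; have t01 : seg 0 1 t by rewrite /seg /= t0.
have Ft := Ff t t01; have Gt := Gf t t01.
have [FG|FG] := pselect (F (l t) = G (l t)); last first.
  have : exists U V, [/\ nbhs (F (l t)) U, nbhs (G (l t)) V & U `&` V = set0].
    apply: contrapT => h; apply: FG; apply: hT => U V hU hV.
    apply/set0P/eqP => UV; apply: h; exists U, V; split => //.
  move=> [U [V [hU hV UV]]].
  have [e e0 he] := nearF _ _ _ Ft hU; have [e' e'0 he'] := nearF _ _ _ Gt hV.
  have ne s : `|s - t| < e -> `|s - t| < e' -> F (l s) <> G (l s).
    move=> se se' k; have : (U `&` V) (F (l s)).
      by split; [exact: he|rewrite k; exact: he'].
    by rewrite UV.
  exists (Num.min e e'); first by rewrite lt_min e0.
  move=> s u _ st tu _; rewrite lt_min => /andP[us us'].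
  have su := le_trans st tu.
  by split=> k; exfalso; [apply: (ne s)|apply: (ne u)] => //; apply: dist_within st tu _ _ _.
have [c hc cF] := LAc (F (l t)).
set z0 := cz c (F (l t)).
have [r r0 hr] := @cO_open _ _ c _ (cz_cO cF).
have vh := vf_holo EL lform0 hc.
have [m vm] := holo_cd (@cO_open _ _ c) vh (cz_cO cF).
have [d d0 hd] := dervat_contat vm ltr01.
set K := cabs (cd (vf c) z0) + 1.
have K0 : 0 <= K by rewrite addr_ge0 // cabs_ge0.
pose rr := Num.min r d.
have rr0 : 0 < rr by rewrite lt_min r0.
have vK w : disc z0 rr w -> cabs (cd (vf c) w) <= K.
  rewrite /disc /= lt_min => /andP[_ wd]; have := hd w Logic.I wd.
  by have := cabsD (cd (vf c) w - cd (vf c) z0) (cd (vf c) z0); rewrite subrK /K -/z0; lra.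
have vhr : holo (disc z0 rr) (vf c).
  by apply: (holo_sub _ vh) => w; rewrite /disc /= lt_min => /andP[wr _]; exact: hr.
have vl := holo_lipschitz vhr vK.
have cn := cz_nbhs cF rr0; rewrite -/z0 in cn.
have [e1 e10 he1] := nearF _ _ _ Ft cn.
have cnG : nbhs (G (l t)) [set s | cdom c s /\ disc z0 rr (cz c s)] by rewrite -FG.
have [e2 e20 he2] := nearF _ _ _ Gt cnG.
have Kv0 : 0 < 2 * (K * cabs (w1 - w0) + 1).
  by have := mulr_ge0 K0 (cabs_ge0 (w1 - w0)); lra.
(* Short enough for the contraction by one half required in [ode_unique]. *)
pose e3 := (2 * (K * cabs (w1 - w0) + 1))^-1.
have e30 : 0 < e3 by rewrite invr_gt0.
exists (Num.min e1 (Num.min e2 e3)); first by rewrite !lt_min e10 e20.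
move=> s u s0 st tu u1; rewrite !lt_min => /and3P[us1 us2 us3].
have su v : seg s u v -> [/\ seg 0 1 v, `|v - t| < e1 & `|v - t| < e2].
  rewrite /seg /= => /andP[sv vu].
  split; [|exact: dist_within st tu sv vu us1|exact: dist_within st tu sv vu us2].
  by rewrite (le_trans s0 sv) (le_trans vu u1).
have sol H : (forall v, seg 0 1 v -> flow_at H (l v)) ->
    (forall v, seg s u v -> cdom c (H (l v)) /\ disc z0 rr (cz c (H (l v)))) ->
    forall v, seg s u v -> disc z0 rr (cz c (H (l v))) /\
      rdv (fun v => cz c (H (l v))) v (vf c (cz c (H (l v))) * (w1 - w0)).
  move=> Hf Hn v hv; have [cv dv] := Hn v hv; split => //.
  have [v01 _ _] := su v hv; have [_ Hd] := Hf v v01.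
  by apply: (@rdv_comp _ (fun w => cz c (H w)) l); [exact: dervat_lpt|exact: Hd].
have nF v : seg s u v -> cdom c (F (l v)) /\ disc z0 rr (cz c (F (l v))).
  by move=> /su [_ h _]; exact: he1.
have nG v : seg s u v -> cdom c (G (l v)) /\ disc z0 rr (cz c (G (l v))).
  by move=> /su [_ _ h]; exact: he2.
have Ksu : K * cabs (w1 - w0) * (u - s) <= 2^-1.
  have k0 := mulr_ge0 K0 (cabs_ge0 (w1 - w0)).
  have us0 : 0 <= u - s by rewrite subr_ge0 (le_trans st tu).
  apply: (@le_trans _ _ ((K * cabs (w1 - w0) + 1) * e3)).
    by apply: ler_pM => //; [rewrite lerDl|exact: ltW].
  by rewrite /e3 invfM mulrCA divff ?mulr1 // gt_eqF // ltr_wpDl.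
have tsu : seg s u t by rewrite /seg /= st.
have all v : seg s u v -> F (l v) = G (l v).
  move=> hv.
  have := @ode_unique R (vf c) z0 (w1 - w0) rr K s u _ _ vl (sol F Ff nF) (sol G Gf nG)
    K0 Ksu t tsu (congr1 (cz c) FG) v hv.
  have [cFv _] := nF v hv; have [cGv _] := nG v hv.
  by move=> /(congr1 (ci c)); rewrite !ciK.
by split => _; apply: all; rewrite /seg /= ?lexx (le_trans st tu).
Qed.

(** Composed with [F], the matrix [E] is a map on a flat disc whose forms are the original
    coefficients multiplied by the field, and the definition of the field is exactly the
    normalization of the Wronskian there. If the field vanishes at the center, the left-hand side is
    zero. *)
Lemma flows_estimate :
  (forall i k, (i < 4)%N -> (k < 4)%N -> i <> k -> p i * q k - p k * q i != 0) ->
  exists2 C : R, 0 < C & forall t r c, 0 < r -> flows t r -> LA c -> cdom c t ->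
    ((sqnormc (thm (coef E c) (cz c t)) + sqnormc (omm (coef E c) (cz c t)))
       * sqnormc (vf c (cz c t))) ^+ 6 * r ^+ 10 <= C.
Proof.
move=> /flat_disc_estimate [C C0 hC]; exists C => // t r c r0 [F F0 Ff] hc ct.
have c0 := @disc_center R 0 r r0.
have [v0|v0] := eqVneq (vf c (cz c t)) 0.
  rewrite v0 (_ : sqnormc 0 = 0) ?mulr0 ?expr0n ?mul0r ?ltW //.
  by rewrite -cabs_sq cabs0 expr0n.
(* At a zero of the field the constant map is a flow too. By uniqueness it would agree with [F] back
   to the center, where the field is nonzero. *)
have vn w d : disc 0 r w -> LA d -> cdom d (F w) -> vf d (cz d (F w)) != 0.
  move=> hw hd dw; apply: contra_neq v0 => v0.
  have Fw0 : F 0 = F w.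
    apply: (@flow_unique F (fun=> F w) w 0) => // s s01.
      by apply: Ff; exact: lpt_disc.
    exact: flow_at_const v0.
  rewrite -F0 Fw0 in ct *.
  by rewrite (vf_ctrans Bh EL lform0 hd hc dw ct) v0 mulr0.
pose G a b w := E (F w) a b.
have loc w d : disc 0 r w -> LA d -> cdom d (F w) -> exists2 e, 0 < e &
    [/\ forall v, disc w e v -> cO d (cz d (F v)),
        holo (disc w e) (fun v => cz d (F v)),
        forall a b v, disc w e v -> G a b v = coef E d a b (cz d (F v)) &
        cd (fun v => cz d (F v)) w = vf d (cz d (F w))].
  move=> hw hd dw; have [e1 e10 he1] := copen_disc hw.
  have dn : nbhs (F w) (cdom d).
    by apply: open_nbhs_nbhs; split => //; exact: cdom_open.
  have [Fc Fd] := Ff w hw; have [e2 e20 he2] := Fc _ dn.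
  exists (Num.min e1 e2); first by rewrite lt_min e10.
  have sub v : disc w (Num.min e1 e2) v -> disc 0 r v /\ cdom d (F v).
    by rewrite /disc /= lt_min => /andP[/he1 ? /he2].
  split=> [v /sub [_ /cz_cO //]|v /sub [hv dv]|a b v /sub [hv dv]|].
  - by exists (vf d (cz d (F v))); have [_] := Ff v hv; exact.
  - by rewrite /G /coef ciK.
  - by apply: cdE; exact: Fd.
have Gh a b : holo (disc 0 r) (G a b).
  move=> w hw; have [d hd dw] := LAc (F w).
  have [e e0 [h1 h2 h3 _]] := loc w d hw hd dw.
  have dh a b := @coef_holo _ _ _ _ _ _ _ _ EL d a b hd.
  by have [k _] := pullback_cd dh h1 h2 h3 a b (disc_center w e0); eexists; exact: k.
have co := @copen_disc R 0 r.
have forms w d : disc 0 r w -> LA d -> cdom d (F w) ->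
    [/\ thm G w = thm (coef E d) (cz d (F w)) * vf d (cz d (F w)),
        omm G w = omm (coef E d) (cz d (F w)) * vf d (cz d (F w)) &
        wronskian (thm G) (omm G) w = wrf E d (cz d (F w)) * vf d (cz d (F w)) ^+ 3].
  move=> hw hd dw; have [e e0 [h1 h2 h3 h4]] := loc w d hw hd dw.
  have dh a b := @coef_holo _ _ _ _ _ _ _ _ EL d a b hd.
  have c1 := disc_center w e0.
  rewrite (pullback_thm dh h1 h2 h3 c1) (pullback_omm dh h1 h2 h3 c1) h4.
  by rewrite (pullback_wronskian e0 (@cO_open _ _ d) dh h1 h2 h3) h4.
have := hC r (thm G) (omm G) r0 (thm_holo co Gh) (omm_holo co Gh).
have [t1 o1 w1] := forms 0 c c0 hc ltac:(by rewrite F0).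
rewrite F0 in t1 o1; rewrite t1 o1 !sqnormcM -mulrDl; apply.
- move=> j w j4 hw; have [d hd dw] := LAc (F w).
  have [-> -> _] := forms w d hw hd dw.
  have := lform_neq0 lform0 hd (cz_cO dw) j4; rewrite /lform.
  have := vn w d hw hd dw; set z := cz d (F w); move: (vf d z) => v v1 l1.
  by rewrite !mulrA -mulrDl mulf_neq0.
- move=> w hw; have [d hd dw] := LAc (F w).
  rewrite -[X in X ^+ 5 = _]/(wronskian (thm G) (omm G) w).
  have [-> -> ->] := forms w d hw hd dw.
  have P0 := prodL_neq0 lform0 hd (cz_cO dw).
  set z := cz d (F w) in P0 *; set v := vf d z.
  have -> : (p 0%N * (thm (coef E d) z * v) + q 0%N * (omm (coef E d) z * v)) *
    (p 1%N * (thm (coef E d) z * v) + q 1%N * (omm (coef E d) z * v)) *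
    (p 2%N * (thm (coef E d) z * v) + q 2%N * (omm (coef E d) z * v)) *
    (p 3%N * (thm (coef E d) z * v) + q 3%N * (omm (coef E d) z * v)) =
    prodL E p q d z * v ^+ 4 by rewrite /prodL /lform; ring.
  have wv : wrf E d z ^+ 5 = v * prodL E p q d z ^+ 4.
    by rewrite /v /vfield divfK // expf_neq0.
  by rewrite exprMn wv; ring.
Qed.

Lemma flows_sub t r r' : r' <= r -> flows t r -> flows t r'.
Proof.
move=> rr [F F0 Ff]; exists F => // w hw; apply: Ff.
by apply: lt_le_trans rr.
Qed.

(** Discs of radius [2 * h * r] around the points of the closed disc of radius [(1 - h) * r] cover
    the disc of radius [(1 + h) * r]. The flows on them are glued by uniqueness along segments,
    everything taking place in the plane of times. *)
Lemma flows_extend F (r h : R) : 0 < r -> 0 < h -> h < 1 ->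
  (forall w, disc 0 r w -> flow_at F w) ->
  (forall w, cabs w <= (1 - h) * r -> flows (F w) (2 * h * r)) ->
  flows (F 0) ((1 + h) * r).
Proof.
move=> r0 h0 h1 Ff hF.
have /boolp.choice [G hG] (w : R[i]) : exists G : R[i] -> T,
    cabs w <= (1 - h) * r -> G 0 = F w /\ forall v, disc 0 (2 * h * r) v -> flow_at G v.
  have [/hF [G G0 Gf]|hw] := pselect (is_true (cabs w <= (1 - h) * r)).
    by exists G.
  by exists (fun=> F w).
set rho := 2 * h * r in hF hG.
have rho0 : 0 < rho by rewrite /rho !mulr_gt0.
pose H a w := G a (w - a).
have Hf a w : cabs a <= (1 - h) * r -> disc a rho w -> flow_at (H a) w.
  move=> ha hw; apply: flow_at_shift; have [_] := hG a ha; apply.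
  by rewrite /disc /= subr0.
have H0 a : cabs a <= (1 - h) * r -> H a a = F a.
  by move=> ha; rewrite /H subrr; have [] := hG a ha.
have inr a : cabs a <= (1 - h) * r -> disc 0 r a.
  by move=> ha; rewrite /disc /= subr0; apply: le_lt_trans ha _; nra.
have HF a w : cabs a <= (1 - h) * r -> disc a rho w -> disc 0 r w -> H a w = F w.
  move=> ha hw wr; apply: (@flow_unique (H a) F a w) => [s s01|s s01|].
  - by apply: Hf => //; apply: lpt_disc => //; exact: disc_center.
  - by apply: Ff; apply: lpt_disc => //; exact: inr.
  - exact: H0.
have HH a b w : cabs a <= (1 - h) * r -> cabs b <= (1 - h) * r ->
    disc a rho w -> disc b rho w -> H a w = H b w.
  (* If two of the discs meet, each contains the midpoint of their centers. That midpoint is again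
     an admissible center, hence in the old disc, where both flows coincide with [F]; from there
     equality spreads inside the convex intersection. *)
  move=> ha hb wa wb; pose m := lpt a b 2^-1.
  have half01 : seg 0 1 (2^-1 : R).
    by rewrite /seg /= invr_ge0 ler0n invf_le1 // ler1n.
  have hm : cabs m <= (1 - h) * r.
    by rewrite -[m]subr0; apply: lpt_ball; rewrite ?subr0.
  have ab : cabs (b - a) < 2 * rho.
    have := cabs_sub b a w; rewrite /disc /= in wa wb; rewrite (cabsBC b w); lra.
  have h2 : (2^-1 : R)%:C = 2^-1 :> R[i] by rewrite fmorphV rmorph_nat.
  have ch : cabs ((b - a) * (2^-1 : R)%:C) < rho.
    rewrite cabsM cabs_real gtr0_norm ?invr_gt0 //; lra.
  have ma : disc a rho m.
    by rewrite /disc /= (_ : m - a = (b - a) * (2^-1 : R)%:C) // /m /lpt; ring.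
  have mb : disc b rho m.
    rewrite /disc /= cabsBC (_ : b - m = (b - a) * (2^-1 : R)%:C) //.
    by rewrite /m /lpt h2; field.
  apply: (@flow_unique (H a) (H b) m w) => [s s01|s s01|].
  - by apply: Hf => //; exact: lpt_disc.
  - by apply: Hf => //; exact: lpt_disc.
  - by rewrite (HF a m ha ma (inr m hm)) (HF b m hb mb (inr m hm)).
(* Radial contraction of the large disc onto the disc of centers. The identity
   [(1 - k) * (1 + h) = 2 * h] shows that [w] lies in the small disc around [k * w]. *)
pose k : R := (1 - h) / (1 + h).
have k1 : k * (1 + h) = 1 - h by rewrite /k divfK // gt_eqF //; lra.
have k0 : 0 <= k by rewrite divr_ge0 //; lra.
have kw w : disc 0 ((1 + h) * r) w -> cabs (k%:C * w) <= (1 - h) * r.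
  rewrite /disc /= subr0 cabsM cabs_real ger0_norm // => hw.
  by rewrite -k1 -[X in _ <= X]mulrA ler_wpM2l // ltW.
have kd w : disc 0 ((1 + h) * r) w -> disc (k%:C * w) rho w.
  rewrite /disc /= subr0 => hw.
  rewrite (_ : w - k%:C * w = (1 - k)%:C * w); last by rewrite rmorphB rmorph1; ring.
  have k2 : (1 - k) * (1 + h) = 2 * h by lra.
  have k3 : 0 < 1 - k by nra.
  rewrite cabsM cabs_real gtr0_norm //.
  by rewrite /rho -k2 -[X in _ < X]mulrA ltr_pM2l.
exists (fun w => H (k%:C * w) w).
  rewrite mulr0 H0 // cabs0; apply: mulr_ge0; lra.
move=> w hw; apply: (@flow_at_eq (H (k%:C * w))); last exact: Hf (kw w hw) (kd w hw).
have [d d0 hd] := copen_disc (kd w hw); have [e e0 he] := copen_disc hw.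
exists (Num.min d e) => [|v]; first by rewrite lt_min d0.
rewrite /disc /= lt_min => /andP[/hd vd /he ve].
apply: HH => //; [exact: kw|exact: kw|exact: kd].
Qed.

End Flow.



(** * Lengths of curves *)

Section RealIntegral.
Variable R : realType.

Lemma conton_rcomp (h p : R -> R) a b : continuous h ->
  conton a b (fun t => (p t)%:C) -> conton a b (fun t => (h (p t))%:C).
Proof.
move=> hc pc t tab e e0.
have /continuous_ltP /(_ e e0) [d d0 hd] := hc (p t).
have [d' d'0 hd'] := pc t tab d d0; exists d' => // y hy yd.
by rewrite cabs_rc; apply: hd; have := hd' y hy yd; rewrite cabs_rc.
Qed.

(** Arc length is a Lebesgue integral; with a primitive of the speed it becomes an increment, which
    can be followed along the curve by [cousin]. *)
Lemma Rint_prim (h : R -> R) : conton 0 1 (fun t => (h t)%:C) ->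
  exists2 F : R -> R, primon 0 1 (fun t => (h t)%:C) (fun t => (F t)%:C) &
    F 1 - F 0 = (\int[lebesgue_measure]_(t in `[0, 1]) h t)%R.
Proof.
move=> hc; have l01 : (0 : R) <= 1 by exact: ler01.
have [G hG] := primon_exists l01 hc.
pose F t := complex.Re (G t).
have FG : primon 0 1 (fun t => (h t)%:C) (fun t => (F t)%:C).
  move=> t t01 e e0; have [d d0 hd] := hG t t01 e e0; exists d => // y hy yd.
  apply: le_trans (hd y hy yd).
  have -> : (F y)%:C - (F t)%:C - (h t)%:C * (y%:C - t%:C) =
    (complex.Re (G y - G t - (h t)%:C * (y%:C - t%:C)))%:C.
    rewrite /F; case: (G y) (G t) => [? ?] [? ?].
    by apply: complex_eqP => /=; ring.
  by rewrite cabs_real Re_le_cabs.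
exists F => //.
have within (p : R -> R) : conton 0 1 (fun t => (p t)%:C) ->
    {within `[0, 1], continuous p}.
  move=> pc; apply/subspace_continuousP => x; rewrite /= in_itv /= => x01.
  apply/cvgrPdist_lt => e e0; rewrite near_withinE.
  have [d d0 hd] := pc x x01 e e0.
  apply/nbhs_ballP; exists d => //= y; rewrite /ball /= distrC => yd y01.
  rewrite distrC; move: y01; rewrite in_itv /= => y01.
  by have := hd y y01; rewrite !cabs_rc; apply.
have Fw : {within `[0, 1], continuous F}.
  by apply: within => t t01; exact: dervat_contat (FG t t01).
have dF (t : R) : t \in `]0, 1[ -> is_derive t 1 F (h t).
  rewrite in_itv /= => /andP[t0 t1]; apply/is_derive_rdv => e e0.
  have t01 : seg 0 1 t by rewrite /seg /= !ltW.
  have [d d0 hd] := FG t t01 e e0.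
  exists (Num.min d (Num.min t (1 - t))); first by rewrite !lt_min d0 t0 subr_gt0.
  move=> y _; rewrite !lt_min => /and3P[yd yt yt1]; apply: hd => //.
  move: yt yt1; rewrite !cabs_rc !ltr_norml /seg /= => /andP[? ?] /andP[? ?].
  by apply/andP; split; lra.
rewrite /Rintegral (@continuous_FTC2 _ h F) //; first exact: within.
- have [_ k1 k2] := (continuous_within_itvP F ltr01).1 Fw; split => //.
  by move=> t /dF k; exact: ex_derive.
- by move=> t /dF k; rewrite derive1E; exact: derive_val.
Qed.

Lemma Rint_le (h : R -> R) M : conton 0 1 (fun t => (h t)%:C) ->
  (forall t, seg 0 1 t -> 0 <= h t <= M) ->
  (\int[lebesgue_measure]_(t in `[0, 1]) h t)%R <= M.
Proof.
move=> hc hM; have [F FG <-] := Rint_prim hc.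
have := @mean_value_ineq _ (seg 0 1) (fun t => (F t)%:C) (fun t => (h t)%:C) 0 1 M ler01
  (fun t h => h) FG.
rewrite subr0 mulr1 cabs_rc => k; apply: le_trans (ler_norm _) (k _).
by move=> t /hM /andP[h0 h1]; rewrite cabs_real ger0_norm.
Qed.

End RealIntegral.

(** * The coefficient of the metric in complex coordinates *)

Section Metric.
Variables (R : realType) (S T : topologicalType) (B : set (chart R S)).
Variables (pi : T -> S) (f nu : S -> 'M[R[i]]_2) (E : T -> 'M[R[i]]_2).
Variables (p q : nat -> R[i]) (lam : chart R S -> 'rV[R]_2 -> R).

Notation LA := (lifted_atlas pi B).

Hypothesis cov : covering_map pi.
Hypothesis Bh : forall z w, B z -> B w -> holomorphic_trans z w.
Hypothesis EL : legendrian_lift B pi f nu E.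
Hypothesis lform0 : forall c t j, LA c -> cdom c t -> (j < 4)%N ->
  lform E p q c j (cz c t) != 0.
Hypothesis lamE : is_ds11 B pi E lam.

Definition lamC z (w : R[i]) : R := lam z (plane_of_C w).

Definition fnorm c (w : R[i]) : R :=
  sqnormc (thm (coef E c) w) + sqnormc (omm (coef E c) w).

Lemma lamC_lift z c w : B z -> lifted_chart pi z c -> cO c w ->
  lamC z w = fnorm c w.
Proof.
move=> Bz zc cw; have hc : LA c by exists z.
have ct := ci_dom cw; have := lamE Bz zc ct.
rewrite (omega_omm EL hc ct) (theta_thm EL hc ct) czK // addrC ; rewrite /fnorm => <-.
by rewrite /lamC /ci cinvK.
Qed.

Lemma lift_point (z : chart R S) w : cO z w -> exists t (c : chart R T), [/\ lifted_chart pi z c, cdom c t,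
  cz c t = w & pi t = ci z w].
Proof.
move=> zw; have [_ pis _] := cov.
have [t _ pt] : range pi (ci z w) by rewrite pis.
have zt : cdom z (pi t) by rewrite pt; exact: ci_dom.
have [c zc ct] := lifted_chart_exists cov zt; exists t, c; split => //.
by rewrite /cz (zc t ct).2 pt -/(cz z (ci z w)) czK.
Qed.

Lemma fnorm_gt0 c w : LA c -> cO c w -> 0 < fnorm c w.
Proof.
move=> hc cw; have ct := ci_dom cw.
have nn := @sqnormc_ge0 R.
have sq0 (u : R[i]) : u != 0 -> 0 < sqnormc u.
  by move=> u0; rewrite -cabs_sq exprn_gt0 // cabs_gt0.
have [] := forms_neq0 EL hc ct; rewrite ?(theta_thm EL hc ct) ?(omega_omm EL hc ct) czK // => /sq0.
  by rewrite /fnorm; have := nn (omm (coef E c) w); lra.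
by rewrite /fnorm; have := nn (thm (coef E c) w); lra.
Qed.

Lemma fnorm_cont c w : LA c -> cO c w -> ccont (fun v => (fnorm c v)%:C) w.
Proof.
move=> hc cw.
have [l1 h1] := thm_coef_holo EL hc cw; have [l2 h2] := omm_coef_holo EL hc cw.
have := contatD (rcont_sqnormc (dervat_contat h1)) (rcont_sqnormc (dervat_contat h2)).
by apply: contat_eq; rewrite -?rmorphD //; exists 1 => // v _ _; rewrite -rmorphD.
Qed.

Lemma lamC_gt0 z w : B z -> cO z w -> 0 < lamC z w.
Proof.
move=> Bz zw; have [t [c [zc ct tw _]]] := lift_point zw.
have cw : cO c w by rewrite -tw; exact: cz_cO.
by rewrite (lamC_lift Bz zc cw); apply: fnorm_gt0 => //; exists z.
Qed.

Lemma lamC_cont z w : B z -> cO z w -> ccont (fun v => (lamC z v)%:C) w.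
Proof.
move=> Bz zw; have [t [c [zc ct tw _]]] := lift_point zw.
have cw : cO c w by rewrite -tw; exact: cz_cO.
have hc : LA c by exists z.
apply: (contat_eq _ _ (fnorm_cont hc cw)); first by rewrite (lamC_lift Bz zc cw).
have [d d0 hd] := cO_open cw; exists d => // v _ /hd cv.
by rewrite (lamC_lift Bz zc cv).
Qed.

(** Read on the cover, both coefficients are the squared norm [fnorm] of the two forms, which are
    multiplied by the derivative of the transition. *)
Lemma lamC_trans (z z' : chart R S) w : B z -> B z' -> cO z w -> cdom z' (ci z w) ->
  exists2 l, cdv (fun v => cz z' (ci z v)) w l &
    lamC z w = lamC z' (cz z' (ci z w)) * sqnormc l.
Proof.
move=> Bz Bz' zw zw'; have [t [c [zc ct tw pt]]] := lift_point zw.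
have zt' : cdom z' (pi t) by rewrite pt.
have [c' zc' ct'] := lifted_chart_exists cov zt'.
have hc : LA c by exists z. have hc' : LA c' by exists z'.
have [t1 o1 _ _] := form_ctrans Bh EL lform0 hc hc' ct ct'.
have [e e0 [h1 h2 h3]] := ctrans_holo Bh hc hc' ct ct'.
have kd := cdvP (h3 _ (disc_center _ e0)).
rewrite tw in t1 o1 kd h1 h2 h3.
have tE v : disc w e v -> ctrans c c' v = cz z' (ci z v).
  move=> hv; rewrite /ctrans {1}/cz (zc' _ (h2 v hv)).2.
  by rewrite (lifted_chart_point zc (h1 v hv)).2.
exists (cd (ctrans c c') w).
  apply: (dervat_eq _ _ kd); first by apply: tE; exact: disc_center.
  by exists e => // v _; exact: tE.
have cw : cO c w by rewrite -tw; exact: cz_cO.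
have zE : cz z' (ci z w) = cz c' t by rewrite /cz (zc' t ct').2 pt.
have cw' := cz_cO ct'.
rewrite zE (lamC_lift Bz zc cw) (lamC_lift Bz' zc' cw') /fnorm t1 o1 !sqnormcM.
by rewrite -mulrDl.
Qed.

End Metric.



Section CurveData.
Variable R : realType.

Lemma conton_continuous (h : R -> R) a b : continuous h -> conton a b (fun t => (h t)%:C).
Proof. by move=> hc; apply: (@conton_rcomp _ h id) => //; exact: conton_id. Qed.

Lemma C1_curveP (g : R -> 'rV[R]_2) : C1_curve g -> exists g' : R -> R[i],
  [/\ forall t, rdv (fun t => C_of_plane (g t)) t (g' t),
      conton 0 1 (fun t => (sqnormc (g' t))%:C) &
      forall m, arc_length m g = (\int[lebesgue_measure]_(t in `[0, 1])
        Num.sqrt (m (g t) * sqnormc (g' t)))%R].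
Proof.
move=> hg; pose d i t := derive1 (fun s => g s 0 i) t.
exists (fun t => d 0 t +i* d 1 t); split.
- move=> t; have [h0 _] := hg 0; have [h1 _] := hg 1.
  apply: rdv_ReIm => /=.
    by have k := derivableP (h0 t); rewrite -derive1E in k.
  by have k := derivableP (h1 t); rewrite -derive1E in k.
- have c i : conton 0 1 (fun t => (d i t)%:C).
    by apply: conton_continuous; have [] := hg i.
  move=> t t01; have := contonD (contonM (c 0) (c 0)) (contonM (c 1) (c 1)).
  move=> /(_ t t01); apply: contat_eq; first by rewrite -!rmorphM -rmorphD /sqnormc !expr2.
  by exists 1 => // y _ _; rewrite -!rmorphM -rmorphD /sqnormc !expr2.
- move=> m; rewrite /arc_length; congr Rintegral; apply/funext => t.
  rewrite !big_ord_recl big_ord0 addr0 /sqnormc /d /=.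
  by congr (Num.sqrt (_ * (_ + _ ^+ 2))); congr (derive1 _ t); apply/funext => s;
    congr (g s 0 _); apply: val_inj.
Qed.

End CurveData.

(** * Short curves stay in small neighborhoods *)

Section Separation.
Variables (R : realType) (S T : topologicalType) (B : set (chart R S)).
Variables (pi : T -> S) (f nu : S -> 'M[R[i]]_2) (E : T -> 'M[R[i]]_2).
Variables (p q : nat -> R[i]) (lam : chart R S -> 'rV[R]_2 -> R).

Notation LA := (lifted_atlas pi B).

Hypothesis cov : covering_map pi.
Hypothesis Bh : forall z w, B z -> B w -> holomorphic_trans z w.
Hypothesis EL : legendrian_lift B pi f nu E.
Hypothesis lform0 : forall c t j, LA c -> cdom c t -> (j < 4)%N ->
  lform E p q c j (cz c t) != 0.
Hypothesis lamE : is_ds11 B pi E lam.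
Hypothesis hS : hausdorff_space S.
Hypothesis Bcov : covers B.

(** A continuous image of a compact disc in a Hausdorff space. Hence a curve outside the ball at
    some time is outside it at all nearby times. *)
Lemma closed_chart_ball (z : chart R S) (w : R[i]) (r : R) :
  (forall v, cabs (v - w) <= r -> cO z v) ->
  closed [set x | cdom z x /\ cabs (cz z x - w) <= r].
Proof.
move=> zw; pose A := [set u : R * R | cabs ((u.1 +i* u.2) - w) <= r].
have -> : [set x | cdom z x /\ cabs (cz z x - w) <= r] =
    (fun u : R * R => ci z (u.1 +i* u.2)) @` A.
  apply/seteqP; split => [x [zx xr]|_ [u Au <-]].
    exists (complex.Re (cz z x), complex.Im (cz z x)).
      by move: xr; case: (cz z x).
    by rewrite -[RHS](ciK zx); case: (cz z x).
  by have zu := zw _ Au; split; [exact: ci_dom|rewrite czK].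
apply: (compact_closed hS); apply: continuous_compact; last exact: compact_cdisc.
apply: continuous_in_subspaceT => u; rewrite inE => Au N hN.
have [d d0 hd] := ci_nbhs (zw _ Au) hN.
apply/nbhs_pairP; exists (d / 2) => [|v v1 v2]; first by lra.
have k := cabs_pair v1 v2.
have dd : 2 * (d / 2) = d by lra.
by rewrite dd in k; have [] := hd _ k.
Qed.

(** The truncation at [r] makes the coordinate distance a function on the whole surface, so it can
    be followed along arcs that leave the ball or lie in other charts. *)
Definition chart_dist (z : chart R S) (w : R[i]) (r : R) (x : S) : R :=
  if `[< cdom z x /\ cabs (cz z x - w) <= r >] then cabs (cz z x - w) else r.

Lemma speed_conton (z : chart R S) (g : R -> 'rV[R]_2) (g' : R -> R[i]) :
  B z -> (forall t, rdv (fun t => C_of_plane (g t)) t (g' t)) ->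
  conton 0 1 (fun t => (sqnormc (g' t))%:C) ->
  (forall t, seg 0 1 t -> cO z (C_of_plane (g t))) ->
  conton 0 1 (fun t => (Num.sqrt (lam z (g t) * sqnormc (g' t)))%:C).
Proof.
move=> Bz dg cg' yO; pose y t := C_of_plane (g t).
have gE t : plane_of_C (y t) = g t by rewrite /y C_of_planeK.
have yc t : contat rc setT y t by exact: dervat_contat (dg t).
apply: (@conton_rcomp _ Num.sqrt (fun t => lam z (g t) * sqnormc (g' t))).
  exact: sqrt_continuous.
have c1 : conton 0 1 (fun t => (lamC lam z (y t))%:C).
  apply: (@conton_comp _ _ _ y (fun v => (lamC lam z v)%:C)).
    by apply: conton_sub => t _; exact: yc.
  by move=> t t01; apply: (lamC_cont cov EL lamE Bz); exact: yO.
move=> t t01; have := contonM c1 cg' t01; apply: contat_eq.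
  by rewrite -rmorphM /lamC gE.
by exists 1 => // s _ _; rewrite -rmorphM /lamC gE.
Qed.

(** Inside the ball the metric is at least [m ^+ 2] times the flat one, and outside it [chart_dist]
    is constant, so [chart_dist] decreases along an arc by at most its length divided by [m]. The
    local inequalities, with a slack [e], are added by [cousin]. *)
Lemma arc_dist_le (z z' : chart R S) (w : R[i]) (r m : R) (g : R -> 'rV[R]_2) :
  B z -> B z' -> 0 < m -> 0 <= r ->
  (forall v, cabs (v - w) <= r -> cO z v) ->
  (forall v, cabs (v - w) <= r -> m ^+ 2 <= lamC lam z v) ->
  C1_curve g -> (forall t, t \in `[0, 1] -> ccod z' (g t)) ->
  chart_dist z w r (cinv z' (g 0)) <=
  chart_dist z w r (cinv z' (g 1)) + arc_length (lam z') g / m.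
Proof.
move=> Bz Bz' m0 r0 zw zm gC gO; pose dst := chart_dist z w r; rewrite -/dst.
have [g' [dg cg' alE]] := C1_curveP gC.
pose y t := C_of_plane (g t).
have yO t : seg 0 1 t -> cO z' (y t).
  by move=> t01; rewrite /cO /y /= C_of_planeK; apply: gO; rewrite in_itv.
have gE t : plane_of_C (y t) = g t by rewrite /y C_of_planeK.
pose sp t := Num.sqrt (lam z' (g t) * sqnormc (g' t)).
have yc t : contat rc setT y t by exact: dervat_contat (dg t).
have spc := speed_conton Bz' dg cg' yO.
have [F FG FE] := Rint_prim spc; rewrite alE -FE.
pose x t := cinv z' (g t).
have xE t : x t = ci z' (y t) by rewrite /x /ci gE.
apply/ler_addgt0Pr => e e0; rewrite -/(x 0) -/(x 1).
suff : dst (x 0) <= dst (x 1) + ((F 1 - F 0) / m + e * (1 - 0)).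
  by rewrite subr0 mulr1 addrA.
apply: (@cousin R (fun s t => dst (x s) <= dst (x t) + ((F t - F s) / m + e * (t - s)))).
- exact: ler01.
- by move=> s u t _ _ _ _ h1 h2; lra.
move=> t t0 t1; have t01 : seg 0 1 t by rewrite /seg /= t0.
have e2 : 0 < e * m / 2 by rewrite divr_gt0 // mulr_gt0.
have [d1 d10 hd1] := FG t t01 _ e2.
have spge s u : 0 <= s -> s <= t -> t <= u -> u <= 1 -> u - s < d1 ->
    (sp t - e * m / 2) * (u - s) <= F u - F s.
  move=> s0 st tu u1 us.
  have k v : seg 0 1 v -> `|v - t| < d1 -> `|F v - F t - sp t * (v - t)| <= e * m / 2 * `|v - t|.
    move=> v01 vt; have := hd1 v v01; rewrite cabs_rc => /(_ vt).
    by rewrite -!rmorphB -rmorphM -rmorphB cabs_real.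
  have su := le_trans st tu.
  have ku : seg 0 1 u by rewrite /seg /= (le_trans s0 su).
  have ks : seg 0 1 s by rewrite /seg /= s0 (le_trans su).
  have := k u ku (dist_within st tu su (lexx u) us).
  rewrite (@ger0_norm _ (u - t)) ?subr_ge0 // ler_norml => /andP[a1 _].
  have := k s ks (dist_within st tu (lexx s) su us).
  rewrite (distrC s t) (@ger0_norm _ (t - s)) ?subr_ge0 // ler_norml => /andP[_ a2].
  by lra.
have spn : 0 <= sp t by exact: sqrtr_ge0.
have xc U : nbhs (x t) U -> exists2 d, 0 < d & forall s, `|s - t| < d -> U (x s).
  rewrite xE => hU; have [d d0 hd] := ci_nbhs (yO t t01) hU.
  have [d' d'0 hd'] := yc t d d0; exists d' => // s st; rewrite xE.
  have k : cabs (y s - y t) < d by apply: hd' => //; rewrite cabs_rc.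
  by have [] := hd (y s) k.
(* Away from the closed ball [chart_dist] equals [r] near [t]. On the ball, its boundary included,
   it is the minimum of the coordinate distance and [r] near [t]. *)
have [[zx xr]|xK] := pselect (cdom z (x t) /\ cabs (cz z (x t) - w) <= r); last first.
  have Ko := closed_openC (closed_chart_ball zw).
  have [d2 d20 hd2] := xc _ (open_nbhs_nbhs (conj Ko xK)).
  have dr s : `|s - t| < d2 -> dst (x s) = r.
    by move=> /hd2 k; rewrite /dst /chart_dist; case: asboolP.
  exists (Num.min d1 d2) => [|s u s0 st tu u1]; first by rewrite lt_min d10.
  rewrite lt_min => /andP[us1 us2].
  have := spge s u s0 st tu u1 us1.
  have su := le_trans st tu.
  rewrite (dr s (dist_within st tu (lexx s) su us2)) (dr u (dist_within st tu su (lexx u) us2)).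
  move=> k; rewrite -{1}[r]addr0 lerD2l.
  rewrite -(ler_pM2r m0) mul0r mulrDl divfK ?gt_eqF //.
  have us0 : 0 <= u - s by rewrite subr_ge0.
  have := mulr_ge0 (mulr_ge0 (ltW e0) (ltW m0)) us0; have := mulr_ge0 spn us0.
  by lra.
have zn : nbhs (x t) (cdom z) by apply: open_nbhs_nbhs; split => //; exact: cdom_open.
have [d2 d20 hd2] := xc _ zn.
have dE s : cdom z (x s) -> dst (x s) = Num.min (cabs (cz z (x s) - w)) r.
  move=> zs; rewrite /dst /chart_dist; case: asboolP => [[_ k]|k]; first by rewrite (min_idPl k).
  have [k'|k'] := leP (cabs (cz z (x s) - w)) r; last by [].
  by exfalso; apply: k.
have zx' : cdom z (ci z' (y t)) by rewrite -xE.
have [l ld lE] := lamC_trans cov Bh EL lform0 lamE Bz' Bz (yO t t01) zx'.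
have yd := rdv_comp (dg t) ld; rewrite -/(y t) in yd.
(* The chain rule moves the speed from the chart of the arc to [z], where the coefficient of the
   metric is at least [m ^+ 2]. *)
have yd0 : cabs (l * g' t) <= sp t / m.
  rewrite ler_pdivlMr // -(@ler_pXn2r _ 2) // ?nnegrE ?mulr_ge0 ?cabs_ge0 ?(ltW m0) //.
  rewrite exprMn cabs_sq sqnormcM /sp sqr_sqrtr; last first.
    by rewrite -gE mulr_ge0 ?sqnormc_ge0 // ltW // (lamC_gt0 cov EL lamE Bz' (yO t t01)).
  rewrite -[lam z' (g t)]/(lam z' (g t)) -{1}gE -/(lamC lam z' (y t)) lE.
  have zmt := zm _ xr; rewrite xE in zmt.
  have n1 := sqnormc_ge0 l; have n2 := sqnormc_ge0 (g' t).
  by have := ler_wpM2r (mulr_ge0 n1 n2) zmt; lra.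
have e4 : 0 < e / 2 by lra.
have [d3 d30 hd3] := yd _ e4.
exists (Num.min d1 (Num.min d2 d3)) => [|s u s0 st tu u1]; first by rewrite !lt_min d10 d20.
rewrite !lt_min => /and3P[us1 us2 us3].
have s_u := le_trans st tu.
have us0 : 0 <= u - s by rewrite subr_ge0.
have zs : cdom z (x s) by apply: hd2; exact: dist_within st tu (lexx s) s_u us2.
have zu : cdom z (x u) by apply: hd2; exact: dist_within st tu s_u (lexx u) us2.
have k v : cdom z (x v) -> `|v - t| < d3 ->
    cabs (cz z (x v) - cz z (x t)) <= (sp t / m + e / 2) * `|v - t|.
  move=> zv vt; have := hd3 v Logic.I; rewrite cabs_rc => /(_ vt).
  rewrite -/(y v) -/(y t) -!xE => k.
  have := cabsD (cz z (x v) - cz z (x t) - l * g' t * (v%:C - t%:C)) (l * g' t * (v%:C - t%:C)).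
  rewrite subrK [cabs (l * g' t * _)]cabsM cabs_rc => k'.
  by have := ler_wpM2r (normr_ge0 (v - t)) yd0; lra.
have := k s zs (dist_within st tu (lexx s) s_u us3); rewrite distrC ger0_norm ?subr_ge0 // => ks.
have := k u zu (dist_within st tu s_u (lexx u) us3); rewrite ger0_norm ?subr_ge0 // => ku.
have su : cabs (cz z (x s) - w) <= cabs (cz z (x u) - w) + (sp t / m + e / 2) * (u - s).
  have := cabs_sub (cz z (x s)) w (cz z (x t)).
  have := cabs_sub (cz z (x t)) w (cz z (x u)).
  by rewrite [cabs (cz z (x t) - cz z (x u))]cabsBC; lra.
have sF : (sp t / m - e / 2) * (u - s) <= (F u - F s) / m.
  rewrite ler_pdivlMr //; apply: le_trans (spge s u s0 st tu u1 us1).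
  rewrite le_eqVlt; apply/orP; left; apply/eqP; field; by rewrite gt_eqF.
have posl : 0 <= (F u - F s) / m + e * (u - s).
  apply: le_trans (lerD sF (lexx _)).
  have := mulr_ge0 (divr_ge0 spn (ltW m0)) us0; have := mulr_ge0 (ltW e0) us0.
  by lra.
rewrite (dE s zs) (dE u zu).
have aQ : cabs (cz z (x s) - w) <= cabs (cz z (x u) - w) + ((F u - F s) / m + e * (u - s)).
  by lra.
move: posl aQ; set Q := _ / m + _ => posl aQ.
have m1 : Num.min (cabs (cz z (x s) - w)) r <= cabs (cz z (x s) - w) by rewrite ge_min lexx.
have m2 : Num.min (cabs (cz z (x s) - w)) r <= r by rewrite ge_min lexx orbT.
have [h|h] := leP (cabs (cz z (x u) - w)) r; first exact: (le_trans m1 aQ).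
by apply: le_trans m2 _; rewrite lerDl.
Qed.

(** On a coordinate ball around [s] the coefficient stays above half its value at [s], so a curve
    joining [s] to a point not inside the ball has length at least [m * r]. This turns convergence
    for the distance into convergence in the topology. *)
Lemma metric_separates (s : S) (U : set S) : nbhs s U ->
  exists2 e, 0 < e & forall x l, curve_length B lam x s l -> l < e -> U x.
Proof.
move=> hU; have [z Bz zs] := Bcov s.
pose w := cz z s; have zw : cO z w by exact: cz_cO.
have hU' : nbhs (ci z w) U by rewrite /w ciK.
have [d1 d10 hd1] := ci_nbhs zw hU'.
have lp := lamC_gt0 cov EL lamE Bz zw.
have lp2 : 0 < lamC lam z w / 2 by lra.
have [d2 d20 hd2] := lamC_cont cov EL lamE Bz zw lp2.
pose r := Num.min d1 d2 / 2.
have mn0 : 0 < Num.min d1 d2 by rewrite lt_min d10.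
have r0 : 0 < r by rewrite /r; lra.
have rd v : cabs (v - w) <= r -> cabs (v - w) < d1 /\ cabs (v - w) < d2.
  have : Num.min d1 d2 <= d1 by rewrite ge_min lexx.
  have : Num.min d1 d2 <= d2 by rewrite ge_min lexx orbT.
  by rewrite /r => ? ? ?; split; lra.
pose m := Num.sqrt (lamC lam z w / 2).
have m0 : 0 < m by rewrite sqrtr_gt0.
have zO v : cabs (v - w) <= r -> cO z v by move=> /rd [/hd1 []].
have zm v : cabs (v - w) <= r -> m ^+ 2 <= lamC lam z v.
  move=> /rd [_ vd]; rewrite /m sqr_sqrtr; last exact: ltW.
  have := hd2 v Logic.I vd; rewrite cabs_rc ltr_norml => /andP[? _]; lra.
pose dst := chart_dist z w r.
have arc x y l : curve_length B lam x y l -> dst x <= dst y + l / m.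
  elim=> [{}x|{}x y' l' z' g _ IH Bz' gC gO gE]; first by rewrite mul0r addr0.
  have := arc_dist_le Bz Bz' m0 (ltW r0) zO zm gC gO; rewrite -/dst gE => k.
  by rewrite mulrDl; lra.
exists (m * r) => [|x l /arc xl lr]; first by rewrite mulr_gt0.
have ds : dst s = 0.
  rewrite /dst /chart_dist; case: asboolP => [_|k]; first by rewrite -/w subrr cabs0.
  by exfalso; apply: k; split => //; rewrite -/w subrr cabs0 ltW.
have : dst x < r.
  rewrite ds add0r in xl; apply: le_lt_trans xl _.
  by rewrite ltr_pdivrMr // mulrC.
rewrite /dst /chart_dist; case: asboolP => [[zx xr] _|_]; last by rewrite ltxx.
by have [/hd1 [_]] := rd _ xr; rewrite ciK.
Qed.

End Separation.



(** * Curves traced by the flow *)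

Section FlowCurves.
Variables (R : realType) (S T : topologicalType) (B : set (chart R S)).
Variables (pi : T -> S) (f nu : S -> 'M[R[i]]_2) (E : T -> 'M[R[i]]_2).
Variables (p q : nat -> R[i]) (lam : chart R S -> 'rV[R]_2 -> R).

Notation LA := (lifted_atlas pi B).
Notation vf := (vfield E p q).

Hypothesis cov : covering_map pi.
Hypothesis Bh : forall z w, B z -> B w -> holomorphic_trans z w.
Hypothesis EL : legendrian_lift B pi f nu E.
Hypothesis lform0 : forall c t j, LA c -> cdom c t -> (j < 4)%N ->
  lform E p q c j (cz c t) != 0.
Hypothesis lamE : is_ds11 B pi E lam.
Hypothesis Bcov : covers B.

Lemma curve_cat x y z l m : curve_length B lam x y l -> curve_length B lam y z m ->
  curve_length B lam x z (l + m).
Proof.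
move=> xy yz; elim: yz xy => [{}y|{}y w k c g _ IH Bc gC gO gE] xy.
  by rewrite addr0.
by rewrite addrA; apply: curve_cons gE => //; exact: IH.
Qed.

Lemma rdv_unique (h : R -> R[i]) t l m : rdv h t l -> rdv h t m -> l = m.
Proof.
move=> hl hm; apply: complex_eqP.
  have k := rdv_Re hl; have k' := rdv_Re hm.
  by rewrite -(@derive_val _ _ _ _ _ _ _ k) (@derive_val _ _ _ _ _ _ _ k').
have k := rdv_Im hl; have k' := rdv_Im hm.
by rewrite -(@derive_val _ _ _ _ _ _ _ k) (@derive_val _ _ _ _ _ _ _ k').
Qed.

Lemma C1_curve_plane (X X' : R -> R[i]) : (forall u, rdv X u (X' u)) ->
  (forall u, contat rc setT X' u) -> C1_curve (fun u => plane_of_C (X u)).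
Proof.
move=> dX cX'.
have main (k : R[i] -> R) i :
    (forall z, plane_of_C z 0 i = k z) ->
    (forall (h : R -> R[i]) (t : R) l, rdv h t l -> is_derive t 1 (fun t => k (h t)) (k l)) ->
    (forall z w, `|k z - k w| <= cabs (z - w)) ->
    (forall t, derivable (fun s => plane_of_C (X s) 0 i) t 1) /\
    continuous (fun t => derive1 (fun s => plane_of_C (X s) 0 i) t).
  move=> ki kd kl; have -> : (fun s => plane_of_C (X s) 0 i) = (fun s => k (X s)).
    by apply/funext => s; exact: ki.
  have kX t := kd _ _ _ (dX t); split => [t|t]; first exact: (@ex_derive _ _ _ _ _ _ _ (kX t)).
  have -> : (fun t => derive1 (fun s => k (X s)) t) = (fun t => k (X' t)).
    by apply/funext => s; rewrite derive1E; exact: (@derive_val _ _ _ _ _ _ _ (kX s)).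
  apply/continuous_ltP => e e0; have [d d0 hd] := cX' t e e0; exists d => // s st.
  apply: le_lt_trans (kl _ _) _; apply: hd => //; by rewrite cabs_rc.
move=> i; have [->|->] := ord2P i.
  apply: (main (@complex.Re R)) => [z|h t l|z w]; first by rewrite mxE.
    exact: rdv_Re.
  by rewrite -raddfB Re_le_cabs.
apply: (main (@complex.Im R)) => [z|h t l|z w]; first by rewrite mxE.
  exact: rdv_Im.
by rewrite -raddfB Im_le_cabs.
Qed.

(** In the time coordinate the metric has coefficient [fnorm] times the squared modulus of the
    field. The segment is cut by [cousin] into pieces contained in single charts; the factor
    [trigo.pi] is the cost of a reparametrization. *)
Lemma flow_curve (F : R[i] -> T) (w0 w1 : R[i]) (M : R) : 0 <= M ->
  (forall t, seg 0 1 t -> flow_at B pi E p q F (lpt w0 w1 t)) ->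
  (forall t c, seg 0 1 t -> LA c -> cdom c (F (lpt w0 w1 t)) ->
     fnorm E c (cz c (F (lpt w0 w1 t))) * sqnormc (vf c (cz c (F (lpt w0 w1 t))))
     <= M ^+ 2) ->
  exists2 l, curve_length B lam (pi (F w0)) (pi (F w1)) l &
    l <= M * cabs (w1 - w0) * trigo.pi.
Proof.
move=> M0 Ff FM; pose l := lpt w0 w1; pose K := M * cabs (w1 - w0) * trigo.pi.
have pi0 : 0 <= trigo.pi :> R by exact: pi_ge0.
suff : exists2 k, curve_length B lam (pi (F (l 0))) (pi (F (l 1))) k & k <= K * (1 - 0).
  by rewrite /l lpt0 lpt1 subr0 mulr1.
apply: (@cousin R (fun s t => exists2 k,
  curve_length B lam (pi (F (l s))) (pi (F (l t))) k & k <= K * (t - s))).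
- exact: ler01.
- move=> s u t _ _ _ _ [k1 h1 k1K] [k2 h2 k2K]; exists (k1 + k2).
    exact: curve_cat h1 h2.
  lra.
move=> t0 t00 t01; have ht0 : seg 0 1 t0 by rewrite /seg /= t00.
have [z Bz zt] := Bcov (pi (F (l t0))).
have [c zc ct] := lifted_chart_exists cov zt.
have hc : LA c by exists z.
have cn : nbhs (F (l t0)) (cdom c) by apply: open_nbhs_nbhs; split => //; exact: cdom_open.
have [Fc _] := Ff t0 ht0; have [d d0 hd] := Fc _ cn.
have [e e0 he] := dervat_contat (@dervat_lpt R setT w0 w1 t0) d0.
exists e => // s t s0 st tt t1 ts.
have inst v : s <= v <= t -> seg 0 1 v /\ cdom c (F (l v)).
  move=> /andP[sv vt]; split; first by rewrite /seg /=; apply/andP; split; lra.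
  apply: hd; apply: he => //; rewrite cabs_rc ltr_norml; apply/andP; split; lra.
pose y v := cz c (F (l v)).
have dy v : s <= v <= t -> rdv y v (vf c (y v) * (w1 - w0)).
  move=> /inst [v01 cv]; have [_ Fd] := Ff v v01.
  by apply: (@rdv_comp _ (fun w => cz c (F w)) l); [exact: dervat_lpt|exact: Fd].
(* A curve has to be of class C1 on the whole line, whereas [F] is controlled on the segment only.
   This smooth parameter runs from [s] to [t] and never leaves [[s, t]]; its speed is at most
   [(t - s) * trigo.pi]. *)
pose a (u : R) := s + (t - s) * ((1 - cos (trigo.pi * u)) / 2).
pose a' (u : R) := (t - s) * (trigo.pi * sin (trigo.pi * u) / 2).
have ts0 : 0 <= t - s by lra.
have ai u : s <= a u <= t.
  have := cos_le1 (trigo.pi * u); have := cos_geN1 (trigo.pi * u) => h1 h2.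
  have b0 : 0 <= (1 - cos (trigo.pi * u)) / 2 by lra.
  have b1 : (1 - cos (trigo.pi * u)) / 2 <= 1 by lra.
  have := mulr_ge0 ts0 b0; have := ler_wpM2l ts0 b1; rewrite /a mulr1 => h3 h4.
  by apply/andP; split; lra.
have da (u : R) : rdv (fun u => (a u)%:C) u (a' u)%:C.
  apply/is_derive_rdv.
  have hm : is_derive u 1 (fun u : R => trigo.pi * u) (trigo.pi * 1).
    exact: is_deriveZ_fun (is_derive_id u 1).
  have hcos := is_derive1_comp (is_derive_cos (trigo.pi * u)) hm.
  have h := is_deriveD_fun (is_derive_cst s u 1) (is_deriveZ_fun (t - s)
    (is_deriveZ_fun 2^-1 (is_deriveD_fun (is_derive_cst (1 : R) u 1) (is_deriveZ_fun (-1) hcos)))).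
  have -> : a = (fun v => cst s v + (t - s) * (2^-1 * (cst 1 v + -1 *
      ((@cos R) \o (fun u : R => trigo.pi * u)) v))).
    by apply/funext => v; rewrite /a /=; field.
  by apply: (@is_derive_eq _ _ _ _ _ _ _ _ h); rewrite /a'; field.
pose X u := y (a u); pose X' u := vf c (X u) * (w1 - w0) * (a' u)%:C.
have dX u : rdv X u (X' u).
  by apply: (@dervat_comp _ _ _ _ rc setT setT a y) => //; apply: dy; exact: ai.
have XO u : cO c (X u) by apply: cz_cO; have [] := inst _ (ai u).
have cX' u : contat rc setT X' u.
  have c1 : contat rc setT (fun u => vf c (X u)) u.
    have [m hm] := vf_holo EL lform0 hc (XO u).
    by apply: (@contat_comp _ _ _ _ id setT setT X (vf c)) => //;
      [exact: dervat_contat (dX u)|exact: dervat_contat hm].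
  apply: contatM; first by apply: contatM => //; exact: contat_cst.
  have : continuous (a' : R -> R).
    move=> v; have hm : is_derive v 1 (fun u : R => trigo.pi * u) (trigo.pi * 1).
      exact: is_deriveZ_fun (is_derive_id v 1).
    have hsin := is_derive1_comp (is_derive_sin (trigo.pi * v)) hm.
    have h := is_deriveZ_fun (t - s) (is_deriveZ_fun (trigo.pi / 2) hsin).
    have -> : a' = (fun v => (t - s) * (trigo.pi / 2 *
        ((@sin R) \o (fun u : R => trigo.pi * u)) v)).
      by apply/funext => v'; rewrite /a' /=; field.
    exact/differentiable_continuous/derivable1_diffP/(@ex_derive _ _ _ _ _ _ _ h).
  move=> /(_ u) /continuous_ltP ca e1 e10; have [d1 d10 hd1] := ca e1 e10.
  by exists d1 => // v _; rewrite !cabs_rc; exact: hd1.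
pose g u := plane_of_C (X u).
have gC : C1_curve g := C1_curve_plane dX cX'.
have gE u : C_of_plane (g u) = X u by rewrite /g plane_of_CK.
have zX u := lifted_chart_point zc (XO u).
have gO u : u \in `[0, 1] -> ccod z (g u) by move=> _; have [] := zX u.
have gp u : cinv z (g u) = pi (F (l (a u))).
  rewrite -[LHS]/(ci z (X u)) -(zX u).2 /X /y ciK //.
  by have [] := inst _ (ai u).
have a0 : a 0 = s by rewrite /a mulr0 cos0; field.
have a1 : a 1 = t by rewrite /a mulr1 cospi; field.
have := curve_cons (curve_nil B lam (cinv z (g 0))) Bz gC gO erefl.
rewrite add0r !gp a0 a1 => cl; exists (arc_length (lam z) g) => //.
have [g' [dg cg' ->]] := C1_curveP gC.
have g'E u : g' u = X' u.
  apply: (@rdv_unique X u); last exact: dX.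
  by have := dg u; apply: dervat_eq => //; exists 1 => // v _ _.
apply: Rint_le.
  apply: (speed_conton cov EL lamE Bz dg cg') => u _; rewrite gE.
  by have [] := zX u.
move=> u u01; rewrite sqrtr_ge0 /=.
have -> : lam z (g u) = fnorm E c (X u) by exact: (lamC_lift EL lamE Bz zc (XO u)).
have [v01 cv] := inst _ (ai u).
have := FM _ c v01 hc cv; rewrite -/l -/(y (a u)) -/(X u) g'E /X'.
move: (vf c (X u)) => v hM; rewrite !sqnormcM.
have s1 : `|a' u| <= (t - s) * trigo.pi.
  rewrite /a' normrM ger0_norm // ler_wpM2l //.
  have : `|sin (trigo.pi * u)| <= 1 by rewrite ler_norml sin_geN1 sin_le1.
  rewrite !normrM (ger0_norm pi0) [`|2^-1|]ger0_norm ?invr_ge0 // => h.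
  have := ler_wpM2l pi0 h; rewrite mulr1; have := mulr_ge0 pi0 (normr_ge0 (sin (trigo.pi * u))).
  lra.
have Ka : 0 <= M * cabs (w1 - w0) * ((t - s) * trigo.pi).
  by rewrite !mulr_ge0 ?cabs_ge0.
rewrite (_ : K * (t - s) = M * cabs (w1 - w0) * ((t - s) * trigo.pi)); last by rewrite /K; ring.
rewrite -[X in _ <= X](ger0_norm Ka) -sqrtr_sqr ler_wsqrtr //.
rewrite [in X in _ <= X]exprMn [in X in _ <= X]exprMn [cabs _ ^+ 2]cabs_sq.
have q1 : sqnormc (a' u)%:C <= ((t - s) * trigo.pi) ^+ 2.
  by rewrite -cabs_sq cabs_real ler_pXn2r // ?nnegrE ?mulr_ge0.
have n := @sqnormc_ge0 R; rewrite [X in X <= _]mulrA [X in X * _ <= _]mulrA.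
have fn : 0 <= fnorm E c (X u) by rewrite addr_ge0 // n.
have fv := mulr_ge0 fn (n v); have nD := n (w1 - w0).
apply: ler_pM; [exact: mulr_ge0|exact: n|by rewrite ler_wpM2r|].
exact: q1.
Qed.

End FlowCurves.



(** * Exceptional values *)

(** If every element of [A] were among three given ones, [A] would inject into three elements. So a
    new element can be found as long as at most three have been chosen. *)
Lemma four_elements (X : eqType) (A : set X) : ~ (A #<= `I_3) ->
  exists a : nat -> X, (forall j, (j < 4)%N -> A (a j)) /\
    (forall i j, (i < 4)%N -> (j < 4)%N -> i <> j -> a i <> a j).
Proof.
move=> nA.
have out (a b c : X) : exists2 x, A x & [/\ x <> a, x <> b & x <> c].
  apply: contrapT => h; apply: nA.
  pose g x : nat := if x == a then 0%N else if x == b then 1%N else 2%N.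
  have hA x : A x -> [\/ x = a, x = b | x = c].
    move=> Ax; apply: contrapT => k; apply: h; exists x => //.
    by split=> e; apply: k; [constructor 1|constructor 2|constructor 3].
  have gi : {in A &, injective g}.
    move=> x y; rewrite !inE => /hA hx /hA hy; rewrite /g.
    by case: eqP => [->|xa]; case: eqP => [->|ya] //; case: eqP => [->|xb] //;
      case: eqP => [->|yb] // _; case: hx => // ->; case: hy => // ->.
  have := card_esym (inj_card_eq gi); rewrite card_eq_le => /andP[h1 _].
  apply: card_le_trans h1 _; apply: subset_card_le => _ [x _ <-] /=.
  by rewrite /g; case: eqP => //; case: eqP.
have [x0 _] : exists x : X, True.
  apply: contrapT => h; apply: nA; suff -> : A = set0 by exact: card_ge0.
  by apply/seteqP; split => // x _; apply: h; exists x.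
have [a Aa _] := out x0 x0 x0.
have [b Ab [ba _ _]] := out a a a.
have [c Ac [ca cb _]] := out a b b.
have [d Ad [da db dc]] := out a b c.
exists (fun j => nth a [:: a; b; c; d] j); split.
  by move=> [|[|[|[|]]]].
by move=> [|[|[|[|i]]]] [|[|[|[|j]]]] //= _ _ _; exact/nesym.
Qed.

(** * A vanishing Wronskian makes the ratio constant *)

Section LocallyConstant.
Variables (R : realType) (S T : topologicalType) (B : set (chart R S)).
Variables (pi : T -> S) (f nu : S -> 'M[R[i]]_2) (E : T -> 'M[R[i]]_2).
Variable (rho : T -> option R[i]).

Notation LA := (lifted_atlas pi B).

Hypothesis EL : legendrian_lift B pi f nu E.
Hypothesis LAc : forall t, exists2 c, LA c & cdom c t.
Hypothesis rhoE : canonical_ratio B pi E rho.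

Lemma quotient_constant (D : set R[i]) (a b : R[i] -> R[i]) (z0 : R[i]) :
  copen D -> holo D a -> holo D b -> D z0 -> b z0 != 0 ->
  (forall z, D z -> wronskian a b z = 0) ->
  exists2 d, 0 < d & forall z, disc z0 d z ->
    [/\ D z, b z != 0 & a z / b z = a z0 / b z0].
Proof.
move=> Do ah bh Dz0 b0 W0; have [r r0 hr] := Do z0 Dz0.
have [l bl] := bh z0 Dz0.
have b1 : 0 < cabs (b z0) by rewrite cabs_gt0.
have [d d0 hd] := dervat_contat bl b1.
exists (Num.min r d) => [|z]; first by rewrite lt_min r0.
have sub v : disc z0 (Num.min r d) v -> D v /\ b v != 0.
  rewrite /disc /= lt_min => /andP[/hr Dv vd]; split => //.
  by apply/eqP => bv; have := hd v Logic.I vd; rewrite bv sub0r cabsN ltxx.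
move=> hz; have [Dz bz] := sub z hz; split => //.
have c0 : disc z0 (Num.min r d) z0 by apply: disc_center; rewrite lt_min r0.
have h v : disc z0 (Num.min r d) v -> cdv (fun v => a v / b v) v 0.
  move=> /sub [Dv bv]; have av := cdvP (ah v Dv); have bv' := cdvP (bh v Dv).
  have := dervatM Logic.I av (dervatV Logic.I bv bv'); congr (dervat _ _ _ _ _).
  have -> : cd a v / b v + a v * (- cd b v / b v ^+ 2) = wronskian a b v / b v ^+ 2.
    by rewrite /wronskian; field.
  by rewrite W0 // mul0r.
have := @cmean_value _ (fun v => a v / b v) (fun=> 0) z0 z 0.
rewrite mul0r => k; apply/eqP; rewrite -subr_eq0 -cabs_eq0 eq_le cabs_ge0 andbT.
apply: k => t t01; last by rewrite cabs0.
by apply: h; exact: lpt_disc.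
Qed.

(** The derivative of a quotient is the Wronskian over the square of the denominator, so the ratio
    is locally constant, hence constant along paths. *)
Lemma ratio_constant :
  (forall c t, LA c -> cdom c t -> wrf E c (cz c t) = 0) ->
  (forall x y : T, exists g : R -> T,
     [/\ {within `[0, 1], continuous g}, g 0 = x & g 1 = y]) ->
  forall x y, rho x = rho y.
Proof.
move=> W0 pathc.
have loc (t0 : T) : nbhs t0 [set t | rho t = rho t0].
  have [c hc ct0] := LAc t0; set z0 := cz c t0.
  have z0O : cO c z0 by exact: cz_cO.
  have th := thm_coef_holo EL hc; have om := omm_coef_holo EL hc.
  have rE t : cdom c t -> rho t = quotient_of_forms (thm (coef E c) (cz c t))
      (omm (coef E c) (cz c t)).
    by move=> ct; rewrite (rhoE hc ct) (theta_thm EL hc ct) (omega_omm EL hc ct).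
  have W0' z : cO c z -> wronskian (thm (coef E c)) (omm (coef E c)) z = 0.
    by move=> cz; have := W0 c _ hc (ci_dom cz); rewrite czK.
  have W0'' z : cO c z -> wronskian (omm (coef E c)) (thm (coef E c)) z = 0.
    by move=> /W0' h; rewrite -[RHS]oppr0 -h /wronskian opprB (mulrC (cd _ _)) (mulrC (cd _ _)).
  (* At a pole the reciprocal quotient is used: it is locally constant with value zero, so the pole
     value persists nearby. *)
  have [om0|om0] := eqVneq (omm (coef E c) z0) 0.
    have th0 : thm (coef E c) z0 != 0.
      have [] := forms_neq0 EL hc ct0; first by rewrite (theta_thm EL hc ct0).
      by rewrite (omega_omm EL hc ct0) om0 eqxx.
    have [d d0 hd] := quotient_constant (@cO_open _ _ c) om th z0O th0 W0''.
    apply: filterS (cz_nbhs ct0 d0) => t [ct /hd [_ tn]].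
    rewrite om0 mul0r => /eqP; rewrite mulf_eq0 invr_eq0 (negbTE tn) orbF => o0.
    by rewrite /= (rE t ct) (rE t0 ct0) /quotient_of_forms o0 -/z0 om0 eqxx.
  have [d d0 hd] := quotient_constant (@cO_open _ _ c) th om z0O om0 W0'.
  apply: filterS (cz_nbhs ct0 d0) => t [ct /hd [_ on qE]].
  by rewrite /= (rE t ct) (rE t0 ct0) /quotient_of_forms (negbTE on) -/z0 (negbTE om0) qE.
move=> x y; have [g [gc <- <-]] := pathc x y.
apply: (@cousin R (fun s t => rho (g s) = rho (g t))).
- exact: ler01.
- by move=> s u t _ _ _ _ -> ->.
move=> t t0 t1; have t01 : `[0, 1]%classic t by rewrite /= in_itv /= t0.
move: gc => /subspace_continuousP gc; have := gc t t01 _ (loc (g t)).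
rewrite /within /= => /nbhs_ballP [d /= d0 hd].
have k s : 0 <= s -> s <= 1 -> `|s - t| < d -> rho (g s) = rho (g t).
  by move=> s0 s1 st; apply: hd; rewrite /ball /= ?in_itv /= ?s0 // distrC.
exists d => // s u s0 st tu u1 us.
have su := le_trans st tu.
rewrite (k s) ?(k u) ?(le_trans s0 su) ?(le_trans su u1) //.
  exact: dist_within st tu su (lexx u) us.
exact: dist_within st tu (lexx s) su us.
Qed.

End LocallyConstant.



Lemma bernoulli_ineq (R : realType) (h : R) n : 0 <= h -> 1 + n%:R * h <= (1 + h) ^+ n.
Proof.
move=> h0; elim: n => [|n IH]; first by rewrite mul0r addr0 expr0.
have n0 : 0 <= n%:R :> R by exact: ler0n.
have h1 : 0 <= 1 + h by lra.
have := ler_wpM2l h1 IH; rewrite -exprS; apply: le_trans.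
by rewrite -natr1; have := mulr_ge0 n0 (mulr_ge0 h0 h0); nra.
Qed.

Lemma last_true (A : nat -> Prop) K : A 0%N -> ~ A K -> exists k, A k /\ ~ A k.+1.
Proof.
move=> A0 nK; apply: contrapT => h.
suff : A K by [].
elim: K {nK} => // k Ak; apply: contrapT => nk; apply: h; by exists k.
Qed.

(** * Shrinking flow discs against completeness *)

Section Main.
Variables (R : realType) (S T : topologicalType) (B : set (chart R S)).
Variables (pi : T -> S) (f nu : S -> 'M[R[i]]_2) (E : T -> 'M[R[i]]_2).
Variables (p q : nat -> R[i]) (lam : chart R S -> 'rV[R]_2 -> R).

Notation LA := (lifted_atlas pi B).
Notation vf := (vfield E p q).
Notation flow_at := (flow_at B pi E p q).
Notation flows := (flows B pi E p q).

Hypothesis cov : covering_map pi.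
Hypothesis Bh : forall z w, B z -> B w -> holomorphic_trans z w.
Hypothesis EL : legendrian_lift B pi f nu E.
Hypothesis lform0 : forall c t j, LA c -> cdom c t -> (j < 4)%N ->
  lform E p q c j (cz c t) != 0.
Hypothesis lamE : is_ds11 B pi E lam.
Hypothesis Bcov : covers B.
Hypothesis hS : hausdorff_space S.
Hypothesis pq : forall i k, (i < 4)%N -> (k < 4)%N -> i <> k ->
  p i * q k - p k * q i != 0.

Lemma lifted_covers t : exists2 c, LA c & cdom c t.
Proof.
have [z Bz zt] := Bcov (pi t); have [c zc ct] := lifted_chart_exists cov zt.
by exists c => //; exists z.
Qed.

Let hT := covering_hausdorff cov hS.

Lemma metric_dist_lt (x y : S) (l e : R) : curve_length B lam x y l -> l < e ->
  (metric_dist B lam x y < e%:E)%E.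
Proof.
move=> xy le; apply: (@le_lt_trans _ _ l%:E); last by rewrite lte_fin.
by apply: ereal_inf_lbound; exists l.
Qed.

Lemma metric_dist_ltP (x y : S) (e : R) : (metric_dist B lam x y < e%:E)%E ->
  exists2 l, curve_length B lam x y l & l < e.
Proof. by move=> /ereal_inf_lt [_ [l xy <-]]; rewrite lte_fin; exists l. Qed.

Lemma flows_disc F (r : R) (w : R[i]) (d : R) : (forall v, disc 0 r v -> flow_at F v) ->
  cabs w + d <= r -> flows (F w) d.
Proof.
move=> Ff wd; exists (fun v => F (v - - w)); first by rewrite sub0r opprK.
move=> v hv; apply: flow_at_shift; apply: Ff; rewrite opprK /disc /= subr0.
by have := cabsD v w; rewrite /disc /= subr0 in hv; lra.
Qed.

(* [h] is the relative size of the collar by which a flow disc is enlarged *)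
Let h : R := 128^-1.

(** The radius is the last admissible term of a geometric progression of ratio [1 + h], which passes
    [r'] by Bernoulli's inequality. Maximality up to this factor is enough, and no disc of supremal
    radius has to be constructed. *)
Lemma flows_maximal t (r r' : R) : 0 < r -> flows t r -> ~ flows t r' ->
  exists r1, [/\ r <= r1, r1 < r', flows t r1 & ~ flows t ((1 + h) * r1)].
Proof.
move=> r0 tr ntr'; have h0 : 0 < h by rewrite invr_gt0.
have [K hK] : exists K, r' <= r * (1 + h) ^+ K.
  have [K KE] : exists K, r' / (r * h) <= K%:R :> R.
    by exists (Num.truncn (r' / (r * h))).+1; exact: ltW (truncnS_gt _).
  exists K; have := bernoulli_ineq K (ltW h0) => hb.
  have rh : 0 < r * h by rewrite mulr_gt0.
  move: KE; rewrite ler_pdivrMr // => KE.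
  by have := ler_wpM2l (ltW r0) hb; nra.
have nK : ~ flows t (r * (1 + h) ^+ K) by move=> k; apply: ntr'; exact: flows_sub k.
have A0 : flows t (r * (1 + h) ^+ 0) by rewrite expr0 mulr1.
have [k [Ak nAk]] := @last_true (fun k => flows t (r * (1 + h) ^+ k)) K A0 nK.
have p1 : 1 <= (1 + h) ^+ k by rewrite exprn_ege1 //; rewrite /h in h0 *; lra.
exists (r * (1 + h) ^+ k); split => //.
- by rewrite ler_peMr // ltW.
- by rewrite ltNge; apply/negP => k'; apply: ntr'; exact: flows_sub Ak.
- by rewrite exprS mulrCA in nAk.
Qed.

Lemma no_regular_point : complete_metric B lam ->
  forall t c, LA c -> cdom c t -> wrf E c (cz c t) = 0.
Proof.
move=> compl t0 c0 hc0 ct0; apply/eqP; apply: contraT => W0; exfalso.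
have h0 : 0 < h by rewrite invr_gt0.
have h128 : 128 * h = 1 by rewrite divff.
have [C C0 hC] := flows_estimate Bh EL lform0 hT lifted_covers pq.
have v0 : vf c0 (cz c0 t0) != 0.
  by rewrite mulf_neq0 ?invr_eq0 ?expf_neq0 // (prodL_neq0 lform0 hc0 (cz_cO ct0)).
pose N0 := fnorm E c0 (cz c0 t0) * sqnormc (vf c0 (cz c0 t0)).
have N00 : 0 < N0.
  by rewrite mulr_gt0 ?(fnorm_gt0 EL hc0 (cz_cO ct0)) // -cabs_sq exprn_gt0 // cabs_gt0.
(* With [N0] positive, the estimate [N0 ^+ 6 * r ^+ 10 <= C] fails for large [r]. *)
have [r' nr'] : exists r', ~ flows t0 r'.
  have N6 : 0 < N0 ^+ 6 by rewrite exprn_gt0.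
  have Cn : 0 < C / N0 ^+ 6 by rewrite divr_gt0.
  exists (C / N0 ^+ 6 + 1) => k.
  have r1 : 1 <= C / N0 ^+ 6 + 1 by lra.
  have := hC t0 _ c0 (lt_le_trans ltr01 r1) k hc0 ct0; rewrite -/(fnorm E c0 _) -/N0.
  apply/negP; rewrite -ltNge.
  apply: (@lt_le_trans _ _ (N0 ^+ 6 * (C / N0 ^+ 6 + 1))).
    by rewrite mulrDr mulrCA divff ?gt_eqF // !mulr1; lra.
  by rewrite ler_pM2l // -{1}[C / N0 ^+ 6 + 1]expr1 ler_weXn2l.
have [e0 e00 /nbhs_singleton fl0] := flows_local Bh EL lform0 lifted_covers t0.
have [r0 [er0 _ fr0 nfr0]] := flows_maximal e00 fl0 nr'.
have r00 : 0 < r0 by exact: lt_le_trans er0.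
pose P n (x : T * R) := [/\ 0 < x.2, flows x.1 x.2, ~ flows x.1 ((1 + h) * x.2) &
  x.2 <= r0 * 64^-1 ^+ n].
pose Q (n : nat) (x y : T * R) := exists F w, [/\ F 0 = x.1,
  forall v, disc 0 x.2 v -> flow_at F v, cabs w <= (1 - h) * x.2 & F w = y.1].
have P0 : P 0%N (t0, r0) by split => //=; rewrite expr0 mulr1.
have step n x : P n x -> exists2 y, P n.+1 y & Q n x y.
  move=> [x20 [F F0 Ff] nfx xr].
  (* Were radius [2 * h * x.2] available at all centers, the disc could be enlarged. The new radius
     thus lies between [h * x.2], available inside the old disc, and [2 * h * x.2]. *)
  have [w wr nw] : exists2 w, cabs w <= (1 - h) * x.2 & ~ flows (F w) (2 * h * x.2).
    apply: contrapT => k; apply: nfx; rewrite -F0.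
    apply: (flows_extend EL lform0 hT lifted_covers x20 h0) => //.
      by rewrite /h in h0 h128 *; lra.
    by move=> w hw; apply: contrapT => nf; apply: k; exists w.
  have hx0 : 0 < h * x.2 by rewrite mulr_gt0.
  have fw : flows (F w) (h * x.2) by apply: flows_disc Ff _; lra.
  have [r1 [hr1 r1r fr1 nfr1]] := flows_maximal hx0 fw nw.
  exists (F w, r1); last by exists F, w.
  split => //=; first exact: lt_le_trans hr1.
  rewrite exprS; apply: ltW; apply: lt_le_trans r1r _.
  (* The reason for [h = 1/128]: the radii shrink by [64 = 2 ^ 6] at least, so lengths of order
     [r^(1/6)] are dominated by powers of [1/2]. *)
  have -> : 2 * h = 64^-1 :> R by rewrite /h; field.
  by rewrite mulrCA ler_wpM2l // invr_ge0.
(* Chosen so that [M := D0 * a / r], with [a = 2^-1 ^+ n] and [r <= r0 * a ^+ 6], satisfies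
   [C <= M ^+ 12 * (h * r) ^+ 10]. The speed of the flow is then at most [M] at every point that is
   the center of a flow disc of radius [h * r], and lengths are at most a multiple of [M * r], that
   is of [a]. *)
pose D0 := 1 + C * r0 ^+ 2 / h ^+ 10.
have D01 : 1 <= D0 by rewrite lerDl !mulr_ge0 ?invr_ge0 ?exprn_ge0 ?(ltW C0) ?(ltW h0) ?(ltW r00).
have D0C : C * r0 ^+ 2 <= D0 ^+ 12 * h ^+ 10.
  have h10 : 0 < h ^+ 10 by rewrite exprn_gt0.
  rewrite -ler_pdivrMr //; apply: (@le_trans _ _ D0); first by rewrite lerDr.
  by rewrite -{1}[D0]expr1 ler_weXn2l.
pose L := D0 * 2 * trigo.pi.
have pi0 : 0 <= trigo.pi :> R by exact: pi_ge0.
have L0 : 0 <= L by rewrite !mulr_ge0 //; lra.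
have curve n (x : T * R) F (v v' : R[i]) : P n x ->
    (forall w, disc 0 x.2 w -> flow_at F w) ->
    cabs v <= (1 - h) * x.2 -> cabs v' <= (1 - h) * x.2 ->
    exists2 l, curve_length B lam (pi (F v)) (pi (F v')) l & l <= L * 2^-1 ^+ n.
  move=> [x20 _ _ xr] Ff hv hv'; set r := x.2 in x20 xr Ff hv hv'.
  have a0 := exp_half_gt0 R n; set a := 2^-1 ^+ n in a0 *.
  have ra : r <= r0 * a ^+ 6.
    apply: le_trans xr _; rewrite ler_wpM2l ?(ltW r00) // /a -exprM mulnC exprM.
    have -> // : 2^-1 ^+ 6 = 64^-1 :> R; by field.
  pose M := D0 * a / r.
  have M0 : 0 <= M by rewrite !mulr_ge0 ?invr_ge0 ?ltW //; lra.
  have hr0 : 0 < h * r by rewrite mulr_gt0.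
  have sub w : cabs w <= (1 - h) * r -> disc 0 r w.
    by rewrite /disc /= subr0 => hw; lra.
  have mid t : seg 0 1 t -> cabs (lpt v v' t) <= (1 - h) * r.
    by move=> t01; rewrite -[lpt _ _ _]subr0; apply: lpt_ball; rewrite ?subr0.
  have CM : C <= (M ^+ 2) ^+ 6 * (h * r) ^+ 10.
    have rn0 : r != 0 by rewrite gt_eqF.
    have -> : (M ^+ 2) ^+ 6 * (h * r) ^+ 10 = D0 ^+ 12 * h ^+ 10 * a ^+ 12 / r ^+ 2.
      by rewrite /M; field.
    rewrite ler_pdivlMr ?exprn_gt0 //.
    apply: (@le_trans _ _ (C * (r0 * a ^+ 6) ^+ 2)).
      by rewrite ler_wpM2l ?(ltW C0) // ler_pXn2r // ?nnegrE ?(ltW x20) // (le_trans (ltW x20)).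
    rewrite exprMn -exprM mulrA ler_wpM2r // exprn_ge0 //; exact: ltW.
  have [t /mid /sub|t c t01 hc ct|l lc ll] :=
    @flow_curve _ _ _ _ _ f nu _ _ _ _ cov EL lform0 lamE Bcov F v v' M M0.
  - exact: Ff.
  - have hm := mid t t01.
    have fw : flows (F (lpt v v' t)) (h * r) by apply: flows_disc Ff _; lra.
    have := le_trans (hC _ _ c hr0 fw hc ct) CM; rewrite -/(fnorm E c _).
    rewrite ler_pM2r ?exprn_gt0 // ler_pXn2r // ?nnegrE ?exprn_ge0 //.
    by rewrite mulr_ge0 ?sqnormc_ge0 // addr_ge0 // sqnormc_ge0.
  - exists l => //; apply: (le_trans ll).
    have vv : cabs (v' - v) <= 2 * r.
      by have := cabsD v' (- v); rewrite cabsN; lra.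
    rewrite (_ : L * a = M * (2 * r) * trigo.pi); last first.
      by rewrite /L /M; field; rewrite gt_eqF.
    by rewrite ler_wpM2r // ler_wpM2l.
have [u [_ uP uQ]] := dependent_choice P0 step.
have zr n : cabs 0 <= (1 - h) * (u n).2.
  by have [x20 _ _ _] := uP n; rewrite cabs0; apply: mulr_ge0; rewrite ?(ltW x20) // /h in h128 *; lra.
(* Curves in both directions are carried along, because the Cauchy condition involves the distance
   in both orders. The bound telescopes the sum of the [L * 2^-1 ^+ j] from [m] to [m + k - 1]. *)
have chain m k : (exists2 l, curve_length B lam (pi (u m).1) (pi (u (m + k)%N).1) l &
      l <= 2 * L * (2^-1 ^+ m - 2^-1 ^+ (m + k))) /\
    (exists2 l, curve_length B lam (pi (u (m + k)%N).1) (pi (u m).1) l &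
      l <= 2 * L * (2^-1 ^+ m - 2^-1 ^+ (m + k))).
  elim: k => [|k [[l1 c1 b1] [l2 c2 b2]]].
    by rewrite addn0 subrr mulr0; split; exists 0 => //; exact: curve_nil.
  have [F [w [F0 Ff wr Fw]]] := uQ (m + k)%N.
  have [l3 c3 b3] := curve _ _ _ _ _ (uP (m + k)%N) Ff (zr _) wr.
  have [l4 c4 b4] := curve _ _ _ _ _ (uP (m + k)%N) Ff wr (zr _).
  rewrite F0 Fw in c3 c4; rewrite addnS exp_halfS; split.
    by exists (l1 + l3); [exact: curve_cat c1 c3|lra].
  by exists (l4 + l2); [exact: curve_cat c4 c2|lra].
have mono m n : (m <= n)%N -> 2^-1 ^+ n <= 2^-1 ^+ m :> R.
  by move=> mn; apply: ler_wiXn2l => //; rewrite ?invr_ge0 // invf_le1 // ler1n.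
have L20 : 0 <= 2 * L by lra.
have chain' m n : (m <= n)%N ->
    (exists2 l, curve_length B lam (pi (u m).1) (pi (u n).1) l & l <= 2 * L * 2^-1 ^+ m) /\
    (exists2 l, curve_length B lam (pi (u n).1) (pi (u m).1) l & l <= 2 * L * 2^-1 ^+ m).
  move=> /subnKC <-; have [[l1 c1 b1] [l2 c2 b2]] := chain m (n - m)%N.
  have k0 : 0 <= 2 * L * 2^-1 ^+ (m + (n - m)).
    exact: mulr_ge0 L20 (ltW (exp_half_gt0 _ _)).
  by split; [exists l1|exists l2] => //; lra.
have small (e K : R) : 0 < e -> 0 <= K -> exists N, forall n, (N <= n)%N -> K * 2^-1 ^+ n < e.
  move=> ep K0; have [|N hN] := @exp_half_small R (e / (K + 1)).
    by rewrite divr_gt0 //; lra.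
  move: hN; rewrite ltr_pdivlMr; last by lra.
  move=> hN; exists N => n /mono nN; have := exp_half_gt0 R n.
  have := ler_wpM2l K0 nN; have := exp_half_gt0 R N; lra.
have [|s hs] := compl (fun n => pi (u n).1).
  move=> e ep; have [N hN] := small e (2 * L) ep L20.
  exists N => m n Nm Nn; have [mn|/ltnW nm] := leqP m n.
    have [[l c1 b1] _] := chain' m n mn.
    exact: metric_dist_lt c1 (le_lt_trans b1 (hN m Nm)).
  have [_ [l c1 b1]] := chain' n m nm.
  exact: metric_dist_lt c1 (le_lt_trans b1 (hN n Nn)).
(* The whole closed disc of radius [(1 - h) * (u n).2] is mapped close to [s], not only its center;
   this allows the sheet to be followed from one center to the next. *)
have near_s (e : R) : 0 < e -> exists N, forall n F w, (N <= n)%N ->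
    F 0 = (u n).1 -> (forall v, disc 0 (u n).2 v -> flow_at F v) ->
    cabs w <= (1 - h) * (u n).2 -> F w = (u n.+1).1 ->
    forall x, cabs x <= (1 - h) * (u n).2 ->
    exists2 l, curve_length B lam (pi (F x)) s l & l < e.
  move=> ep; have e2 : 0 < e / 2 by lra.
  have [N hN] := small _ (2 * L) e2 L20; have [K hK] := hs _ e2.
  exists N => n F w Nn F0 Ff wr Fw x xr.
  have [l1 c1 b1] := curve _ _ _ _ _ (uP n) Ff xr wr; rewrite Fw in c1.
  have [[l2 c2 b2] _] := chain' n.+1 (maxn K n.+1) (leq_maxr _ _).
  have [l3 c3 b3] := metric_dist_ltP (hK _ (leq_maxl K n.+1)).
  exists (l1 + l2 + l3); first exact: curve_cat (curve_cat c1 c2) c3.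
  have := hN n Nn; rewrite exp_halfS in b2; lra.
(* The limit [s] is a point of the surface. An evenly covered neighborhood of it is used to find the
   limit on the cover. *)
have [pic _ /(_ s) [U [Uo Us [I [V [Vtriv VU hV]]]]]] := cov.
have sep := metric_separates cov Bh EL lform0 lamE hS Bcov.
have [eU eU0 heU] := sep s U (open_nbhs_nbhs (conj Uo Us)).
have [N1 hN1] := near_s eU eU0.
have inU n F w x : (N1 <= n)%N -> F 0 = (u n).1 ->
    (forall v, disc 0 (u n).2 v -> flow_at F v) ->
    cabs w <= (1 - h) * (u n).2 -> F w = (u n.+1).1 ->
    cabs x <= (1 - h) * (u n).2 -> exists i, V i (F x).
  move=> Nn F0 Ff wr Fw xr; have [l c1 b1] := hN1 n F w Nn F0 Ff wr Fw x xr.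
  have Ux : (pi @^-1` U) (F x) by exact: heU c1 b1.
  by rewrite VU in Ux; have [i _ Vi] := Ux; exists i.
have [F1 [w1 [F10 F1f w1r F1w]]] := uQ N1.
have [i Vi] := inU N1 F1 w1 0 (leqnn _) F10 F1f w1r F1w (zr N1).
rewrite F10 in Vi.
(* Along the segment joining consecutive centers every point lies over [U], hence in some sheet.
   Sheets are open and disjoint, so the sheet cannot change. *)
have allV k : V i (u (N1 + k)%N).1.
  elim: k => [|k Vk]; first by rewrite addn0.
  have [F [w [F0 Ff wr Fw]]] := uQ (N1 + k)%N; set n := (N1 + k)%N in F0 Ff wr Fw Vk.
  rewrite addnS -/n -Fw; move: Vk; rewrite -F0 -{1}(lpt0 0 w) -{2}(lpt1 0 w).
  have xr t : seg 0 1 t -> cabs (lpt 0 w t) <= (1 - h) * (u n).2.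
    by move=> t01; rewrite -[lpt _ _ _]subr0; apply: lpt_ball; rewrite ?subr0 ?zr.
  suff k2 : V i (F (lpt 0 w 0)) <-> V i (F (lpt 0 w 1)) by move=> /k2.
  apply: (@cousin R (fun a b => V i (F (lpt 0 w a)) <-> V i (F (lpt 0 w b)))).
  - exact: ler01.
  - by move=> a b c _ _ _ _ k1 k2; rewrite k1.
  move=> t t00 t01; have ht : seg 0 1 t by rewrite /seg /= t00.
  have [j Vj] := inU n F w _ (leq_addr _ _) F0 Ff wr Fw (xr t ht).
  have [Vjo _ _] := hV j.
  have un0 : 0 < (u n).2 by have [] := uP n.
  have [Fc _] : flow_at F (lpt 0 w t).
    by apply: Ff; rewrite /disc /= subr0; apply: le_lt_trans (xr t ht) _; have := mulr_gt0 h0 un0; lra.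
  have [d d0 hd] := Fc _ (open_nbhs_nbhs (conj Vjo Vj)).
  have [e1 e10 he1] := dervat_contat (@dervat_lpt R setT 0 w t) d0.
  have nr a : `|a - t| < e1 -> V j (F (lpt 0 w a)).
    by move=> at_; apply: hd; apply: he1 => //; rewrite cabs_rc.
  have iff a : `|a - t| < e1 -> V i (F (lpt 0 w a)) <-> i = j.
    move=> /nr Va; split=> [Vi'|-> //]; apply: Vtriv => //.
    by exists (F (lpt 0 w a)).
  exists e1 => // a b _ at_ tb _ ab.
  by rewrite !iff //; apply: (dist_within at_ tb _ _ ab) => //; exact: (le_trans at_ tb).
have [Vio [_ Vinj Vsurj] Vopen] := hV i.
(* The lift of [s] in the sheet containing all the centers from [N1] on: it is their limit on the
   cover, and flow discs of a fixed radius [e1] exist around it. *)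
have [tt Vt pt] := Vsurj s Us.
have [e1 e10 ne1] := flows_local Bh EL lform0 lifted_covers tt.
set G := [set t | flows t e1] in ne1.
have Oo : open (interior G `&` V i) by apply: openI => //; exact: open_interior.
have pOo := Vopen _ Oo (@subIsetr _ _ _).
have sO : nbhs s (pi @` (interior G `&` V i)).
  by apply: open_nbhs_nbhs; split => //; exists tt.
have [e2 e20 he2] := sep s _ sO.
have [N2 hN2] := near_s e2 e20.
have hr0 : 0 <= (1 + h) * r0 by rewrite mulr_ge0 ?(ltW r00) //; lra.
have [N3 hN3] := small e1 _ e10 hr0.
(* Large enough for the center to lie in the sheet, to be close to [tt], and for
   [(1 + h) * (u n).2 < e1], which contradicts the failure of the flow at radius
   [(1 + h) * (u n).2]. *)
pose n := (N1 + (N2 + N3))%N.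
have [F [w [F0 Ff wr Fw]]] := uQ n.
have N2n : (N2 <= n)%N by rewrite /n addnCA leq_addr.
have N3n : (N3 <= n)%N by rewrite /n addnA leq_addl.
have [l c1 b1] := hN2 n F w N2n F0 Ff wr Fw 0 (zr n).
have [x [Gx Vx] px] := he2 _ _ c1 b1.
have xn : x = (u n).1.
  by rewrite -F0; apply: Vinj; rewrite ?inE //; rewrite F0; exact: allV.
have fx : flows (u n).1 e1 by rewrite -xn; exact: interior_subset Gx.
have [_ _ nfl rn] := uP n.
apply: nfl; apply: flows_sub fx; apply: ltW; apply: le_lt_trans (hN3 n N3n).
rewrite -mulrA ler_wpM2l //; first by rewrite addr_ge0 // ltW.
apply: (le_trans rn); rewrite ler_wpM2l ?(ltW r00) //.
by apply: lerXn2r; rewrite ?nnegrE ?invr_ge0 // lef_pV2 ?posrE // ler_nat.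
Qed.

End Main.

Theorem theorem4p5 (R : realType) (S : topologicalType) (A B : set (chart R S))
  (f nu : S -> 'M[R[i]]_2)
  (T : topologicalType) (pi : T -> S) (E : T -> 'M[R[i]]_2)
  (rho : T -> option R[i])
  (S_surface : oriented_surface A)
  (f_flat : flat_front A f nu)
  (pi_universal : universal_covering R pi)
  (B_complex : complex_structure A B)
  (E_lift : legendrian_lift B pi f nu E)
  (f_complete : weakly_complete B pi E)
  (rho_ratio : canonical_ratio B pi E rho)
  (rho_nonconstant : ~ (exists a, forall t, rho t = a)) :
  ([set: option R[i]] `\` range rho) #<= `I_3.
Proof.
apply: contrapT => /four_elements [al [alA alD]].
have [cov [Tpath _]] := pi_universal.
have hS := surface_hausdorff S_surface.
have Bcov := complex_covers B_complex; have Bh := complex_holomorphic B_complex.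
have [lam lamE compl] := f_complete.
(* An omitted finite value [a] gives the form [theta - a * omega], and an omitted pole gives
   [omega]. *)
pose p j : R[i] := if al j is Some _ then 1 else 0.
pose q j : R[i] := if al j is Some a then - a else 1.
have pq i k : (i < 4)%N -> (k < 4)%N -> i <> k -> p i * q k - p k * q i != 0.
  move=> i4 k4 ik; have := alD i k i4 k4 ik; rewrite /p /q.
  case: (al i) => [a|]; case: (al k) => [b|] // ab.
  - rewrite !mul1r opprK addrC subr_eq0; apply/eqP => e; apply: ab; by rewrite e.
  - by rewrite !mul1r mul0r subr0 oner_neq0.
  - by rewrite mul0r mul1r sub0r oppr_eq0 oner_neq0.
have lform0 c t j : lifted_atlas pi B c -> cdom c t -> (j < 4)%N ->
    lform E p q c j (cz c t) != 0.
  move=> hc ct j4; have [_ nr] := alA j j4; apply/eqP => l0; apply: nr.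
  exists t => //; rewrite (rho_ratio c t hc ct) /quotient_of_forms.
  move: l0; rewrite /lform -(theta_thm E_lift hc ct) -(omega_omm E_lift hc ct) /p /q.
  case: (al j) => [a|]; last by rewrite mul0r mul1r add0r => ->; rewrite eqxx.
  rewrite mul1r mulNr => /eqP; rewrite subr_eq0 => /eqP tE.
  (* With [omega = 0], the relation would give [theta = 0] as well, and the two forms have no common
     zero. *)
  have [om0|om0] := eqVneq (omega E c t) 0; last by rewrite tE mulfK.
  by have [ | ] := forms_neq0 E_lift hc ct; rewrite ?tE om0 ?mulr0 eqxx.
have W0 := no_regular_point cov Bh E_lift lform0 lamE Bcov hS pq compl.
have LAc := lifted_covers cov Bcov.
have rho_cst := ratio_constant E_lift LAc rho_ratio (fun c t => W0 t c) Tpath.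
apply: rho_nonconstant; have [[t _]|nT] := pselect (exists t : T, True).
  by exists (rho t) => t'; exact: rho_cst.
(* On an empty cover any value witnesses constancy. *)
by exists None => t; exfalso; apply: nT; exists t.
Qed.
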